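(* Let $k$ be a field and let $(A,m_\bullet)$ be a filtered $A_\infty$-algebra over $k$, with filtration $\{F^pA\}_{p\in\mathbb{Z}}$, provided with a compatible bigrading of $0$-th type. Then the multiplicative spectral sequence associated to the filtration is enhanced with an $A_\infty$-algebra structure (that is, it has an $A_\infty$-enhancement).
   Context: Conventions: $\mathbb{N}$ is the set of positive integers, $\mathbb{N}_0=\mathbb{N}\cup\{0\}$, $\otimes=\otimes_k$, and the Koszul sign rule (for the total/cohomological degree) is used. $A_\infty$-algebras. An $A_\infty$-algebra is a graded module $A$ with linear maps $m_i:A^{\otimes i}\to A$ of degree $2-i$, $i\in\mathbb{N}$, with $\sum_{r+s+t=n,\ r,t\ge0,\ s\ge1}(-1)^{r+st}m_{r+1+t}\circ(\mathrm{id}^{\otimes r}\otimes m_s\otimes\mathrm{id}^{\otimes t})=0$ for all $n\in\mathbb{N}$; dg algebras are the case $m_i=0$ for $i\ge3$. A morphism $f_\bullet:A\to B$ is a family $f_i:A^{\otimes i}\to B$ of degree $1-i$ with $\sum_{r+s+t=n}(-1)^{r+st}f_{r+1+t}\circ(\mathrm{id}^{\otimes r}\otimes m^A_s\otimes\mathrm{id}^{\otimes t})=\sum_{q}\sum_{i_1+\dots+i_q=n,\ i_j\ge1}(-1)^{w}m^B_q\circ(f_{i_1}\otimes\dots\otimes f_{i_q})$, $w=\sum_j(q-j)(i_j-1)$, for all $n$; it is a quasi-isomorphism if $f_1$ is one for the differentials $m_1$. For $s\in\mathbb{N}_0$, a compatible bigrading of $s$-th type on $A$ is a decomposition $A=\bigoplus_{p,q\in\mathbb{Z}}A^{p,q}$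 with $A^n=\bigoplus_pA^{p,n-p}$ and $m_n$ of bidegree $(2-n)(s,-s+1)$; a morphism is compatible with bigradings if $f_n$ has bidegree $(1-n)(s,-s+1)$. A model on $H^\bullet(A)=\ker m_1/\mathrm{Im}\,m_1$, compatible with the bigrading, is an $A_\infty$-structure $\{\bar m_n\}$ with $\bar m_1=0$, $\bar m_2$ induced by $m_2$, $\bar m_n$ of bidegree $(2-n)(s,-s+1)$, together with a quasi-isomorphism $H^\bullet(A)\to A$ compatible with the bigradings whose first component is a section of $\ker m_1\to H^\bullet(A)$ followed by inclusion into $A$; such models exist. Filtered $A_\infty$-algebras. A filtered $A_\infty$-algebra is an $A_\infty$-algebra $A$ with a decreasing filtration by graded submodules $F^pA$, $p\in\mathbb{Z}$, with $m_n(F^{p_1}A\otimes\dots\otimes F^{p_n}A)\subseteq F^{p_1+\dots+p_n}A$ for all $n$ and $p_i$; it is assumed exhaustive ($\bigcup_pF^pA=A$) and graded complete ($A\to\varprojlim_qA/F^qA$ is an isomorphism, with limit in graded modules). Spectral sequences. A multiplicative spectral sequence consists, for $r\in\mathbb{N}$, of bigraded dg algebras $(E_r,d_r,\mu_r)$, $E_r=\bigoplus_{p,q\in\mathbb{Z}}E_r^{p,q}$, $d_r$ of bidegree $(r,1-r)$ with $d_r^2=0$, $\mu_r$ associative of bidegree $(0,0)$, $d_r$ a derivation for the total degree, together with isomorphisms of bigraded algebras $i_r:H(E_r,d_r)\to E_{r+1}$. An isomorphism of such is a family of isomorphisms of bigraded algebras commuting with all $d_r$ and $i_r$. The multiplicative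 spectral sequence associated to the filtration of $A$ is the usual one of the filtered complex $(A,m_1)$: it is the spectral sequence starting at $1$ of the exact couple obtained from the long exact cohomology sequence of $0\to\bigoplus_pF^pA\otimes k\hbar^{-p}\xrightarrow{\hbar}\bigoplus_pF^pA\otimes k\hbar^{-p}\to\bigoplus_pF^pA/F^{p+1}A\to0$, where $F^pA^{p+q}\otimes k\hbar^{-p}$ and $F^pA^{p+q}/F^{p+1}A^{p+q}$ are in bidegree $(p,q)$ and the differentials are induced by $m_1$; so $E_1^{p,q}=H^{p+q}(F^pA/F^{p+1}A)$. Its products are those induced by $m_2$. Formal bigraded deformations. $k[\hbar]$ is bigraded with $\hbar$ in bidegree $(-1,1)$. For a bigraded $k[\hbar]$-module $M$ its bigraded completion is $\varprojlim_N M\otimes_{k[\hbar]}k[\hbar]/(\hbar^N)$ in bigraded modules; $\hat\otimes^{\mathrm{bgr}}_{k[\hbar]}$ is the bigraded completion of $\otimes_{k[\hbar]}$; $V[[\hbar]]^{\mathrm{bgr}}=\bigoplus_{p,q}\prod_{r\ge0}(V^{p+r,q-r}\otimes k\hbar^r)$ is the bigraded completion of $V\otimes k[\hbar]$. A formal bigraded deformation $B_\hbar$ of an $A_\infty$-algebra $(B,m_\bullet)$ with compatible bigrading of $s$-th type is $B[[\hbar]]^{\mathrm{bgr}}$ with $k[\hbar]$-linear maps $\tilde m_n:B_\hbar^{\hat\otimes^{\mathrm{bgr}}_{k[\hbar]}n}\to B_\hbar$ of bidegree $(2-n)(s,-s+1)$ whose reductions modulo $\hbar^{N+1}$ form an $A_\infty$-algebra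 over $k[\hbar]/(\hbar^{N+1})$ for every $N\in\mathbb{N}$ and whose reductions modulo $\hbar$ are the $m_n$. One writes $\tilde m_n|_{B^{\otimes n}}=\sum_{j\ge0}m_n^j\hbar^j$. A quasi-isomorphism of formal bigraded deformations $B_\hbar\to C_\hbar$ is a family of $k[\hbar]$-linear maps $\tilde f_n:B_\hbar^{\hat\otimes^{\mathrm{bgr}}_{k[\hbar]}n}\to C_\hbar$ of bidegree $(1-n)(s,-s+1)$ whose reductions modulo every $\hbar^{N+1}$ form a morphism of $A_\infty$-algebras over $k[\hbar]/(\hbar^{N+1})$, with reduction $f_\bullet:B\to C$ modulo $\hbar$, such that $f_1$ and $\tilde f_1$ are quasi-isomorphisms. $A_\infty$-enhancements. If $C$ is a minimal $A_\infty$-algebra ($m_1=0$) with compatible bigrading of $s$-th type and formal bigraded deformation $(C_\hbar,\tilde m_\bullet)$, let $\mathrm{P}(C_\hbar)$ be the dg algebra with underlying bigraded module $C$, product $m_2$ and differential $m_1^1$ (the coefficient of $\hbar$ in $\tilde m_1|_C$); it has a compatible bigrading of $(s+1)$-th type. Let $\mathrm{T}(C_\hbar)$ be the $k[\hbar]$-module $C_\hbar$ with structure maps $\hbar^{i-2}\tilde m_i$, $i\in\mathbb{N}$ (well defined for $i=1$ since $m_1^0=0$); it is a formal bigraded deformation of $\mathrm{P}(C_\hbar)$. Let ${}^0B$ be an $A_\infty$-algebra with compatible bigrading of $0$-th type and ${}^0B_\hbar$ a formal bigraded deformation of it. Given ${}^rB$ (compatible bigrading of $r$-th type) and a formal bigraded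 deformation ${}^rB_\hbar$ of it, choose a model on $H^\bullet({}^rB)$ compatible with the bigrading and a formal bigraded deformation $H^\bullet({}^rB)_\hbar$ of this model together with a quasi-isomorphism of formal bigraded deformations $H^\bullet({}^rB)_\hbar\to{}^rB_\hbar$ reducing modulo $\hbar$ to a quasi-isomorphism $H^\bullet({}^rB)\to{}^rB$ belonging to the model (these exist), and put ${}^{r+1}B=\mathrm{P}(H^\bullet({}^rB)_\hbar)$, ${}^{r+1}B_\hbar=\mathrm{T}(H^\bullet({}^rB)_\hbar)$. The dg algebras $\{{}^rB\}_{r\in\mathbb{N}}$, with the identifications of $H^\bullet({}^rB)$ with the underlying algebra of ${}^{r+1}B$, form a multiplicative spectral sequence, called the multiplicative spectral sequence associated to the formal bigraded deformation ${}^0B_\hbar$ of ${}^0B$. A multiplicative spectral sequence is enhanced with an $A_\infty$-algebra structure (has an $A_\infty$-enhancement) if it is obtained, up to isomorphism of multiplicative spectral sequences, by this procedure from some formal bigraded deformation ${}^0B_\hbar$ of some $A_\infty$-algebra ${}^0B$ with a compatible bigrading of $0$-th type. *)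

(* Defs.v *)
From HB Require Import structures.
From mathcomp Require Import all_boot all_order all_algebra.
From mathcomp Require Import mathcomp_extra boolp classical_sets functions.
From mathcomp Require Import cardinality fsbigop.
From mathcomp Require Import zify ring.

Set Implicit Arguments.
Unset Strict Implicit.
Unset Printing Implicit Defensive.
Import Order.TTheory GRing.Theory Num.Theory.
Local Open Scope ring_scope.

Section Submodules.
Variables (k : fieldType) (V : lmodType k).

Section SubmodOf.
Variables (P : V -> Prop) (P0 : P 0)
  (PD : forall a x y, P x -> P y -> P (a *: x + y)).
Definition submod_pred : {pred V} := fun x => `[< P x >].
Lemma submod_pred_closed : submod_closed submod_pred.
Proof.
split; first exact/asboolP.
by move=> a x y /asboolP Px /asboolP Py; apply/asboolP; apply: PD.
Qed.
HB.instance Definition _ :=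
  GRing.isSubmodClosed.Build k V submod_pred submod_pred_closed.
Definition submod_of : submodClosed V := submod_pred.
End SubmodOf.

Lemma submod_ofP (P : V -> Prop) x : reflect (P x) (x \in submod_pred P).
Proof. exact: asboolP. Qed.

Section MkLinear.
Variables (W : lmodType k) (f : V -> W) (fL : linear f).
Definition mklin_fun of linear f := f.
HB.instance Definition _ := GRing.isLinear.Build k V W *:%R (mklin_fun fL) fL.
Definition mklin : {linear V -> W} := mklin_fun fL.
End MkLinear.

Section Closure.
Variable S : submodClosed V.
Lemma sm0 : 0 \in S. Proof. exact: rpred0. Qed.
Lemma smD x y : x \in S -> y \in S -> x + y \in S. Proof. exact: rpredD. Qed.
Lemma smZ a x : x \in S -> a *: x \in S. Proof. exact: rpredZ. Qed.
Lemma smN x : x \in S -> - x \in S.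
Proof. by move=> xS; rewrite -scaleN1r smZ. Qed.
Lemma smB x y : x \in S -> y \in S -> x - y \in S.
Proof. by move=> xS yS; rewrite smD ?smN. Qed.
Lemma sm_sum (J : Type) (s : seq J) (f : J -> V) :
  (forall j, f j \in S) -> \sum_(j <- s) f j \in S.
Proof. by move=> fS; apply: rpred_sum => j _. Qed.
End Closure.

Section SubType.
Variable S : submodClosed V.
Record subm := Subm { subm_val : V; subm_valP : subm_val \in S }.
HB.instance Definition _ := [isSub for subm_val].
HB.instance Definition _ := [Choice of subm by <:].
HB.instance Definition _ := [SubChoice_isSubLmodule of subm by <:].
End SubType.

End Submodules.

Section Subquotient.
Variables (k : fieldType) (V : lmodType k) (Z B : submodClosed V).

Definition crepr (x : V) : V := choose (fun y => (y \in Z) && (y - x \in B)) x.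

Lemma creprP x : x \in Z -> (crepr x \in Z) && (crepr x - x \in B).
Proof.
by move=> xZ; apply: (@chooseP _ (fun y => (y \in Z) && (y - x \in B)));
   rewrite xZ subrr sm0.
Qed.

Lemma crepr_eq x y : x \in Z -> y \in Z -> x - y \in B -> crepr x = crepr y.
Proof.
move=> xZ yZ xyB; rewrite /crepr.
rewrite (@eq_choose _ _ (fun z => (z \in Z) && (z - y \in B))); last first.
  move=> z /=; congr (_ && _); apply/idP/idP => h.
    by have := smD h xyB; rewrite addrA subrK.
  by have := smB h xyB; rewrite opprB addrA subrK.
by apply: choose_id; rewrite ?xZ ?yZ //= subrr sm0.
Qed.

(* The quotient of Z by the intersection of Z and B, as the type of canonical  *)
(* representatives of its classes; cls sends elements outside of Z to 0.       *)
Record subquot :=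
  Subquot { sqval : V; sqvalP : (sqval \in Z) && (crepr sqval == sqval) }.
HB.instance Definition _ := [isSub for sqval].
HB.instance Definition _ := [Choice of subquot by <:].

Lemma cls_subproof x (y := if x \in Z then x else 0) :
  (crepr y \in Z) && (crepr (crepr y) == crepr y).
Proof.
have yZ : y \in Z by rewrite /y; case: ifP => // _; exact: sm0.
by have /andP[h1 h2] := creprP yZ; rewrite h1 (crepr_eq h1 yZ h2) eqxx.
Qed.
Definition cls x : subquot := Subquot (cls_subproof x).

Lemma sqvalZ c : sqval c \in Z. Proof. by case/andP: (sqvalP c). Qed.

Lemma sqvalK : cancel sqval cls.
Proof. by move=> c; apply: val_inj; rewrite /= sqvalZ; case/andP: (sqvalP c) => _ /eqP. Qed.

Lemma clsP x y : x \in Z -> y \in Z -> cls x = cls y <-> x - y \in B.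
Proof.
move=> xZ yZ; split; last first.
  by move=> h; apply: val_inj; rewrite /= xZ yZ; exact: crepr_eq.
move/(congr1 sqval); rewrite /= xZ yZ => e.
have /andP[_ h1] := creprP xZ; have /andP[_ h2] := creprP yZ.
have := smB h2 h1; rewrite e opprB addrC addrA subrK.
by rewrite addrC.
Qed.

Lemma sqval_cls x : x \in Z -> sqval (cls x) - x \in B.
Proof. by move=> xZ; apply/clsP => //; rewrite ?sqvalZ ?sqvalK. Qed.

Lemma clsW (P : subquot -> Prop) : (forall x, x \in Z -> P (cls x)) -> forall c, P c.
Proof. by move=> h c; rewrite -(sqvalK c); apply: h; exact: sqvalZ. Qed.

Let sq0 := cls 0.
Let sqN c := cls (- sqval c).
Let sqD c d := cls (sqval c + sqval d).
Let sqS a c := cls (a *: sqval c).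

Let sqDE x y : x \in Z -> y \in Z -> sqD (cls x) (cls y) = cls (x + y).
Proof.
move=> xZ yZ; apply/(clsP (smD (sqvalZ _) (sqvalZ _)) (smD xZ yZ)).
by rewrite opprD addrACA smD ?sqval_cls.
Qed.
Let sqSE a x : x \in Z -> sqS a (cls x) = cls (a *: x).
Proof.
move=> xZ; apply/(clsP (smZ _ (sqvalZ _)) (smZ _ xZ)).
by rewrite -scalerBr smZ ?sqval_cls.
Qed.
Let sqNE x : x \in Z -> sqN (cls x) = cls (- x).
Proof.
move=> xZ; apply/(clsP (smN (sqvalZ _)) (smN xZ)).
by have := smN (sqval_cls xZ); rewrite opprD.
Qed.

Let sqDA : associative sqD.
Proof.
elim/clsW=> x xZ; elim/clsW=> y yZ; elim/clsW=> z zZ.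
by rewrite !sqDE ?smD // addrA.
Qed.
Let sqDC : commutative sqD.
Proof. by elim/clsW=> x xZ; elim/clsW=> y yZ; rewrite !sqDE // addrC. Qed.
Let sq0D : left_id sq0 sqD.
Proof. by elim/clsW=> x xZ; rewrite !sqDE ?sm0 // add0r. Qed.
Let sqNK : left_inverse sq0 sqN sqD.
Proof. by elim/clsW=> x xZ; rewrite sqNE // sqDE ?smN // addNr. Qed.
HB.instance Definition _ := GRing.isZmodule.Build subquot sqDA sqDC sq0D sqNK.

Let sqSA a b c : sqS a (sqS b c) = sqS (a * b) c.
Proof. by elim/clsW: c => x xZ; rewrite !sqSE ?smZ // scalerA. Qed.
Let sqS1 : left_id 1 sqS.
Proof. by elim/clsW=> x xZ; rewrite sqSE // scale1r. Qed.
Let addE (c d : subquot) : c + d = sqD c d. Proof. by []. Qed.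
Let sqSDr : right_distributive sqS +%R.
Proof.
move=> a; elim/clsW=> x xZ; elim/clsW=> y yZ.
by rewrite !addE (sqDE xZ yZ) (sqSE a xZ) (sqSE a yZ) (sqSE a (smD xZ yZ))
  (sqDE (smZ a xZ) (smZ a yZ)) scalerDr.
Qed.
Let sqSDl c : {morph sqS^~ c : a b / a + b}.
Proof.
elim/clsW: c => x xZ a b /=.
by rewrite addE !(sqSE _ xZ) (sqDE (smZ a xZ) (smZ b xZ)) scalerDl.
Qed.
HB.instance Definition _ :=
  GRing.Zmodule_isLmodule.Build k subquot sqSA sqS1 sqSDr sqSDl.

Lemma clsD x y : x \in Z -> y \in Z -> cls (x + y) = cls x + cls y.
Proof. by move=> xZ yZ; rewrite -sqDE. Qed.
Lemma clsZ a x : x \in Z -> cls (a *: x) = a *: cls x.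
Proof. by move=> xZ; rewrite -sqSE. Qed.
Lemma cls0 : cls 0 = 0. Proof. by []. Qed.
Lemma cls_eq0 x : x \in Z -> cls x = 0 <-> x \in B.
Proof. by move=> xZ; rewrite -cls0 clsP ?sm0 // subr0. Qed.
Lemma cls_lin a x y : x \in Z -> y \in Z -> cls (a *: x + y) = a *: cls x + cls y.
Proof. by move=> xZ yZ; rewrite clsD ?smZ // clsZ. Qed.
Lemma cls_sum (J : Type) (s : seq J) (f : J -> V) :
  (forall j, f j \in Z) -> cls (\sum_(j <- s) f j) = \sum_(j <- s) cls (f j).
Proof.
move=> fZ; elim: s => [|j s IH]; first by rewrite !big_nil.
by rewrite !big_cons clsD ?IH ?sm_sum.
Qed.

End Subquotient.

Section Gradings.
Variables (k : fieldType) (I : zmodType).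

Section Family.
Variables (V : lmodType k) (V_ : I -> submodClosed V).

(* x is a finite sum of homogeneous elements. *)
Definition homsum (x : V) : Prop :=
  exists2 s : seq (I * V),
    all (fun p => p.2 \in V_ p.1) s & x = \sum_(p <- s) p.2.

Definition independent : Prop :=
  forall (s : seq I) (f : I -> V), uniq s -> (forall i, f i \in V_ i) ->
    \sum_(i <- s) f i = 0 -> forall i, i \in s -> f i = 0.

Definition is_grading : Prop := (forall x, homsum x) /\ independent.

Lemma homsum0 : homsum 0.
Proof. by exists [::]; rewrite ?big_nil. Qed.

Lemma homsum_hom i x : x \in V_ i -> homsum x.
Proof. by move=> xV; exists [:: (i, x)]; rewrite /= ?xV ?big_seq1. Qed.

Lemma homsumP a x y : homsum x -> homsum y -> homsum (a *: x + y).
Proof.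
move=> [s sV ->] [t tV ->].
exists ([seq (p.1, a *: p.2) | p <- s] ++ t); last first.
  by rewrite big_cat big_map /= scaler_sumr.
rewrite all_cat tV andbT all_map; apply/allP => p ps /=.
by rewrite smZ //; exact: (allP sV).
Qed.

Lemma homsum_uniq x : homsum x ->
  exists s (f : I -> V), [/\ uniq s, forall i, f i \in V_ i
    & x = \sum_(i <- s) f i].
Proof.
case=> s sV ->.
exists (undup [seq p.1 | p <- s]), (fun i => \sum_(p <- s | p.1 == i) p.2).
split; first exact: undup_uniq.
  move=> i; rewrite big_seq_cond; apply: rpred_sum => p /andP[ps /eqP <-].
  exact: (allP sV).
under [RHS]eq_bigr => i _ do rewrite big_mkcond /=.
rewrite [RHS]exchange_big /= [LHS]big_seq [RHS]big_seq; apply: eq_bigr => p ps.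
have pu : p.1 \in undup [seq p.1 | p <- s] by rewrite mem_undup map_f.
rewrite (bigD1_seq p.1) ?undup_uniq //= eqxx big1 ?addr0 // => i.
by rewrite eq_sym => /negbTE ->.
Qed.

End Family.

Record gmod := Gmod {
  gcar :> lmodType k;
  gpart : I -> submodClosed gcar;
  gmodP : is_grading gpart }.
Arguments gpart {g}.

Lemma gmod_sum (V : gmod) (x : V) : homsum (@gpart V) x.
Proof. by case: (gmodP V). Qed.

Lemma gmod_indep (V : gmod) : independent (@gpart V).
Proof. by case: (gmodP V). Qed.

Lemma gmod_eq (V : gmod) (s : seq I) (f g : I -> V) : uniq s ->
  (forall i, f i \in gpart i) -> (forall i, g i \in gpart i) ->
  \sum_(i <- s) f i = \sum_(i <- s) g i -> forall i, i \in s -> f i = g i.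
Proof.
move=> us fV gV e i iS; apply/eqP; rewrite -subr_eq0; apply/eqP.
apply: (@gmod_indep V s (fun i => f i - g i) us) => //.
  by move=> j; rewrite smB.
by rewrite sumrB e subrr.
Qed.

Definition is_graded_sub (V : gmod) (S : submodClosed V) : Prop :=
  forall x, x \in S -> exists2 s : seq (I * V),
    all (fun p => (p.2 \in gpart p.1) && (p.2 \in S)) s & x = \sum_(p <- s) p.2.

Record gsub (V : gmod) :=
  Gsub { gscar :> submodClosed V; gsubP : is_graded_sub gscar }.

Lemma sub_widen (V : gmod) (S : submodClosed V) (s t : seq I) (f : I -> V) :
  uniq s -> uniq t -> {subset s <= t} ->
  \sum_(i <- s) f i = \sum_(i <- t) if i \in s then f i else 0.
Proof.
move=> us ut st; rewrite -big_mkcond -[RHS]big_filter.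
apply: perm_big; apply: uniq_perm; rewrite ?filter_uniq // => i.
by rewrite mem_filter; case: (boolP (i \in s)) => // /st ->.
Qed.

Lemma gsub_comp (V : gmod) (S : gsub V) (s : seq I) (f : I -> V) : uniq s ->
  (forall i, f i \in gpart i) -> \sum_(i <- s) f i \in S ->
  forall i, i \in s -> f i \in S.
Proof.
move=> us fV fS i iS.
have [t tV e] := gsubP fS.
have [u [g [uu gVS eg]]] :
    exists u (g : I -> V), [/\ uniq u, forall i, (g i \in gpart i) && (g i \in S)
      & \sum_(i <- s) f i = \sum_(i <- u) g i].
  exists (undup [seq p.1 | p <- t]), (fun i => \sum_(p <- t | p.1 == i) p.2).
  split; first exact: undup_uniq.
    move=> j; apply/andP; split; rewrite big_seq_cond;
      apply: rpred_sum => p /andP[/(allP tV)/andP[h1 h2] /eqP pj] //.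
    by rewrite -pj.
  rewrite e; under [RHS]eq_bigr => j _ do rewrite big_mkcond /=.
  rewrite [RHS]exchange_big /= [LHS]big_seq [RHS]big_seq; apply: eq_bigr => p ps.
  have pu : p.1 \in undup [seq p.1 | p <- t] by rewrite mem_undup map_f.
  rewrite (bigD1_seq p.1) ?undup_uniq //= eqxx big1 ?addr0 // => j.
  by rewrite eq_sym => /negbTE ->.
pose w := undup (s ++ u).
have uw : uniq w by exact: undup_uniq.
have sw : {subset s <= w} by move=> j js; rewrite mem_undup mem_cat js.
have tw : {subset u <= w} by move=> j js; rewrite mem_undup mem_cat js orbT.
rewrite (sub_widen S f us uw sw) (sub_widen S g uu uw tw) in eg.
have := @gmod_eq V w _ _ uw _ _ eg i (sw _ iS); rewrite /= iS => ->.
- by case: ifP => _; rewrite ?sm0 //; case/andP: (gVS i).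
- by move=> j; case: ifP => _; rewrite ?sm0.
- by move=> j; case: ifP => _; rewrite ?sm0 //; case/andP: (gVS j).
Qed.

Lemma hom_comp (V : gmod) (n : I) (s : seq I) (f : I -> V) : uniq s ->
  (forall i, f i \in gpart i) -> \sum_(i <- s) f i \in @gpart V n ->
  \sum_(i <- s) f i = if n \in s then f n else 0.
Proof.
move=> us fV sn; set x := \sum_(i <- s) f i in sn *.
pose w := undup (n :: s).
have uw : uniq w by exact: undup_uniq.
have sw : {subset s <= w} by move=> j js; rewrite mem_undup inE js orbT.
have nw : n \in w by rewrite mem_undup inE eqxx.
have e : \sum_(i <- w) (if i \in s then f i else 0)
       = \sum_(i <- w) (if i == n then x else 0).
  rewrite -(sub_widen (@gpart V n) f us uw sw) [RHS](bigD1_seq n) //= eqxx [X in _ + X]big1 ?addr0 //.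
  by move=> j /negbTE ->.
have := @gmod_eq V w _ _ uw _ _ e n nw; rewrite /= eqxx => -> //.
- by move=> j; case: ifP => _; rewrite ?sm0.
- by move=> j; case: eqP => [->|_]; rewrite ?sm0.
Qed.

Section GradedSubquotient.
Variables (V : gmod) (Z B : gsub V).

Definition gsq_part (i : I) : submodClosed (subquot Z B) :=
  submod_of
    (P := fun c => exists z, [/\ z \in gpart i, z \in Z & c = cls Z B z])
    (ex_intro _ 0 (And3 (sm0 _) (sm0 _) (erefl _)))
    (fun a c d '(ex_intro z (And3 zi zZ ce)) '(ex_intro w (And3 wi wZ de)) =>
       ex_intro _ (a *: z + w)
         (And3 (smD (smZ a zi) wi) (smD (smZ a zZ) wZ)
            (etrans (congr2 (fun c d => a *: c + d) ce de)
               (esym (cls_lin B a zZ wZ))))).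

Lemma gsq_grading : is_grading gsq_part.
Proof.
split.
  elim/clsW=> z zZ; have [s sV ->] := gsubP zZ.
  exists [seq (p.1, cls Z B p.2) | p <- s].
    rewrite all_map; apply/allP => p /(allP sV)/andP[h1 h2] /=.
    by apply/submod_ofP; exists p.2.
  rewrite big_map /= {zZ}; elim: s sV => [|p s IH] sV; first by rewrite !big_nil.
  move: sV => /= /andP[/andP[_ pZ] sV].
  rewrite !big_cons clsD ?IH // big_seq; apply: rpred_sum => q /(allP sV).
  by case/andP.
move=> s f us fV e i iS.
have /choice[z zP] : forall i, exists z,
   [/\ z \in @gpart V i, z \in Z & f i = cls Z B z].
  by move=> j; have /submod_ofP := fV j.
have zZ j : z j \in Z by case: (zP j).
have zV j : z j \in gpart j by case: (zP j).
have fE j : f j = cls Z B (z j) by case: (zP j).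
rewrite fE; apply/cls_eq0 => //.
apply: (gsub_comp us zV) => //; apply/(@cls_eq0 _ _ Z B); first exact: sm_sum.
by rewrite cls_sum // -[RHS]e; apply: eq_bigr => j _; rewrite fE.
Qed.

(* Z / (Z :&: B), with the induced grading *)
Definition gsubquot : gmod := Gmod gsq_grading.
End GradedSubquotient.

Section DirectSum.
Variables (U : lmodType k) (U_ : I -> submodClosed U) (ind : independent U_).

(* The internal direct sum of the independent family U_. *)
Definition dspan : submodClosed U := submod_of (homsum0 U_) (@homsumP U U_).

Definition dsum_part (i : I) : submodClosed (subm dspan) :=
  submod_of (P := fun x => subm_val x \in U_ i) (sm0 _)
    (fun a x y xU yU => smD (smZ a xU) yU).

Lemma subm_val_sum (J : Type) (s : seq J) (f : J -> subm dspan) :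
  subm_val (\sum_(j <- s) f j) = \sum_(j <- s) subm_val (f j).
Proof.
elim: s => [|j s IH]; first by rewrite !big_nil.
by rewrite !big_cons -IH.
Qed.

Lemma dsum_grading : is_grading dsum_part.
Proof.
split.
  case=> x xS; have /submod_ofP[s sV e] := xS.
  have sS p : p \in s -> p.2 \in dspan.
    by move=> /(allP sV) h; apply/submod_ofP; exact: homsum_hom h.
  exists [seq (p.1, insubd 0 p.2) | p <- s].
    rewrite all_map; apply/allP => p ps /=; apply/submod_ofP.
    rewrite (_ : subm_val _ = p.2); first exact: (allP sV).
    by rewrite [LHS](_ : _ = val (insubd 0 p.2 : subm dspan)) // insubdK //; exact: sS.
  apply: val_inj; rewrite /= subm_val_sum big_map e [LHS]big_seq [RHS]big_seq.
  apply: eq_bigr => p ps /=.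
  by rewrite [RHS](_ : _ = val (insubd 0 p.2 : subm dspan)) // insubdK //; exact: sS.
move=> s f us fV e i iS; apply: val_inj.
apply: (ind us (f := fun i => subm_val (f i))) => //.
  by move=> j; have /submod_ofP := fV j.
by rewrite -subm_val_sum e.
Qed.

Definition dsum : gmod := Gmod dsum_grading.
End DirectSum.

Record hlin (V W : gmod) := Hlin {
  hfun :> {linear V -> W};
  hdeg : I;
  hlinP : forall i x, x \in @gpart V i -> hfun x \in @gpart W (i + hdeg) }.

Definition hcomp (U V W : gmod) (g : hlin V W) (f : hlin U V) : hlin U W :=
  @Hlin U W (g \o f) (hdeg f + hdeg g)
    (fun i x xi => eq_ind_r (fun j => g (f x) \in @gpart W j)
       (hlinP g (hlinP f xi)) (addrA i (hdeg f) (hdeg g))).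

Section KernelImage.
Variables (V W : gmod) (f : hlin V W).

Definition kersub : submodClosed V :=
  submod_of (P := fun x => f x = 0) (linear0 f)
    (fun a x y (fx : f x = 0) (fy : f y = 0) =>
       etrans (linearP f a x y)
         (etrans (congr2 (fun u v => a *: u + v) fx fy)
            (etrans (addr0 _) (scaler0 _ _)))).

Definition imsub : submodClosed W :=
  submod_of (P := fun y => exists x, y = f x)
    (ex_intro _ 0 (esym (linear0 f)))
    (fun a y y' '(ex_intro x e) '(ex_intro x' e') =>
       ex_intro _ (a *: x + x')
         (etrans (congr2 (fun u v => a *: u + v) e e') (esym (linearP f a x x')))).

Lemma kersub_graded : is_graded_sub kersub.
Proof.
move=> x /submod_ofP fx; have [s [g [us gV e]]] := homsum_uniq (gmod_sum x).
exists [seq (i, g i) | i <- s]; last by rewrite big_map.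
rewrite all_map; apply/allP => i iS /=; rewrite gV /=; apply/submod_ofP.
pose h (j : I) : W := f (g (j - hdeg f)).
have hV j : h j \in gpart j by rewrite -[in gpart j](subrK (hdeg f) j) hlinP.
have -> : f (g i) = h (i + hdeg f) by rewrite /h addrK.
apply: (@gmod_indep W [seq j + hdeg f | j <- s] h) => //.
- by rewrite map_inj_uniq //; exact: addIr.
- by rewrite big_map -[RHS]fx e linear_sum; apply: eq_bigr => j _; rewrite /h addrK.
- exact: map_f.
Qed.

Lemma imsub_graded : is_graded_sub imsub.
Proof.
move=> y /submod_ofP[x ->]; have [s sV ->] := gmod_sum x.
exists [seq (p.1 + hdeg f, f p.2) | p <- s]; last by rewrite big_map linear_sum.
rewrite all_map; apply/allP => p ps /=; rewrite hlinP ?(allP sV) //=.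
by apply/submod_ofP; exists p.2.
Qed.

Definition gker : gsub V := Gsub kersub_graded.
Definition gim : gsub W := Gsub imsub_graded.

Lemma gkerP x : reflect (f x = 0) (x \in gker).
Proof. exact: submod_ofP. Qed.
Lemma gimP y : reflect (exists x, y = f x) (y \in gim).
Proof. exact: submod_ofP. Qed.

Lemma him n y : y \in gim -> y \in @gpart W n ->
  exists2 x, x \in @gpart V (n - hdeg f) & y = f x.
Proof.
move=> /gimP[x ->] yn; have [s [g [us gV e]]] := homsum_uniq (gmod_sum x).
pose h (j : I) : W := f (g (j - hdeg f)).
have hV j : h j \in gpart j by rewrite -[in gpart j](subrK (hdeg f) j) hlinP.
have fxE : f x = \sum_(j <- [seq j + hdeg f | j <- s]) h j.
  by rewrite big_map e linear_sum; apply: eq_bigr => j _; rewrite /h addrK.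
have us' : uniq [seq j + hdeg f | j <- s].
  by rewrite map_inj_uniq //; exact: addIr.
have := @hom_comp W n _ h us' hV; rewrite -fxE => /(_ yn) ->.
case: ifP => _; first by exists (g (n - hdeg f)).
by exists 0; rewrite ?linear0 ?sm0.
Qed.

End KernelImage.

Definition gzero (V : gmod) : gsub V.
Proof.
apply: (@Gsub V (submod_of (P := fun x => x = 0) (erefl _)
  (fun a x y (ex : x = 0) (ey : y = 0) =>
     etrans (congr2 (fun u v => a *: u + v) ex ey)
            (etrans (addr0 _) (scaler0 _ _))))).
by move=> x /submod_ofP ->; exists [::]; rewrite ?big_nil.
Defined.

Definition gfull (V : gmod) : gsub V.
Proof.
apply: (@Gsub V (submod_of (P := fun _ : V => True) Logic.I (fun _ _ _ _ _ => Logic.I))).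
move=> x _; have [s sV ->] := gmod_sum x; exists s => //.
by apply/allP => p /(allP sV) ->; apply/submod_ofP.
Defined.

End Gradings.
Arguments gpart {k I g}.

Section LinearRelation.
Variables (k : fieldType) (V W : lmodType k) (G : V -> W -> Prop).

Definition functional_rel : Prop :=
  [/\ forall v, exists w, G v w, forall w, G 0 w -> w = 0
    & forall a v v' w w', G v w -> G v' w' -> G (a *: v + v') (a *: w + w')].

Variable GP : functional_rel.

Lemma lrel_total v : exists w, G v w. Proof. by case: GP. Qed.
Definition lrel_fun v : W := sval (cid (lrel_total v)).
Lemma lrel_funP v : G v (lrel_fun v). Proof. exact: svalP. Qed.

Lemma lrel_uniq v w w' : G v w -> G v w' -> w = w'.
Proof.
case: GP => _ G0 GL h h'; apply/eqP; rewrite eq_sym -subr_eq0; apply/eqP; apply: G0.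
by have := GL (-1) _ _ _ _ h h'; rewrite !scaleN1r addNr addrC.
Qed.

Lemma lrel_linear : linear lrel_fun.
Proof.
case: (GP) => _ _ GL a v v'; apply: (@lrel_uniq (a *: v + v')).
  exact: lrel_funP.
by apply: GL; exact: lrel_funP.
Qed.

Definition lrel : {linear V -> W} := mklin lrel_linear.

Lemma lrelE v w : G v w -> lrel v = w.
Proof. by move=> h; apply: (lrel_uniq _ h); exact: lrel_funP. Qed.
End LinearRelation.

Section ExactCouples.
Variables (k : fieldType) (I : zmodType).
Local Notation gmod := (gmod k I).

Section MapSubquotient.
Variables (V W : gmod) (f : hlin V W) (Z B : gsub V) (Z' B' : gsub W).
Hypothesis fZ : forall x, x \in Z -> f x \in Z'.
Hypothesis fB : forall x, x \in Z -> x \in B -> f x \in B'.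

Definition sqmap_fun (c : gsubquot Z B) : gsubquot Z' B' := cls Z' B' (f (sqval c)).

Lemma sqmap_funE x : x \in Z -> sqmap_fun (cls Z B x) = cls Z' B' (f x).
Proof.
move=> xZ; apply/clsP; [by apply: fZ; exact: sqvalZ|exact: fZ|].
by rewrite -linearB; apply: fB; [rewrite smB ?sqvalZ|exact: sqval_cls].
Qed.

Lemma sqmap_linear : linear sqmap_fun.
Proof.
move=> a c d; have cZ := sqvalZ c; have dZ := sqvalZ d.
rewrite -(sqvalK c) -(sqvalK d) -cls_lin // !sqmap_funE ?smD ?smZ // linearP.
by rewrite cls_lin ?fZ.
Qed.

Lemma sqmap_hom i c : c \in @gpart k I (gsubquot Z B) i ->
  mklin sqmap_linear c \in @gpart k I (gsubquot Z' B') (i + hdeg f).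
Proof.
move=> /submod_ofP[z [zi zZ ->]]; apply/submod_ofP; exists (f z).
by split; [exact: hlinP|exact: fZ|exact: sqmap_funE].
Qed.

Definition sqmap : hlin (gsubquot Z B) (gsubquot Z' B') := Hlin sqmap_hom.

Lemma sqmapE x : x \in Z -> sqmap (cls Z B x) = cls Z' B' (f x).
Proof. exact: sqmap_funE. Qed.
End MapSubquotient.

Definition coh (V : gmod) (d : hlin V V) : gmod := gsubquot (gker d) (gim d).

Definition exact_at (U V W : gmod) (f : hlin U V) (g : hlin V W) : Prop :=
  forall x, g x = 0 <-> exists y, x = f y.

(* exact couples, with D --ci--> D --cj--> E --ck--> D *)
Record ecouple := Ecouple {
  cD : gmod;
  cE : gmod;
  ci : hlin cD cD;
  cj : hlin cD cE;
  ck : hlin cE cD;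
  cij : exact_at ci cj;
  cjk : exact_at cj ck;
  cki : exact_at ck ci }.

Section Derive.
Variable C : ecouple.
Local Notation D := (cD C).
Local Notation E := (cE C).
Local Notation i := (ci C).
Local Notation j := (cj C).
Local Notation kk := (ck C).

Lemma ci_ck e : i (kk e) = 0. Proof. by apply/cki; exists e. Qed.
Lemma ck_cj x : kk (j x) = 0. Proof. by apply/cjk; exists x. Qed.
Lemma cj_ci x : j (i x) = 0. Proof. by apply/cij; exists x. Qed.

Definition cd : hlin E E := hcomp j kk.
Lemma cdE e : cd e = j (kk e). Proof. by []. Qed.
Definition cD' : gmod := gsubquot (gim i) (gzero D).
Definition cE' : gmod := coh cd.

Lemma cls_im x y : x \in gim i -> y \in gim i ->
  cls (gim i) (gzero D) x = cls (gim i) (gzero D) y -> x = y.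
Proof.
move=> xi yi /(clsP _ xi yi)/submod_ofP h.
by apply/eqP; rewrite -subr_eq0 h.
Qed.

Lemma cj_ker x : j x \in gker cd.
Proof. by apply/gkerP; rewrite cdE ck_cj linear0. Qed.

Lemma ci'Z x : x \in gim i -> i x \in gim i.
Proof. by move=> _; apply/gimP; exists x. Qed.
Lemma ci'B x : x \in gim i -> x \in gzero D -> i x \in gzero D.
Proof. by move=> _ /submod_ofP ->; rewrite linear0; apply: sm0. Qed.
Definition ci' : hlin cD' cD' := sqmap ci'Z ci'B.

Lemma ck'Z e : e \in gker cd -> kk e \in gim i.
Proof. by move=> /gkerP; rewrite cdE => /cij[x ->]; apply/gimP; exists x. Qed.
Lemma ck'B e : e \in gker cd -> e \in gim cd -> kk e \in gzero D.
Proof. by move=> _ /gimP[e' ->]; rewrite cdE ck_cj; apply: sm0. Qed.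
Definition ck' : hlin cE' cD' := sqmap ck'Z ck'B.

(* cj' (ci x) is the class of cj x. *)
Definition cj_rel (c : cD') (e : cE') : Prop :=
  exists x, c = cls (gim i) (gzero D) (i x) /\ e = cls (gker cd) (gim cd) (j x).

Lemma imi x : i x \in gim i. Proof. by apply/gimP; exists x. Qed.

Lemma cj_rel_functional : functional_rel cj_rel.
Proof.
split.
- by elim/clsW=> y /gimP[x ->]; eexists; exists x.
- move=> e [x [e0 ->]]; apply/cls_eq0; first exact: cj_ker.
  have ix0 : i x = 0.
    by apply: (cls_im (imi x) (sm0 _)); rewrite -e0 cls0.
  by have /cki[e' ->] := ix0; apply/gimP; exists e'.
- move=> a c c' e e' [x [-> ->]] [x' [-> ->]]; exists (a *: x + x').
  by rewrite !linearP -!cls_lin ?imi ?cj_ker.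
Qed.

Lemma cj_rel_hom n c : c \in @gpart k I cD' n ->
  lrel cj_rel_functional c \in @gpart k I cE' (n + (hdeg j - hdeg i)).
Proof.
move=> /submod_ofP[y [yn yi ->]]; have [x xn yE] := him yi yn.
rewrite (lrelE cj_rel_functional (w := cls (gker cd) (gim cd) (j x))); last first.
  by exists x; rewrite yE.
apply/submod_ofP; exists (j x); split=> //; last exact: cj_ker.
by rewrite addrA addrAC hlinP.
Qed.

Definition cj' : hlin cD' cE' := Hlin cj_rel_hom.

Lemma cj'E x : cj' (cls (gim i) (gzero D) (i x)) = cls (gker cd) (gim cd) (j x).
Proof. by apply: lrelE; exists x. Qed.

Lemma derive_ij : exact_at ci' cj'.
Proof.
move=> c; split.
  elim/clsW: c => y /gimP[x ->]; rewrite cj'E => /(cls_eq0 _ (cj_ker x))/gimP[e je].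
  have /cij[y' e'] : j (x - kk e) = 0 by rewrite linearB je subrr.
  exists (cls (gim i) (gzero D) (i y')); rewrite sqmapE ?imi // -e' linearB.
  by rewrite ci_ck subr0.
move=> [c' ->]; elim/clsW: c' => y /gimP[x ->]; rewrite sqmapE ?imi // cj'E.
by rewrite cj_ci cls0.
Qed.

Lemma derive_jk : exact_at cj' ck'.
Proof.
move=> c; split.
  elim/clsW: c => e ez; rewrite sqmapE // => /(cls_eq0 _ (ck'Z ez))/submod_ofP.
  move=> /cjk[x ->]; exists (cls (gim i) (gzero D) (i x)); by rewrite cj'E.
move=> [c' ->]; elim/clsW: c' => y /gimP[x ->]; rewrite cj'E sqmapE ?cj_ker //.
by rewrite ck_cj cls0.
Qed.

Lemma derive_ki : exact_at ck' ci'.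
Proof.
move=> c; split.
  elim/clsW: c => y yi; rewrite sqmapE // => /(cls_eq0 _ (ci'Z yi))/submod_ofP.
  move=> /cki[e ye]; have ez : e \in gker cd.
    by apply/gkerP; rewrite cdE -ye; apply/cij; case/gimP: yi => x ->; exists x.
  by exists (cls (gker cd) (gim cd) e); rewrite sqmapE // ye.
move=> [c' ->]; elim/clsW: c' => e ez; rewrite (sqmapE ck'Z ck'B ez).
by rewrite sqmapE ?ck'Z // ci_ck cls0.
Qed.

Definition derive : ecouple := Ecouple derive_ij derive_jk derive_ki.
End Derive.

Section LongExactSequence.
Variables (R Q : gmod) (dR : hlin R R) (dQ : hlin Q Q) (h : hlin R R) (p : hlin R Q).
Hypothesis dR2 : forall x, dR (dR x) = 0.
Hypothesis h_inj : injective h.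
Hypothesis p_surj : forall q, exists x, q = p x.
Hypothesis hp : exact_at h p.
Hypothesis hd : forall x, h (dR x) = dR (h x).
Hypothesis pd : forall x, p (dR x) = dQ (p x).

Lemma hZ x : x \in gker dR -> h x \in gker dR.
Proof. by move=> /gkerP dx; apply/gkerP; rewrite -hd dx linear0. Qed.
Lemma hB x : x \in gker dR -> x \in gim dR -> h x \in gim dR.
Proof. by move=> _ /gimP[y ->]; apply/gimP; exists (h y); rewrite hd. Qed.
Definition les_i : hlin (coh dR) (coh dR) := sqmap hZ hB.

Lemma pZ x : x \in gker dR -> p x \in gker dQ.
Proof. by move=> /gkerP dx; apply/gkerP; rewrite -pd dx linear0. Qed.
Lemma pB x : x \in gker dR -> x \in gim dR -> p x \in gim dQ.
Proof. by move=> _ /gimP[y ->]; apply/gimP; exists (p y); rewrite pd. Qed.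
Definition les_j : hlin (coh dR) (coh dQ) := sqmap pZ pB.

(* the connecting map: [p x] is sent to [y] when dR x = h y *)
Definition les_rel (c : coh dQ) (c' : coh dR) : Prop :=
  exists x y, [/\ p x \in gker dQ, c = cls (gker dQ) (gim dQ) (p x), dR x = h y
                & c' = cls (gker dR) (gim dR) y].

Lemma les_ker x y : dR x = h y -> y \in gker dR.
Proof.
by move=> e; apply/gkerP; apply: h_inj; rewrite hd -e dR2 linear0.
Qed.

Lemma les_functional : functional_rel les_rel.
Proof.
split.
- elim/clsW=> q qz; have [x qx] := p_surj q.
  have /hp[y e] : p (dR x) = 0 by rewrite pd -qx; apply/gkerP.
  by eexists; exists x, y; rewrite -qx.
- move=> w [x [y [pxz e0 e ->]]]; apply/cls_eq0; first exact: les_ker e.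
  have /gimP[q pxq] : p x \in gim dQ by apply/(cls_eq0 _ pxz).
  have [x' qx'] := p_surj q.
  have /hp[t xt] : p (x - dR x') = 0 by rewrite linearB pd -qx' pxq subrr.
  apply/gimP; exists t; apply: h_inj.
  by rewrite -e hd -xt linearB dR2 subr0.
- move=> a c c' w w' [x [y [xz -> e ->]]] [x' [y' [xz' -> e' ->]]].
  exists (a *: x + x'), (a *: y + y'); split.
  + by rewrite linearP smD ?smZ.
  + by rewrite linearP cls_lin.
  + by rewrite !linearP e e'.
  + by rewrite cls_lin // ?(les_ker e) ?(les_ker e').
Qed.

Lemma les_hom n c : c \in @gpart k I (coh dQ) n ->
  lrel les_functional c \in @gpart k I (coh dR) (n + (hdeg dR - hdeg h - hdeg p)).
Proof.
move=> /submod_ofP[q [qn qz ->]].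
have [x0 qx0] := p_surj q.
have /him /(_ qn)[x xn qx] : q \in gim p by apply/gimP; exists x0.
have /hp[y0 e0] : p (dR x) = 0 by rewrite pd -qx; apply/gkerP.
have /him /(_ (hlinP dR xn))[y yn e] : dR x \in gim h by apply/gimP; exists y0.
rewrite (lrelE les_functional (w := cls (gker dR) (gim dR) y)); last first.
  by exists x, y; rewrite -qx.
apply/submod_ofP; exists y; split=> //; last exact: les_ker e.
have -> // : n + (hdeg dR - hdeg h - hdeg p) = n - hdeg p + hdeg dR - hdeg h.
by rewrite !addrA addrAC; congr (_ - _); rewrite addrAC.
Qed.

Definition les_k : hlin (coh dQ) (coh dR) := Hlin les_hom.

Lemma les_kE x y : p x \in gker dQ -> dR x = h y ->
  les_k (cls (gker dQ) (gim dQ) (p x)) = cls (gker dR) (gim dR) y.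
Proof. by move=> xz e; apply: lrelE; exists x, y. Qed.

Lemma les_ij : exact_at les_i les_j.
Proof.
move=> c; split.
  elim/clsW: c => x xz; rewrite sqmapE // => /(cls_eq0 _ (pZ xz))/gimP[q pxq].
  have [x' qx'] := p_surj q.
  have /hp[t xt] : p (x - dR x') = 0 by rewrite linearB pd -qx' pxq subrr.
  have tz : t \in gker dR.
    apply/gkerP; apply: h_inj; rewrite hd -xt linearB dR2 subr0 linear0.
    exact/gkerP.
  exists (cls (gker dR) (gim dR) t); rewrite sqmapE // -xt; apply/clsP => //.
    by rewrite xt hZ.
  by rewrite opprB addrC subrK; apply/gimP; exists x'.
move=> [c' ->]; elim/clsW: c' => t tz; rewrite (sqmapE hZ hB tz) (sqmapE pZ pB (hZ tz)).
by rewrite (_ : p (h t) = 0) ?cls0 //; apply/hp; exists t.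
Qed.

Lemma les_lift c : exists x y,
  [/\ p x \in gker dQ, c = cls (gker dQ) (gim dQ) (p x) & dR x = h y].
Proof.
elim/clsW: c => q qz; have [x qx] := p_surj q.
have /hp[y e] : p (dR x) = 0 by rewrite pd -qx; apply/gkerP.
by exists x, y; rewrite -qx.
Qed.

Lemma les_jk : exact_at les_j les_k.
Proof.
move=> c; split.
  have [x [y [xz -> e]]] := les_lift c.
  rewrite (les_kE xz e) => /(cls_eq0 _ (les_ker e))/gimP[t yt].
  have wz : x - h t \in gker dR.
    by apply/gkerP; rewrite linearB -hd -yt e subrr.
  exists (cls (gker dR) (gim dR) (x - h t)); rewrite sqmapE // linearB.
  by rewrite (_ : p (h t) = 0) ?subr0 //; apply/hp; exists t.
move=> [c' ->]; elim/clsW: c' => x xz; rewrite sqmapE //.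
rewrite (@les_kE x 0) ?cls0 ?pZ //.
by rewrite linear0; apply/gkerP.
Qed.

Lemma les_ki : exact_at les_k les_i.
Proof.
move=> c; split.
  elim/clsW: c => y yz; rewrite sqmapE // => /(cls_eq0 _ (hZ yz))/gimP[x e].
  have xz : p x \in gker dQ.
    by apply/gkerP; rewrite -pd -e; apply/hp; exists y.
  by exists (cls (gker dQ) (gim dQ) (p x)); rewrite (les_kE xz (esym e)).
move=> [c' ->]; have [x [y [xz -> e]]] := les_lift c'.
rewrite (les_kE xz e) sqmapE ?(les_ker e) // -e.
apply/cls_eq0; first by apply/gkerP; rewrite dR2.
by apply/gimP; exists x.
Qed.

Definition les_couple : ecouple := Ecouple les_ij les_jk les_ki.
End LongExactSequence.

End ExactCouples.

Section GradedMultilinear.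
Variables (k : fieldType) (I : zmodType).

Definition multilinear (V W : lmodType k) (f : seq V -> W) : Prop :=
  forall l r a x y,
    f (l ++ (a *: x + y) :: r) = a *: f (l ++ x :: r) + f (l ++ y :: r).

Definition homog (V : lmodType k) (V_ : I -> submodClosed V)
    (ds : seq I) (xs : seq V) : bool :=
  all2 (fun d x => x \in V_ d) ds xs.

Definition multihomog (V W : lmodType k) (V_ : I -> submodClosed V)
    (W_ : I -> submodClosed W) (dg : nat -> I) (f : seq V -> W) : Prop :=
  forall ds xs, homog V_ ds xs ->
    f xs \in W_ (\sum_(d <- ds) d + dg (size xs)).

(* A family of linear maps V^{(x) n} -> W of degree dg n, for n >= 1, as one   *)
(* function on lists: its restriction to lists of length n is multilinear and  *)
(* is the n-th map of the family. There is no 0-ary map, whence gmulti0.       *)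
Record gmulti (V W : gmod k I) (dg : nat -> I) := Gmulti {
  mfun :> seq V -> W;
  gmulti0 : mfun [::] = 0;
  gmultiL : multilinear mfun;
  gmultiP : multihomog (@gpart _ _ V) (@gpart _ _ W) dg mfun }.

Section FirstMap.
Variables (V W : gmod k I) (dg : nat -> I) (f : gmulti V W dg).
Lemma arity1_linear : linear (fun x => f [:: x]).
Proof. by move=> a x y; have := gmultiL f [::] [::] a x y. Qed.
Lemma arity1_hom i x : x \in gpart i -> mklin arity1_linear x \in gpart (i + dg 1%N).
Proof.
move=> xi; have := @gmultiP _ _ _ f [:: i] [:: x].
by rewrite /homog /= xi big_seq1 => /(_ isT).
Qed.
Definition arity1 : hlin V W := Hlin arity1_hom.
End FirstMap.

(* In the next definitions, tdeg is the total degree, used for Koszul signs.   *)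
Section Ainfinity.
Variable tdeg : I -> int.

Definition ksign (z : int) : k := (-1) ^+ `|z|%N.

(* sum over r + s + t = n of (-1)^(r + s t) f_(r+1+t) (id^r (x) m_s (x) id^t)  *)
(* at homogeneous xs_1, ..., xs_n of degrees ds, where m_s has total degree    *)
(* 2 - s.                                                                      *)
Definition insertion_sum (V W : lmodType k) (f : seq V -> W) (m : seq V -> V)
    (ds : seq I) (xs : seq V) : W :=
  let n := size xs in
  \sum_(r < n) \sum_(s < n.+1 | (0 < s)%N && (r + s <= n)%N)
    ((-1) ^+ (r + s * (n - r - s))%N
       * ksign ((2 - s%:Z) * \sum_(d <- take r ds) tdeg d))
    *: f (take r xs ++ m (take s (drop r xs)) :: drop (r + s)%N xs).

(* sum over i_1 + ... + i_q = n of (-1)^w m_q (f_(i_1) (x) ... (x) f_(i_q)) at *)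
(* homogeneous xs_1, ..., xs_n, where w = sum_j (q - j)(i_j - 1) and f_i has   *)
(* total degree 1 - i.                                                         *)
Definition block_sum (V W : lmodType k) (m : seq W -> W) (f : seq V -> W)
    (ds : seq I) (xs : seq V) : W :=
  let n := size xs in
  \sum_(q < n.+1)
   \sum_(c : q.-tuple 'I_n.+1
         | all (fun i : 'I_n.+1 => (0 < i)%N) c
           && (sumn [seq val i | i <- c] == n))
    let sh := [seq val i | i <- c] in
    ((-1) ^+ (\sum_(j < q) (q - j.+1) * (nth 0 sh j).-1)%N
       * ksign (\sum_(j < q) (1 - (nth 0%N sh j)%:Z)
                  * \sum_(d <- take (sumn (take j sh)) ds) tdeg d))
    *: m [seq f b | b <- reshape sh xs].

Definition stasheff (V : lmodType k) (m : seq V -> V) := insertion_sum m m.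

Definition is_Ainf (V : lmodType k) (V_ : I -> submodClosed V)
    (m : seq V -> V) : Prop :=
  forall ds xs, homog V_ ds xs -> stasheff m ds xs = 0.

Definition is_Ainf_morphism (V W : lmodType k) (V_ : I -> submodClosed V)
    (mV : seq V -> V) (mW : seq W -> W) (f : seq V -> W) : Prop :=
  forall ds xs, homog V_ ds xs ->
    insertion_sum f mV ds xs = block_sum mW f ds xs.

End Ainfinity.

Definition is_quasi_iso (V W : lmodType k) (dV : V -> V) (dW : W -> W)
    (f : V -> W) : Prop :=
  [/\ forall x, dV x = 0 -> dW (f x) = 0,
      forall x, dV x = 0 -> (exists y, f x = dW y) -> exists z, x = dV z
    & forall y, dW y = 0 -> exists x z, dV x = 0 /\ y = f x + dW z].

End GradedMultilinear.

Notation Z2 := (int * int)%type.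
Notation bgmod k := (gmod k (int * int)%type).
Definition tot (i : Z2) : int := i.1 + i.2.
Lemma Z2_eq (x y : Z2) : x.1 = y.1 -> x.2 = y.2 -> x = y.
Proof. by case: x y => [? ?] [? ?] /= -> ->. Qed.
Notation is_bAinf V m := (is_Ainf tot (@gpart _ _ V) m).

Definition alg_deg (s n : nat) : Z2 :=
  ((2 - n%:Z) * s%:Z, (2 - n%:Z) * (1 - s%:Z)).
Definition mor_deg (s n : nat) : Z2 :=
  ((1 - n%:Z) * s%:Z, (1 - n%:Z) * (1 - s%:Z)).

Section DirectSumMap.
Variables (k : fieldType) (I : zmodType) (U U' : lmodType k).
Variables (U_ : I -> submodClosed U) (ind : independent U_).
Variables (U_' : I -> submodClosed U') (ind' : independent U_').
Variables (phi : {linear U -> U'}) (c : I).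
Hypothesis phiP : forall i x, x \in U_ i -> phi x \in U_' (i + c).

Lemma dmap_subproof (x : dsum ind) : phi (subm_val x) \in dspan U_'.
Proof.
case: x => x /= /submod_ofP[s sU ->]; apply/submod_ofP.
exists [seq (p.1 + c, phi p.2) | p <- s]; last by rewrite big_map linear_sum.
by rewrite all_map; apply/allP => p /(allP sU)/phiP.
Qed.
Definition dmap_fun (x : dsum ind) : dsum ind' := Subm (dmap_subproof x).
Lemma dmap_linear : linear dmap_fun.
Proof. by move=> a x y; apply: val_inj; rewrite /= linearP. Qed.
Lemma dmap_hom i x : x \in gpart i -> mklin dmap_linear x \in gpart (i + c).
Proof. by move=> /submod_ofP xi; apply/submod_ofP; exact: phiP. Qed.
Definition dmap : hlin (dsum ind) (dsum ind') := Hlin dmap_hom.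
End DirectSumMap.

Section Series.
Variables (k : fieldType) (B : bgmod k).

Definition hser_part (i : Z2) : submodClosed (nat -> B) :=
  submod_of
    (P := fun f : nat -> B => forall r, f r \in gpart (i.1 + r%:Z, i.2 - r%:Z))
    (fun r => sm0 _)
    (fun a f g fP gP r => smD (smZ a (fP r)) (gP r)).

Lemma hser_indep : independent hser_part.
Proof.
move=> s f us fV e i iS; apply/funext => r.
pose g (j : Z2) : B := f (j - (r%:Z, - r%:Z)) r.
have gV j : g j \in gpart j.
  have /submod_ofP/(_ r) := fV (j - (r%:Z, - r%:Z)).
  by congr (_ \in gpart _); apply: Z2_eq => /=; ring.
have := @gmod_indep k _ B [seq j + (r%:Z, - r%:Z) | j <- s] g _ gV _
          (i + (r%:Z, - r%:Z)) _.
rewrite /g addrK; apply.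
- by rewrite map_inj_uniq //; exact: addIr.
- have := congr1 (fun h : nat -> B => h r) e; rewrite /= fct_sumE => er.
  rewrite big_map -[RHS]er; apply: eq_bigr => j _; by rewrite addrK.
- exact: map_f.
Qed.

(* B[[h]]^bgr, the direct sum over (p, q) of the prod_r B^(p+r, q-r) h^r, where *)
(* h is the formal parameter, in bidegree (-1, 1).                             *)
Definition hser : bgmod k := dsum hser_indep.

Definition hcoef_fun (r : nat) (f : hser) : B := subm_val f r.
Lemma hcoef_linear r : linear (hcoef_fun r). Proof. by []. Qed.
Definition hcoef r : {linear hser -> B} := mklin (hcoef_linear r).

Lemma hcoef_hom r i (f : hser) :
  f \in gpart i -> hcoef r f \in gpart (i + (r%:Z, - r%:Z)).
Proof. by move=> /submod_ofP/submod_ofP; apply. Qed.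

Definition shift_up (f : nat -> B) : nat -> B :=
  fun r => if r is r'.+1 then f r' else 0.
Lemma shift_up_linear : linear shift_up.
Proof.
move=> a f g; apply/funext => -[|r] //=.
by rewrite /shift_up !fctE /= scaler0 addr0.
Qed.
Lemma shift_upP i f : f \in hser_part i ->
  mklin shift_up_linear f \in hser_part (i + (-1, 1)).
Proof.
move=> /submod_ofP fP; apply/submod_ofP => -[|r] /=; first exact: sm0.
have := fP r; congr (_ \in gpart _); apply: Z2_eq; rewrite /= intS; ring.
Qed.
Definition hbar : hlin hser hser := dmap hser_indep hser_indep shift_upP.

Definition shift_down (f : nat -> B) : nat -> B := fun r => f r.+1.
Lemma shift_down_linear : linear shift_down. Proof. by []. Qed.
Lemma shift_downP i f : f \in hser_part i ->
  mklin shift_down_linear f \in hser_part (i + (1, -1)).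
Proof.
move=> /submod_ofP fP; apply/submod_ofP => r.
have := fP r.+1; congr (_ \in gpart _); apply: Z2_eq; rewrite /= intS; ring.
Qed.
(* division by h; it is only meaningful on h B[[h]]^bgr *)
Definition hbar_inv : hlin hser hser := dmap hser_indep hser_indep shift_downP.

Lemma hbarK : cancel hbar hbar_inv.
Proof. by move=> f; apply: val_inj. Qed.

Definition const_series (b : B) : nat -> B := fun r => if r is 0 then b else 0.
Lemma const_series_linear : linear const_series.
Proof.
move=> a b c; apply/funext => -[|r] //=.
by rewrite /const_series !fctE /= scaler0 addr0.
Qed.
Lemma const_seriesP i b : b \in gpart i -> const_series b \in hser_part i.
Proof.
move=> bi; apply/submod_ofP => -[|r]; last exact: sm0.
by rewrite addr0 subr0; case: (i) bi.
Qed.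
Lemma hconst_subproof b : const_series b \in dspan hser_part.
Proof.
apply/submod_ofP; have [s sV ->] := gmod_sum b.
exists [seq (p.1, const_series p.2) | p <- s].
  by rewrite all_map; apply/allP => p /(allP sV) /const_seriesP.
rewrite big_map; exact: (linear_sum (mklin const_series_linear)).
Qed.
Definition hconst_fun b : hser := Subm (hconst_subproof b).
Lemma hconst_linear : linear hconst_fun.
Proof. by move=> a b c; apply: val_inj; exact: const_series_linear. Qed.
Definition hconst : {linear B -> hser} := mklin hconst_linear.
Lemma hconst_hom i b : b \in gpart i -> hconst b \in @gpart _ _ hser i.
Proof. by move=> bi; apply/submod_ofP; exact: const_seriesP. Qed.

Definition in_hbarX (N : nat) (f : hser) : Prop := exists g, f = iter N hbar g.
End Series.
Arguments hbar {k B}.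
Arguments hbar_inv {k B}.
Arguments hconst {k B}.
Arguments hcoef {k B}.

Section Deformations.
Variable k : fieldType.

(* A k-linear map commuting with h is k[h]-linear. By the universal property   *)
(* of the completed tensor product over k[h], a k[h]-linear map of given       *)
(* bidegree from the n-th completed tensor power of V[[h]]^bgr to W[[h]]^bgr   *)
(* is a k[h]-multilinear map of this bidegree, as the target is complete.      *)
Definition hbar_linear (V W : bgmod k) (f : seq (hser V) -> hser W) : Prop :=
  forall l r x, f (l ++ hbar x :: r) = hbar (f (l ++ x :: r)).

Definition reduces_to (V W : bgmod k) (tf : seq (hser V) -> hser W)
    (f : seq V -> W) : Prop :=
  forall xs, hcoef 0 (tf xs) = f [seq hcoef 0 x | x <- xs].

(* Data of an A_infinity-algebra with a compatible bigrading of s-th type and  *)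
(* of a formal bigraded deformation of it.                                     *)
Record deform_data (s : nat) := Deform {
  dB : bgmod k;
  dm : gmulti dB dB (alg_deg s);
  dtm : gmulti (hser dB) (hser dB) (alg_deg s) }.

(* The identities of an A_infinity-algebra over k[h]/(h^(N+1)) are expressed   *)
(* as congruences modulo h^(N+1).                                              *)
Definition is_deformation (V : bgmod k) (m : seq V -> V)
    (tm : seq (hser V) -> hser V) : Prop :=
  [/\ hbar_linear tm,
      forall N ds xs, homog (@gpart _ _ (hser V)) ds xs ->
        in_hbarX N.+1 (stasheff tot tm ds xs)
    & reduces_to tm m].

Definition is_deform (s : nat) (X : deform_data s) : Prop :=
  is_bAinf (dB X) (dm X) /\ is_deformation (dm X) (dtm X).

Definition is_hbar_morphism (V W : bgmod k) (tmV : seq (hser V) -> hser V)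
    (tmW : seq (hser W) -> hser W) (tf : seq (hser V) -> hser W) : Prop :=
  hbar_linear tf /\
  forall N ds xs, homog (@gpart _ _ (hser V)) ds xs ->
    in_hbarX N.+1 (insertion_sum tot tf tmV ds xs - block_sum tot tmW tf ds xs).

Section ProcedureStep.
Variables (s : nat) (V : bgmod k).
Variables (m : gmulti V V (alg_deg s)) (tm : gmulti (hser V) (hser V) (alg_deg s)).

(* The structure maps of the dg algebra P(V_h), where V_h is given by tm. *)
Definition P_fun (xs : seq V) : V :=
  match xs with
  | [:: x] => hcoef 1 (tm [:: hconst x])
  | [:: x; y] => m [:: x; y]
  | _ => 0
  end.

Lemma P_multilinear : multilinear P_fun.
Proof.
case=> [|u [|v l]] [|z [|w r]] a x y /=; rewrite ?scaler0 ?addr0 //.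
- by rewrite linearP (gmultiL tm [::] [::]) linearP.
- by rewrite (gmultiL m [::] [:: z]).
- by rewrite (gmultiL m [:: u] [::]).
- by case: l => [|? l] /=; rewrite scaler0 addr0.
- by case: l => [|? l] /=; rewrite scaler0 addr0.
- by case: l => [|? l] /=; rewrite scaler0 addr0.
Qed.

Lemma P_homog :
  multihomog (@gpart _ _ V) (@gpart _ _ V) (alg_deg s.+1) P_fun.
Proof.
move=> ds [|x [|y [|z xs]]] h /=; try exact: sm0.
- case: ds h => [|d [|e ds]]; rewrite /homog /= ?andbF // andbT big_seq1 => xd.
  have ch : homog (@gpart _ _ (hser V)) [:: d] [:: hconst x].
    by apply/andP; split; first exact: hconst_hom.
  have := hcoef_hom 1 (gmultiP tm ch); rewrite big_seq1.
  congr (_ \in gpart _); rewrite -addrA; congr (_ + _).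
  by apply: Z2_eq; rewrite /alg_deg /= intS; ring.
- have := @gmultiP _ _ _ _ _ m _ _ h; congr (_ \in gpart _); congr (_ + _).
  by rewrite /alg_deg /= subrr !mul0r.
Qed.

Definition P_alg : gmulti V V (alg_deg s.+1) :=
  Gmulti (mfun := P_fun) (erefl _) P_multilinear P_homog.

(* The structure maps h^(i-2) tm_i of T(V_h); for i = 1, the values of tm_1    *)
(* are divisible by h when m_1 = 0.                                            *)
Definition T_fun (xs : seq (hser V)) : hser V :=
  if size xs == 1%N then hbar_inv (tm xs)
  else iter (size xs - 2) hbar (tm xs).

Lemma iter_hbarP n a (x y : hser V) :
  iter n hbar (a *: x + y) = a *: iter n hbar x + iter n hbar y.
Proof. by elim: n => //= n ->; rewrite linearP. Qed.

Lemma iter_hbar_hom n i (x : hser V) : x \in gpart i ->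
  iter n hbar x \in gpart (i + (- n%:Z, n%:Z)).
Proof.
move=> xi; elim: n => [|n IH].
  by move: xi; congr (_ \in gpart _); apply: Z2_eq; rewrite /= ?oppr0 addr0.
have := hlinP hbar IH; congr (_ \in gpart _); rewrite -addrA; congr (_ + _).
by apply: Z2_eq; rewrite /= intS; ring.
Qed.

Lemma T_fun0 : T_fun [::] = 0.
Proof. by rewrite /T_fun /= gmulti0. Qed.

Lemma T_multilinear : multilinear T_fun.
Proof.
move=> l r a x y; rewrite /T_fun !size_cat /= !addnS gmultiL.
by case: ifP => _; rewrite ?linearP // iter_hbarP.
Qed.

Lemma T_homog :
  multihomog (@gpart _ _ (hser V)) (@gpart _ _ (hser V)) (alg_deg s.+1) T_fun.
Proof.
move=> ds xs h; have th := gmultiP tm h.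
case: xs h th => [|x [|y xs]] h th.
- by rewrite T_fun0; exact: sm0.
- change (T_fun [:: x]) with (hbar_inv (tm [:: x])).
  have := hlinP hbar_inv th; congr (_ \in gpart _); rewrite -addrA; congr (_ + _).
  by apply: Z2_eq; rewrite /= intS; ring.
- have -> : T_fun [:: x, y & xs] = iter (size xs) hbar (tm [:: x, y & xs]).
    by rewrite /T_fun /= !subSS subn0.
  have := iter_hbar_hom (size xs) th.
  congr (_ \in gpart _); rewrite -addrA; congr (_ + _).
  by apply: Z2_eq; rewrite /= !intS; ring.
Qed.

Definition T_alg : gmulti (hser V) (hser V) (alg_deg s.+1) :=
  Gmulti T_fun0 T_multilinear T_homog.

Definition PT : deform_data s.+1 := Deform P_alg T_alg.
End ProcedureStep.

(* Data of a model on the cohomology of X (mo_m, mo_f), of a formal bigraded   *)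
(* deformation of it (mo_tm) and of a quasi-isomorphism to X_h (mo_tf).        *)
Record model_data (s : nat) (X : deform_data s)
    (H := coh (arity1 (dm X))) := Model {
  mo_m : gmulti H H (alg_deg s);
  mo_f : gmulti H (dB X) (mor_deg s);
  mo_tm : gmulti (hser H) (hser H) (alg_deg s);
  mo_tf : gmulti (hser H) (hser (dB X)) (mor_deg s) }.

Definition hcls (V : bgmod k) (d : hlin V V) (x : V) : coh d :=
  cls (gker d) (gim d) x.

Definition is_model (s : nat) (X : deform_data s) (M : model_data X) : Prop :=
  let H := coh (arity1 (dm X)) in
  let d x := dm X [:: x] in
  [/\ is_bAinf H (mo_m M),
      forall c, mo_m M [:: c] = 0,
      forall x y, d x = 0 -> d y = 0 ->
        mo_m M [:: hcls (arity1 (dm X)) x; hcls (arity1 (dm X)) y]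
          = hcls (arity1 (dm X)) (dm X [:: x; y]),
      is_Ainf_morphism tot (@gpart _ _ H) (mo_m M) (dm X) (mo_f M)
        /\ is_quasi_iso (fun c => mo_m M [:: c]) d (fun c => mo_f M [:: c])
    & forall c, d (mo_f M [:: c]) = 0
        /\ hcls (arity1 (dm X)) (mo_f M [:: c]) = c].

Definition is_model_deformation (s : nat) (X : deform_data s)
    (M : model_data X) : Prop :=
  [/\ is_deformation (mo_m M) (mo_tm M),
      is_hbar_morphism (mo_tm M) (dtm X) (mo_tf M),
      reduces_to (mo_tf M) (mo_f M)
    & is_quasi_iso (fun c => mo_tm M [:: c]) (fun x => dtm X [:: x])
        (fun c => mo_tf M [:: c])].

(* ch makes the choices of the successive steps; only its values at the stages *)
(* matter.                                                                     *)
Section Procedure.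
Variables (X0 : deform_data 0) (ch : forall s (X : deform_data s), model_data X).

Fixpoint stage (r : nat) : deform_data r :=
  match r return deform_data r with
  | 0 => X0
  | r'.+1 => PT (mo_m (ch (stage r'))) (mo_tm (ch (stage r')))
  end.

Definition valid_procedure : Prop :=
  forall r, [/\ is_deform (stage r), is_model (ch (stage r))
              & is_model_deformation (ch (stage r))].
End Procedure.

End Deformations.

Section SpectralSequences.
Variable k : fieldType.

(* Pages are indexed from 0: the data of index r are those of page r + 1.      *)
Record ss_data := SSData {
  page : nat -> bgmod k;
  ss_d : forall r, hlin (page r) (page r);
  ss_mul : forall r, page r -> page r -> page r;
  ss_next : forall r, coh (ss_d r) -> page r.+1 }.

(* the product induced on cohomology, computed on representatives *)
Definition coh_mul (V : bgmod k) (d : hlin V V) (mul : V -> V -> V) :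
    coh d -> coh d -> coh d :=
  fun x y => hcls d (mul (sqval x) (sqval y)).

Definition bihomog (V W : bgmod k) (c : Z2) (f : V -> W) : Prop :=
  forall i x, x \in gpart i -> f x \in gpart (i + c).

Record algebra_iso (V W : bgmod k) (mV : V -> V -> V) (mW : W -> W -> W)
    (f : V -> W) : Prop := {
  iso_linear : linear f;
  iso_bij : bijective f;
  iso_hom : bihomog 0 f;
  iso_mul : forall x y, f (mV x y) = mW (f x) (f y) }.

Record dg_algebra_page (r : nat) (V : bgmod k) (d : V -> V) (mul : V -> V -> V)
    : Prop := {
  page_d_deg : bihomog (r%:Z, 1 - r%:Z) d;
  page_d2 : forall x, d (d x) = 0;
  page_mul_linl : forall y, linear (mul^~ y);
  page_mul_linr : forall x, linear (mul x);
  page_mul_deg : forall i j x y, x \in gpart i -> y \in gpart j ->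
    mul x y \in gpart (i + j);
  page_mulA : associative mul;
  page_leibniz : forall i x y, x \in gpart i ->
    d (mul x y) = mul (d x) y + ksign k (tot i) *: mul x (d y) }.

Definition is_mult_ss (E : ss_data) : Prop :=
  forall r, dg_algebra_page r.+1 (ss_d E r) (@ss_mul E r)
    /\ algebra_iso (coh_mul (d := ss_d E r) (@ss_mul E r)) (@ss_mul E r.+1)
         (@ss_next E r).

Definition ss_iso (E E' : ss_data) : Prop :=
  exists phi : forall r, page E r -> page E' r,
    [/\ forall r, algebra_iso (@ss_mul E r) (@ss_mul E' r) (phi r),
        forall r x, phi r (ss_d E r x) = ss_d E' r (phi r x)
      & forall r x, ss_d E r x = 0 ->
          phi r.+1 (ss_next (hcls (ss_d E r) x))
            = ss_next (hcls (ss_d E' r) (phi r x))].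

Definition procedure_ss (X0 : deform_data k 0)
    (ch : forall s (X : deform_data k s), model_data X) : ss_data :=
  @SSData (fun r => dB (stage X0 ch r.+1))
    (fun r => arity1 (dm (stage X0 ch r.+1)))
    (fun r x y => dm (stage X0 ch r.+1) [:: x; y])
    (fun r c => c).

Definition has_Ainf_enhancement (E : ss_data) : Prop :=
  is_mult_ss E /\
  exists X0 ch, valid_procedure X0 ch /\ ss_iso E (procedure_ss X0 ch).

Section CoupleSpectralSequence.
Variables (C : ecouple k Z2) (mul : cE C -> cE C -> cE C).
Definition couple_page (r : nat) : ecouple k Z2 :=
  iter r (@derive k Z2) C.
Fixpoint couple_mul (r : nat) :
    cE (couple_page r) -> cE (couple_page r) -> cE (couple_page r) :=
  match r with
  | 0 => mul
  | r'.+1 => coh_mul (d := cd (couple_page r')) (@couple_mul r')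
  end.
(* The spectral sequence, starting at 1, of an exact couple whose term E       *)
(* carries a product.                                                          *)
Definition couple_ss : ss_data :=
  @SSData (fun r => cE (couple_page r)) (fun r => cd (couple_page r))
    couple_mul (fun r c => c).
End CoupleSpectralSequence.
End SpectralSequences.

Section FilteredAinfinity.
Variable k : fieldType.

Record filtered_Ainf := FilteredAinf {
  fA :> gmod k int;
  fm : gmulti fA fA (fun n => 2 - n%:Z);
  fm_Ainf : is_Ainf id (@gpart _ _ fA) fm;
  fil : int -> gsub fA;
  fil_dec : forall p x, x \in fil (p + 1) -> x \in fil p;
  fil_mul : forall ps xs, all2 (fun p x => x \in fil p) ps xs ->
    fm xs \in fil (\sum_(p <- ps) p);
  fil_exhaustive : forall x, exists p, x \in fil p;
  (* in each degree n, the map A^n -> lim_q A^n / F^q A^n is injective ... *)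
  fil_separated : forall n x, x \in @gpart _ _ fA n ->
    (forall q, x \in fil q) -> x = 0;
  (* ... and surjective *)
  fil_complete : forall n (u : int -> fA),
    (forall q, u q \in gpart n) ->
    (forall q q', q <= q' -> u q' - u q \in fil q) ->
    exists2 x, x \in gpart n & forall q, x - u q \in fil q }.

Definition compatible_bigrading (s : nat) (A : gmod k int) (m : seq A -> A)
    (bg : Z2 -> submodClosed A) : Prop :=
  [/\ is_grading bg,
      forall n x, x \in @gpart _ _ A n <->
        homsum (fun p : int => bg (p, n - p)) x
    & multihomog bg bg (alg_deg s) m].

Section Rees.
Variable A : filtered_Ainf.
Local Notation m := (fm A).

(* The element x (x) h^(-p), x in F^p A, is encoded by the family int -> A     *)
(* with value x at p and 0 elsewhere.                                          *)
Definition rees_part (i : Z2) : submodClosed (int -> A).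
Proof.
apply: (@submod_of k _ (fun f : int -> A =>
  [/\ f i.1 \in gpart (i.1 + i.2), f i.1 \in fil A i.1
    & forall p, p != i.1 -> f p = 0])).
- by split=> //; exact: sm0.
- move=> a f g [f1 f2 f0] [g1 g2 g0]; split.
  + exact: smD (smZ a f1) g1.
  + exact: smD (smZ a f2) g2.
  + by move=> p pi; rewrite -[LHS]/(a *: f p + g p) f0 // g0 // scaler0 addr0.
Defined.

Lemma rees_partP i (f : int -> A) : reflect
  [/\ f i.1 \in gpart (i.1 + i.2), f i.1 \in fil A i.1
    & forall p, p != i.1 -> f p = 0] (f \in rees_part i).
Proof. exact: submod_ofP. Qed.

Lemma rees_indep : independent rees_part.
Proof.
move=> s f us fV e [p q] iS; apply/funext => x.
have [->|xp] := eqVneq x p; last first.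
  by case/rees_partP: (fV (p, q)) => _ _ ->.
pose t := [seq i <- s | i.1 == p].
have ut : uniq [seq i.1 + i.2 | i <- t].
  rewrite map_inj_in_uniq ?filter_uniq // => -[a b] [c d].
  rewrite !mem_filter /= => /andP[/eqP -> _] /andP[/eqP -> _] /addrI -> //.
have e' : \sum_(n <- [seq i.1 + i.2 | i <- t]) f (p, n - p) p = 0.
  have := congr1 (fun h : int -> A => h p) e; rewrite /= fct_sumE => ep.
  rewrite big_map -[RHS]ep big_filter big_mkcond /=; apply: eq_bigr => -[a b] _ /=.
  case: eqP => [->|/eqP ap]; first by rewrite addrC addKr.
  by case/rees_partP: (fV (a, b)) => _ _ -> //; rewrite eq_sym.
have := @gmod_indep _ _ _ _ (fun n => f (p, n - p) p) ut _ e' (p + q) _.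
rewrite [p + q]addrC addrK => -> //.
- by move=> n; case/rees_partP: (fV (p, n - p)) => /=; rewrite addrCA subrr addr0.
- by rewrite addrC; apply/mapP; exists (p, q); rewrite // mem_filter /= eqxx.
Qed.

(* The direct sum of the F^p A (x) k h^(-p). *)
Definition rees : bgmod k := dsum rees_indep.

Definition rees_shift (f : int -> A) : int -> A := fun p => f (p + 1).
Lemma rees_shift_linear : linear rees_shift. Proof. by []. Qed.
Lemma rees_shiftP i f : f \in rees_part i ->
  mklin rees_shift_linear f \in rees_part (i + (-1, 1)).
Proof.
move=> /rees_partP[f1 f2 f0]; apply/rees_partP; split.
- rewrite [X in X \in _](_ : _ = f i.1); last by congr f; rewrite /= subrK.
  by move: f1; congr (_ \in gpart _); rewrite /=; ring.
- rewrite [X in X \in _](_ : _ = f i.1); last by congr f; rewrite /= subrK.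
  by apply: fil_dec; rewrite /= subrK.
- move=> p pi; apply: f0; apply: contra pi => /eqP e.
  by rewrite /= -e addrK.
Qed.
(* multiplication by h: x h^(-p) is mapped to x h^(-(p - 1)) *)
Definition rees_h : hlin rees rees := dmap rees_indep rees_indep rees_shiftP.

Lemma rees_h_inj : injective rees_h.
Proof.
move=> f g e; apply: val_inj; apply/funext => p.
have := congr1 (fun h : rees => subm_val h (p - 1)) e.
by rewrite /= /mklin_fun /rees_shift subrK.
Qed.

Definition rees_diff (f : int -> A) : int -> A := fun p => m [:: f p].
Lemma rees_diff_linear : linear rees_diff.
Proof.
by move=> a f g; apply/funext => p; exact: (gmultiL m [::] [::] a (f p) (g p)).
Qed.
Lemma rees_diffP i f : f \in rees_part i ->
  mklin rees_diff_linear f \in rees_part (i + (0, 1)).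
Proof.
move=> /rees_partP[f1 f2 f0]; apply/rees_partP; rewrite /= addr0; split.
- have := @gmultiP _ _ _ _ _ m [:: i.1 + i.2] [:: f i.1].
  by rewrite /homog /= f1 big_seq1 => /(_ isT); congr (_ \in gpart _); ring.
- have := @fil_mul A [:: i.1] [:: f i.1].
  by rewrite /= f2 big_seq1 => /(_ isT).
- move=> p pi; rewrite /mklin_fun /rees_diff f0 //.
  exact: (linear0 (arity1 m)).
Qed.
Definition rees_d : hlin rees rees := dmap rees_indep rees_indep rees_diffP.

Lemma fm1_square x : m [:: m [:: x]] = 0.
Proof.
have hom n y : y \in @gpart _ _ A n -> m [:: m [:: y]] = 0.
  move=> yn; have := @fm_Ainf A [:: n] [:: y]; rewrite /homog /= yn => /(_ isT).
  rewrite /stasheff /insertion_sum /= big_ord1 big_mkcond big_ord_recl big_ord1 /=.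
  by rewrite big_nil mulr0 /ksign /= add0r !expr0 mulr1 scale1r.
have [s sV ->] := gmod_sum x.
rewrite -[m [:: m _]]/((arity1 m \o arity1 m) (\sum_(p <- s) p.2)) linear_sum.
by rewrite big_seq big1 // => p /(allP sV); exact: hom.
Qed.

Lemma rees_d2 f : rees_d (rees_d f) = 0.
Proof. by apply: val_inj; apply/funext => p; exact: fm1_square. Qed.

Lemma rees_hd f : rees_h (rees_d f) = rees_d (rees_h f).
Proof. exact: val_inj. Qed.

(* rees / h rees is the direct sum of the F^p A / F^(p+1) A. *)
Definition gr : bgmod k := gsubquot (gfull rees) (gim rees_h).

Lemma in_gfull (f : rees) : f \in gfull rees.
Proof. exact/submod_ofP. Qed.

Definition gr_proj_fun (f : rees) : gr := cls (gfull rees) (gim rees_h) f.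
Lemma gr_proj_linear : linear gr_proj_fun.
Proof. by move=> a f g; rewrite /gr_proj_fun cls_lin ?in_gfull. Qed.
Lemma gr_proj_hom i f : f \in gpart i -> mklin gr_proj_linear f \in gpart (i + 0).
Proof.
by move=> fi; rewrite addr0; apply/submod_ofP; exists f; split; rewrite ?in_gfull.
Qed.
Definition gr_proj : hlin rees gr := Hlin gr_proj_hom.

Lemma gr_dZ f : f \in gfull rees -> rees_d f \in gfull rees.
Proof. by rewrite !in_gfull. Qed.
Lemma gr_dB f : f \in gfull rees -> f \in gim rees_h -> rees_d f \in gim rees_h.
Proof.
by move=> _ /gimP[g ->]; apply/gimP; exists (rees_d g); rewrite rees_hd.
Qed.
Definition gr_d : hlin gr gr := sqmap gr_dZ gr_dB.

Lemma gr_proj_surj c : exists f, c = gr_proj f.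
Proof. by exists (sqval c); rewrite [RHS]sqvalK. Qed.
Lemma gr_exact : exact_at rees_h gr_proj.
Proof.
move=> f; split.
  by move=> /(cls_eq0 _ (in_gfull f))/gimP.
by move=> fh; apply/(cls_eq0 _ (in_gfull f))/gimP.
Qed.
Lemma gr_projd f : gr_proj (rees_d f) = gr_d (gr_proj f).
Proof. by rewrite [RHS](sqmapE gr_dZ gr_dB (in_gfull f)). Qed.

Definition filtration_couple : ecouple k Z2 :=
  les_couple rees_d2 rees_h_inj gr_proj_surj gr_exact rees_hd gr_projd.

(* the product (x h^(-a)) (y h^(-b)) = m_2(x, y) h^(-(a+b)) *)
Definition conv (f g : int -> A) : int -> A :=
  fun p => \sum_(a \in [set: int]) m [:: f a; g (p - a)].

Definition fsupp (f : int -> A) : Prop :=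
  exists2 s : seq int, uniq s & forall a, a \notin s -> f a = 0.

Lemma m20l y : m [:: 0; y] = 0.
Proof.
have := gmultiL m [::] [:: y] (-1) 0 0; rewrite scaler0 addr0 /= => ->.
by rewrite scaleN1r addNr.
Qed.
Lemma m20r y : m [:: y; 0] = 0.
Proof.
have := gmultiL m [:: y] [::] (-1) 0 0; rewrite scaler0 addr0 /= => ->.
by rewrite scaleN1r addNr.
Qed.

Lemma convE s (f g : int -> A) p : uniq s -> (forall a, a \notin s -> f a = 0) ->
  conv f g p = \sum_(a <- s) m [:: f a; g (p - a)].
Proof.
move=> us f0; rewrite /conv (fsbigE s) //.
  by apply: eq_bigl => a; rewrite in_setT.
by move=> a _ /f0 ->; rewrite m20l.
Qed.

Lemma fsupp_sum (s : seq (Z2 * (int -> A))) :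
  all (fun u => u.2 \in rees_part u.1) s -> fsupp (\sum_(u <- s) u.2).
Proof.
move=> sV; exists (undup [seq u.1.1 | u <- s]); first exact: undup_uniq.
move=> a; rewrite mem_undup => as'; rewrite fct_sumE big_seq big1 // => u us.
have /rees_partP[_ _ -> //] := allP sV _ us.
by apply: contra as' => /eqP ->; apply: map_f.
Qed.

Lemma conv0l g : conv 0 g = 0.
Proof.
by apply/funext => p; rewrite (@convE [::]) ?big_nil.
Qed.

Lemma convDl f f' g : fsupp f -> fsupp f' -> conv (f + f') g = conv f g + conv f' g.
Proof.
move=> [s us f0] [t ut f0']; apply/funext => p.
have uw : uniq (undup (s ++ t)) by exact: undup_uniq.
have fw a : a \notin undup (s ++ t) -> f a = 0.
  by rewrite mem_undup mem_cat negb_or => /andP[/f0].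
have fw' a : a \notin undup (s ++ t) -> f' a = 0.
  by rewrite mem_undup mem_cat negb_or => /andP[_ /f0'].
have fw2 a : a \notin undup (s ++ t) -> (f + f') a = 0.
  by move=> h; rewrite fctE fw // fw' // addr0.
rewrite [RHS](_ : _ = conv f g p + conv f' g p) //.
rewrite (convE _ _ uw fw2) (convE _ _ uw fw) (convE _ _ uw fw') -big_split /=.
apply: eq_bigr => a _; have := gmultiL m [::] [:: g (p - a)] 1 (f a) (f' a).
by rewrite !scale1r.
Qed.

Lemma conv_hom i j f g : f \in rees_part i -> g \in rees_part j ->
  conv f g \in rees_part (i + j).
Proof.
move=> /rees_partP[f1 f2 f0] /rees_partP[g1 g2 g0].
have cE p : conv f g p = m [:: f i.1; g (p - i.1)].
  rewrite (@convE [:: i.1]) ?big_seq1 // => a; rewrite inE; exact: f0.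
apply/rees_partP; rewrite !cE /= [i.1 + j.1]addrC addrK; split.
- have := @gmultiP _ _ _ _ _ m [:: i.1 + i.2; j.1 + j.2] [:: f i.1; g j.1].
  rewrite /homog /= f1 g1 big_cons big_seq1 => /(_ isT).
  by congr (_ \in gpart _); rewrite subrr addr0; ring.
- have := @fil_mul A [:: i.1; j.1] [:: f i.1; g j.1].
  by rewrite /= f2 g2 big_cons big_seq1 addrC => /(_ isT).
- move=> p pij; rewrite cE g0 ?m20r //.
  by apply: contra pij => /eqP <-; rewrite subrK.
Qed.

Lemma conv_span f g : f \in dspan rees_part -> g \in dspan rees_part ->
  conv f g \in dspan rees_part.
Proof.
move=> /submod_ofP[s sV ->] /submod_ofP[t tV ->].
elim: s sV => [|u s IH] sV.
  by rewrite big_nil conv0l; exact: sm0.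
have /andP[uV sV'] : (u.2 \in rees_part u.1) && all (fun v => v.2 \in rees_part v.1) s.
  exact: sV.
rewrite big_cons convDl; last 2 first.
- have := @fsupp_sum [:: u]; rewrite big_seq1; apply.
  by rewrite /= uV.
- exact: fsupp_sum.
apply: smD; last exact: IH.
have /rees_partP[_ _ u0] := uV.
have cE g' p : conv u.2 g' p = m [:: u.2 u.1.1; g' (p - u.1.1)].
  by rewrite (@convE [:: u.1.1]) ?big_seq1 // => a; rewrite inE; exact: u0.
have -> : conv u.2 (\sum_(v <- t) v.2) = \sum_(v <- t) conv u.2 v.2.
  apply/funext => p; rewrite cE !fct_sumE.
  elim: (t) => [|v t' IHt]; first by rewrite !big_nil m20r.
  rewrite !big_cons -IHt cE.
  have := gmultiL m [:: u.2 u.1.1] [::] 1 (v.2 (p - u.1.1)) (\sum_(w <- t') w.2 (p - u.1.1)).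
  by rewrite !scale1r.
rewrite big_seq; apply: rpred_sum => v vt; apply/submod_ofP.
by apply: (homsum_hom (i := u.1 + v.1)); apply: conv_hom => //; exact: (allP tV).
Qed.

Definition rees_mul (f g : rees) : rees := 
  Subm (conv_span (subm_valP f) (subm_valP g)).

(* the product of E_1 = H(gr), induced by m_2 through representatives *)
Definition gr_mul (x y : gr) : gr := gr_proj (rees_mul (sqval x) (sqval y)).

Definition filtration_ss : ss_data k :=
  @couple_ss k filtration_couple (coh_mul (d := gr_d) gr_mul).
End Rees.
End FilteredAinfinity.

(* Main.v *)
Require Import Defs.
From HB Require Import structures.
From mathcomp Require Import all_boot all_order all_algebra.
From mathcomp Require Import mathcomp_extra boolp classical_sets functions.
From mathcomp Require Import cardinality fsbigop.
From mathcomp Require Import zify ring.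

Set Implicit Arguments.
Unset Strict Implicit.
Unset Printing Implicit Defensive.
Import Order.TTheory GRing.Theory Num.Theory.
Local Open Scope ring_scope.

(** A filtration is the same as its Rees module, the sum of the F^p A h^(-p),
    and the operations of A extend to it k[h]-linearly because they respect the
    filtration.  Modulo h this is gr A.  As A is complete in each degree, every
    homogeneous element of the Rees module has exactly one h-adic expansion
    whose digits lie in the image of a chosen section of its projection to
    gr A.  So the Rees module is gr A[[h]]^bgr, and its operations are a formal
    bigraded deformation of gr A with the operations induced on it
    (rees_deformation).  The iterative procedure is applied to this deformation.

    The procedure never stops, since every formal deformation (B, tm) has a
    deformed minimal model (model_exists).  To build one, contract the complex
    B to its cohomology, which works over a field (contraction_exists).  The
    k[h]-linear extension of this contraction does not contract the deformed
    differential tm_1 = d_0 + delta, but delta vanishes modulo h, so that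
    1 + s delta is invertible on bigraded power series (one_plus_inverse) and
    the perturbation lemma (pert_chain, pert_pi, pert_homotopy) provides a
    contraction that does.  Homotopy transfer along it gives the operations on
    the cohomology and the morphism to B (transfer_morP, transfer_algP).  All
    ingredients are k[h]-linear, hence so are the results, and their reductions
    modulo h are the transfer along the contraction chosen first.  The next step
    starts from the operations h^(n-2) tm_n of this model; their identities are
    those of tm up to a power of h (PT_is_deform).

    The Koszul signs enter the transfer only through a change of variables.
    With tau the parity operator, x |-> (-1)^deg(x) x, and
    tw [x_1; ..; x_n] = [tau^(n-1) x_1; ..; tau^0 x_n], the maps m \o tw are the
    components of a coderivation and the maps f \o tw those of a morphism
    between tensor coalgebras on suspensions.  The Stasheff identities and the
    equations of a morphism become statements on plain sums over decompositions
    of a list (insertion_ins, block_comp), which are proved first, for abstract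
    additive maps.

    It remains to compare the spectral sequence of the exact couple of the
    filtration with that of the procedure (couple_ss_enhanced).  An element x of
    the Rees module with d x = h^(r+1) y defines a class on the page of index r
    of the couple, whose differential is the class of y (gr_class_d).  On the
    other side, the composite of the chosen quasi-isomorphisms leads from the
    deformed r-th stage to the Rees module, and since each step divides the
    differential by h, it satisfies d (descend x) = h^r (descend (D x)) with D
    the differential of that stage.  So the isomorphism of the first pages
    induces maps on all pages, and on each page these commute with the
    differentials: both send the class of descend x to that of D x, modulo h.
    The axioms of the pages of the couple are then read off from the stages,
    where they are the identities for m_1 and m_2. *)

(** * A decision procedure for abelian groups *)

(** The tactic zmodule proves the equations that hold in every abelian group, by
    comparing the integral coefficients of the atoms on both sides.  It matches
    atoms up to conversion, as the operands below often carry different, but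
    convertible, structures. *)
Inductive zexpr := ZVar of nat | ZZero | ZOpp of zexpr | ZAdd of zexpr & zexpr.

Fixpoint zeval (V : zmodType) (env : seq V) (e : zexpr) : V :=
  match e with
  | ZVar n => nth 0 env n
  | ZZero => 0
  | ZOpp e => - zeval env e
  | ZAdd e e' => zeval env e + zeval env e'
  end.

Fixpoint zcoef (e : zexpr) (n : nat) : int :=
  match e with
  | ZVar m => (m == n)%:Z
  | ZZero => 0
  | ZOpp e => - zcoef e n
  | ZAdd e e' => zcoef e n + zcoef e' n
  end.

Lemma zeval_coef (V : zmodType) (env : seq V) e :
  zeval env e = \sum_(i < size env) nth 0 env i *~ zcoef e i.
Proof.
elim: e => [n||e IH|e IH e' IH'] /=.
- have [nlt|nge] := ltnP n (size env).
    rewrite (bigD1 (Ordinal nlt)) //= eqxx big1 ?addr0 // => i.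
    by rewrite -val_eqE /= eq_sym => /negbTE ->.
  rewrite nth_default // big1 // => i _.
  by rewrite gtn_eqF ?mulr0z // (leq_trans (ltn_ord i)).
- by rewrite big1.
- by rewrite IH -sumrN; apply: eq_bigr => i _; rewrite mulrNz.
- by rewrite IH IH' -big_split; apply: eq_bigr => i _; rewrite mulrzDr.
Qed.

Lemma zeval_eq (V : zmodType) (env : seq V) e e' :
  all (fun i => zcoef e i == zcoef e' i) (iota 0 (size env)) ->
  zeval env e = zeval env e'.
Proof.
move=> /allP h; rewrite !zeval_coef; apply: eq_bigr => i _.
by rewrite (eqP (h i _)) // mem_iota /=.
Qed.

Ltac zindex env x :=
  match env with
  | ?y :: ?env' =>
      match constr:(tt) with
      | _ => let _ := match goal with _ => unify x y end in constr:(0%N)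
      | _ => let n := zindex env' x in constr:(n.+1)
      end
  end.
Ltac zenv env x :=
  match x with
  | GRing.add ?a ?b => let env1 := zenv env a in zenv env1 b
  | GRing.opp ?a => zenv env a
  | GRing.zero => env
  | _ => match env with
         | _ => let n := zindex env x in env
         | _ => constr:(x :: env)
         end
  end.
Ltac zreify env x :=
  match x with
  | GRing.add ?a ?b => let a' := zreify env a in let b' := zreify env b in
                       constr:(ZAdd a' b')
  | GRing.opp ?a => let a' := zreify env a in constr:(ZOpp a')
  | GRing.zero => constr:(ZZero)
  | _ => let n := zindex env x in constr:(ZVar n)
  end.
Ltac zmodule :=
  match goal with |- @eq ?T ?x ?y =>
    let env0 := zenv (@nil T) x in
    let env := zenv env0 y in
    let e := zreify env x in let e' := zreify env y in
    first [refine (@zeval_eq _ env e e' _) | change (@zeval _ env e = @zeval _ env e')];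
    vm_compute; reflexivity
  end.

(** * Sums over decompositions of a list *)

Section Splitting.
Variables (V : Type) (W : zmodType).
Implicit Types (K : seq V -> seq V -> W) (xs : seq V).

(** The pairing of K with the deconcatenation coproduct of the tensor coalgebra. *)
Definition split K xs : W :=
  \sum_(i < (size xs).+1) K (take i xs) (drop i xs).

Lemma split_nil K : split K [::] = K [::] [::].
Proof. by rewrite /split big_ord1. Qed.

Lemma split_cons K x xs :
  split K (x :: xs) = K [::] (x :: xs) + split (fun P R => K (x :: P) R) xs.
Proof. by rewrite /split /= big_ord_recl take0 drop0. Qed.

Lemma eq_split K K' xs :
  (forall P R, P ++ R = xs -> K P R = K' P R) -> split K xs = split K' xs.
Proof. by move=> e; apply: eq_bigr => i _; rewrite e ?cat_take_drop. Qed.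

Lemma splitD K K' xs :
  split (fun P R => K P R + K' P R) xs = split K xs + split K' xs.
Proof. exact: big_split. Qed.

Lemma split0 K xs : (forall P R, P ++ R = xs -> K P R = 0) -> split K xs = 0.
Proof. by move=> e; apply: big1 => i _; rewrite e ?cat_take_drop. Qed.

Lemma split_cat K xs y ys :
  split K (xs ++ y :: ys) = split (fun P R => K P (R ++ y :: ys)) xs
    + split (fun P R => K (xs ++ y :: P) R) ys.
Proof.
elim: xs K => [|x xs IH] K; first by rewrite split_cons split_nil.
by rewrite /= !split_cons IH addrA.
Qed.

(** Coassociativity of deconcatenation. *)
Lemma split_split (K : seq V -> seq V -> seq V -> W) xs :
  split (fun A R => split (fun B C => K A B C) R) xs
    = split (fun P C => split (fun A B => K A B C) P) xs.
Proof.
elim: xs K => [|x xs IH] K; first by rewrite !split_nil.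
rewrite !split_cons split_nil IH -addrA -splitD; congr (_ + _).
by apply: eq_split => P R _; rewrite split_cons.
Qed.

End Splitting.

Lemma split_map (U V : Type) (W : zmodType) (h : U -> V)
    (K : seq V -> seq V -> W) ys :
  split K (map h ys) = split (fun P R => K (map h P) (map h R)) ys.
Proof.
by rewrite /split size_map; apply: eq_bigr => i _; rewrite map_take map_drop.
Qed.

Lemma add_morph0 (W W' : zmodType) (h : W -> W') :
  {morph h : x y / x + y} -> h 0 = 0.
Proof. by move=> hD; apply: (addrI (h 0)); rewrite -hD !addr0. Qed.

Lemma add_morphN (W W' : zmodType) (h : W -> W') (x : W) :
  {morph h : x y / x + y} -> h (- x) = - h x.
Proof.
by move=> hD; apply/eqP; rewrite -subr_eq0 opprK -hD addNr (add_morph0 hD).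
Qed.

Lemma morph_split (V : Type) (W W' : zmodType) (h : W -> W')
    (K : seq V -> seq V -> W) xs : {morph h : x y / x + y} ->
  h (split K xs) = split (fun P R => h (K P R)) xs.
Proof. by move=> hD; apply: (big_morph h hD); exact: add_morph0. Qed.

(** Additivity, linearity and k[h]-linearity in one place of a list all say that
    the values at three lists satisfy a relation of this kind.  Being stable
    under sums, such relations pass to all the sums over decompositions below,
    so that the three properties are treated at once. *)
Record sumrel (W : zmodType) (S : W -> W -> W -> Prop) : Prop := SumRel {
  sumrel0 : S 0 0 0;
  sumrelD : forall z x y z' x' y',
    S z x y -> S z' x' y' -> S (z + z') (x + x') (y + y') }.

Lemma split_sumrel (V : Type) (W : zmodType) (S : W -> W -> W -> Prop)
    (K1 K2 K3 : seq V -> seq V -> W) xs ys zs : sumrel S ->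
  size xs = size ys -> size xs = size zs ->
  (forall i, (i <= size xs)%N ->
     S (K1 (take i xs) (drop i xs)) (K2 (take i ys) (drop i ys))
       (K3 (take i zs) (drop i zs))) ->
  S (split K1 xs) (split K2 ys) (split K3 zs).
Proof.
move=> [S0 SD] e1 e2 h; rewrite /split -e1 -e2.
have {}h : forall i : 'I_(size xs).+1,
   S (K1 (take i xs) (drop i xs)) (K2 (take i ys) (drop i ys))
       (K3 (take i zs) (drop i zs)) by move=> i; apply: h; rewrite -ltnS.
elim: (index_enum _) => [|i s IH]; first by rewrite !big_nil.
by rewrite !big_cons; exact: SD.
Qed.

(** With S and T the relation z = a x + y this is multilinearity; with z = h x,
    for all y, it is linearity over k[h]. *)
Definition placewise (V W : Type) (S : V -> V -> V -> Prop)
    (T : W -> W -> W -> Prop) (f : seq V -> W) : Prop :=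
  forall l r z x y, S z x y -> T (f (l ++ z :: r)) (f (l ++ x :: r)) (f (l ++ y :: r)).

Section Composition.
Variables (V M : Type) (W : zmodType).
Implicit Types (g : seq M -> W) (f : seq V -> M) (xs : seq V).

Fixpoint compn (n : nat) g f xs : W :=
  match xs, n with
  | [::], _ => g [::]
  | _ :: _, 0 => 0
  | x :: xs', n'.+1 =>
      split (fun B R => compn n' (fun ys => g (f (x :: B) :: ys)) f R) xs'
  end.

(** The value of g on the image of xs under the morphism of tensor coalgebras
    with components f: the sum of the g [f B_1; ..; f B_q] over the
    decompositions of xs into nonempty blocks B_j.  The recursion splits off the
    first block, so that g may keep track of the blocks before. *)
Definition comp g f xs := compn (size xs) g f xs.

Lemma compn_stable n m g f xs : (size xs <= n)%N -> (size xs <= m)%N ->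
  compn n g f xs = compn m g f xs.
Proof.
elim: n m g xs => [|n IH] [|m] g [|x xs] //= hn hm.
apply: eq_split => P R e; apply: IH; move: hn hm; rewrite -e size_cat;
  lia.
Qed.

Lemma comp_nil g f : comp g f [::] = g [::]. Proof. by []. Qed.

Lemma comp_cons g f x xs : comp g f (x :: xs) =
  split (fun B R => comp (fun ys => g (f (x :: B) :: ys)) f R) xs.
Proof.
rewrite {1}/comp /=; apply: eq_split => P R e; apply: compn_stable => //.
by rewrite -e size_cat leq_addl.
Qed.

Lemma suffix_ind (P : seq V -> Prop) :
  P [::] -> (forall x xs, (forall A R, A ++ R = xs -> P R) -> P (x :: xs)) ->
  forall xs, P xs.
Proof.
move=> P0 PS xs; have [n] := ubnP (size xs).
elim: n xs => // n IH [|x xs] //= hn; apply: PS => A R e; apply: IH.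
by move: hn; rewrite -e size_cat; lia.
Qed.

Lemma eq_compr g f f' xs :
  (forall B, (size B <= size xs)%N -> f B = f' B) -> comp g f xs = comp g f' xs.
Proof.
elim/suffix_ind: xs g => [|x xs IH] g ef //.
rewrite !comp_cons; apply: eq_split => P R e.
rewrite ef /=; last by rewrite -e size_cat; lia.
apply: (IH P R e) => B BR.
by apply: ef; move: BR; rewrite /= -e size_cat; lia.
Qed.

Lemma eq_compl g g' f xs : g =1 g' -> comp g f xs = comp g' f xs.
Proof. by move=> /funext ->. Qed.

Lemma comp_sumrel (S : W -> W -> W -> Prop) g1 g2 g3 f xs : sumrel S ->
  (forall ys, S (g1 ys) (g2 ys) (g3 ys)) ->
  S (comp g1 f xs) (comp g2 f xs) (comp g3 f xs).
Proof.
move=> SS; elim/suffix_ind: xs g1 g2 g3 => [|x xs IH] g1 g2 g3 h.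
  by rewrite !comp_nil.
rewrite !comp_cons; apply: split_sumrel => // i _.
by apply: (IH (take i xs)); rewrite ?cat_take_drop.
Qed.

Lemma compD g g' f xs :
  comp (fun ys => g ys + g' ys) f xs = comp g f xs + comp g' f xs.
Proof.
apply: (@comp_sumrel (fun z x y => z = x + y)) => //.
by split=> [|z x y z' x' y' -> ->]; rewrite ?addr0 // addrACA.
Qed.

Lemma comp0 g f xs : (forall ys, g ys = 0) -> comp g f xs = 0.
Proof.
move=> g0; apply: (@comp_sumrel (fun z _ _ => z = 0) g g g) => //.
by split=> // z x y z' x' y' -> ->; rewrite addr0.
Qed.

(** The morphism of coalgebras with components f commutes with coproducts. *)
Lemma comp_coproduct (K : seq M -> seq M -> W) f xs :
  comp (split K) f xs
    = split (fun P C => comp (fun Q => comp (K Q) f C) f P) xs.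
Proof.
elim/suffix_ind: xs K => [|x xs IH] K; first by rewrite comp_nil !split_nil.
rewrite comp_cons split_cons comp_nil.
rewrite (eq_split (K' := fun B R => comp (fun ys => K [::] (f (x :: B) :: ys)) f R
   + split (fun P C => comp (fun Q => comp (K (f (x :: B) :: Q)) f C) f P) R));
  last first.
  move=> B R e; rewrite -(IH B R e (fun Q => K (f (x :: B) :: Q))) -compD.
  by apply: eq_compl => ys; exact: split_cons.
rewrite splitD -comp_cons split_split; congr (_ + _).
apply: eq_split => P R _; rewrite comp_cons; apply: eq_split => A B _.
by apply: eq_compl.
Qed.

(** Multilinearity and k[h]-linearity of composites. *)
Lemma comp_placewise (SV : V -> V -> V -> Prop) (SM : M -> M -> M -> Prop)
    (SW : W -> W -> W -> Prop) g f : sumrel SW ->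
  placewise SV SM f -> placewise SM SW g -> placewise SV SW (comp g f).
Proof.
move=> S fP gP l r z x y zxy.
have [n] := ubnP (size (l ++ z :: r)); elim: n l g gP => // n IH l g gP hn.
have step v : placewise SM SW (fun ys => g (v :: ys)).
  by move=> l' r' z' x' y'; exact: (gP (v :: l')).
case: l hn => [|w l] hn /=.
  rewrite !comp_cons; apply: split_sumrel => // i _.
  apply: comp_sumrel => // ys; apply: (gP [::]); exact: (fP [::]).
rewrite !comp_cons !split_cat; apply: sumrelD => //.
  apply: split_sumrel => // i _; apply: (IH _ _ (step _)).
  by move: hn; rewrite /= !size_cat size_drop /=; lia.
apply: split_sumrel => // i _; apply: comp_sumrel => // ys.
by apply: (gP [::]); exact: (fP (w :: l)).
Qed.
End Composition.

Lemma morph_comp (V M : Type) (W W' : zmodType) (h : W -> W')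
    (g : seq M -> W) (f : seq V -> M) xs : {morph h : x y / x + y} ->
  h (comp g f xs) = comp (fun ys => h (g ys)) f xs.
Proof.
move=> hD; elim/suffix_ind: xs g => [|x xs IH] g //.
by rewrite !comp_cons morph_split //; apply: eq_split => B R e; exact: (IH B).
Qed.

Lemma comp_map (V V' M : Type) (W : zmodType) (h : V' -> V)
    (g : seq M -> W) (f : seq V -> M) xs :
  comp g f (map h xs) = comp g (fun B => f (map h B)) xs.
Proof.
elim/suffix_ind: xs g => [|x xs IH] g //=.
rewrite !comp_cons split_map; apply: eq_split => B R e; exact: (IH B).
Qed.

Lemma comp_mapr (V M M' : Type) (W : zmodType) (h : M -> M')
    (g : seq M' -> W) (f : seq V -> M) xs :
  comp g (fun B => h (f B)) xs = comp (fun ys => g (map h ys)) f xs.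
Proof.
elim/suffix_ind: xs g => [|x xs IH] g //=.
by rewrite !comp_cons; apply: eq_split => B R e; exact: (IH B).
Qed.

(** * Coderivations and morphisms of tensor coalgebras *)

Definition multiadditive (V W : zmodType) (f : seq V -> W) : Prop :=
  placewise (fun z x y => z = x + y) (fun z x y => z = x + y) f.

Section Additive.
Variables (V W : zmodType) (f : seq V -> W).
Hypothesis fD : multiadditive f.
Lemma maddP l r : {morph (fun x => f (l ++ x :: r)) : x y / x + y}.
Proof. by move=> x y; exact: fD. Qed.
Lemma madd0 l r : f (l ++ 0 :: r) = 0.
Proof. exact: (add_morph0 (maddP l r)). Qed.
Lemma maddN l r x : f (l ++ - x :: r) = - f (l ++ x :: r).
Proof.
by apply/eqP; rewrite -subr_eq0 opprK -(maddP l r) addNr madd0.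
Qed.
Lemma madd_cons x : multiadditive (fun ys => f (x :: ys)).
Proof. by move=> l r z u v; exact: (fD (x :: l)). Qed.
End Additive.

(** The coderivation with components b, followed by g.  Here s is the parity
    operator of the suspension: the sign of b passing an element x is carried by
    s x, and no further signs occur. *)
Definition ins (V : Type) (W : zmodType) (s : V -> V) (g : seq V -> W)
    (b : seq V -> V) (xs : seq V) : W :=
  split (fun A R => split (fun B C => g (map s A ++ b B :: C)) R) xs.

Lemma ins_cons (V : Type) (W : zmodType) (s : V -> V) (g : seq V -> W)
    (b : seq V -> V) x xs :
  ins s g b (x :: xs) = split (fun B C => g (b B :: C)) (x :: xs)
    + ins s (fun ys => g (s x :: ys)) b xs.
Proof. by rewrite /ins split_cons. Qed.

Lemma ins_nil (V W : zmodType) (s : V -> V) (g : seq V -> W)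
    (b : seq V -> V) : multiadditive g -> b [::] = 0 -> ins s g b [::] = 0.
Proof. by move=> gD b0; rewrite /ins !split_nil /= b0 (madd0 gD [::]). Qed.

Lemma ins_placewise (V : Type) (W : zmodType) (s : V -> V)
    (SV : V -> V -> V -> Prop) (SW : W -> W -> W -> Prop)
    (g : seq V -> W) (b : seq V -> V) : sumrel SW ->
  (forall z x y, SV z x y -> SV (s z) (s x) (s y)) ->
  placewise SV SV b -> placewise SV SW g -> placewise SV SW (ins s g b).
Proof.
move=> S sP bP gP l r z x y zxy; rewrite /ins !split_cat.
apply: sumrelD => //; apply: split_sumrel => // i _.
  rewrite !split_cat; apply: sumrelD => //; apply: split_sumrel => // j _.
    rewrite -!cat_cons !catA; exact: gP.
  by apply: gP; exact: bP.
apply: split_sumrel => // j _.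
by rewrite !map_cat /= -!catA !cat_cons; apply: gP; exact: sP.
Qed.

Lemma split_swap (T U : Type) (W : zmodType)
    (K : seq T -> seq T -> seq U -> seq U -> W) xs ys :
  split (fun A B => split (K A B) ys) xs
    = split (fun C D => split (fun A B => K A B C D) xs) ys.
Proof. exact: exchange_big. Qed.

Section Morphism.
Variables (V M W : zmodType) (s : V -> V) (f : seq V -> M) (u : seq V -> M).

(** The coderivation along the morphism f with components u, followed by g: one
    block is sent through u, and the others through f. *)
Definition insF (g : seq M -> W) (xs : seq V) : W :=
  split (fun A R => split (fun B C =>
    comp (fun ys => comp (fun zs => g (ys ++ u B :: zs)) f C) f (map s A)) R) xs.

Lemma insF_cons g x xs : insF g (x :: xs) =
  split (fun B C => comp (fun ys => g (u B :: ys)) f C) (x :: xs)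
  + split (fun P R => insF (fun ys => g (f (map s (x :: P)) :: ys)) R) xs.
Proof.
rewrite /insF split_cons; congr (_ + _).
rewrite [RHS](split_split (fun P A R => split (fun B C =>
    comp (fun ys => comp (fun zs => g (f (map s (x :: P)) :: ys ++ u B :: zs))
      f C) f (map s A)) R)).
apply: eq_split => A R _.
rewrite -(split_swap (fun B C P A => comp (fun ys => comp (fun zs =>
   g (f (map s (x :: P)) :: ys ++ u B :: zs)) f C) f (map s A))).
by apply: eq_split => B C _; rewrite /= comp_cons split_map.
Qed.

(** As f is a morphism of coalgebras, the list to which a coderivation of the
    target applies b is itself the image of a sublist of xs: inserting
    b (f B_1, .., f B_q) after applying f is a coderivation along f. *)
Lemma comp_ins (t : M -> M) (b : seq M -> M) (g : seq M -> W) xs :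
  multiadditive g -> b [::] = 0 ->
  (forall B, f (map s B) = t (f B)) -> u =1 comp b f ->
  comp (ins t g b) f xs = insF g xs.
Proof.
move=> gD b0 fs uE; elim/suffix_ind: xs g gD => [|x xs IH] g gD.
  by rewrite comp_nil ins_nil // /insF !split_nil /= !comp_nil uE comp_nil b0 (madd0 gD [::]).
rewrite insF_cons.
rewrite (_ : split _ (x :: xs) =
    comp (split (fun Q S => g (b Q :: S))) f (x :: xs)); last first.
  rewrite comp_coproduct; apply: eq_split => P C _.
  rewrite uE; apply: (morph_comp (h := fun v => comp (fun S => g (v :: S)) f C)).
  by move=> v w; rewrite -compD; apply: eq_compl => ys; exact: (maddP gD [::]).
rewrite [X in comp X](_ : _ = fun ys =>
    split (fun Q S => g (b Q :: S)) ys + (if ys is y :: ys' then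
    ins t (fun zs => g (t y :: zs)) b ys' else 0)); last first.
  apply/funext => -[|y ys]; last exact: ins_cons.
  by rewrite ins_nil // split_nil b0 (madd0 gD [::]) addr0.
rewrite compD; congr (_ + _).
rewrite comp_cons; apply: eq_split => B R e; rewrite fs.
apply: (IH B R e); exact: madd_cons.
Qed.

(** An insertion in the source takes place inside of a single block of the image
    under f, to which f then applies as f(.., b B, ..). *)
Lemma ins_comp (b : seq V -> V) (g : seq M -> W) xs :
  multiadditive g -> multiadditive f -> f [::] = 0 -> b [::] = 0 ->
  u =1 ins s f b -> ins s (comp g f) b xs = insF g xs.
Proof.
move=> gD fD f0 b0 uE; elim/suffix_ind: xs g gD => [|x xs IH] g gD.
  rewrite /ins /insF !split_nil /= comp_cons split_nil comp_nil.
  by rewrite uE ins_nil // b0 (madd0 fD [::]).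
pose K A B C1 C2 := comp (fun ys => g (f (map s A ++ b B :: C1) :: ys)) f C2.
have -> : insF g (x :: xs) =
    split (fun A R => split (fun B C => split (K A B) C) R) (x :: xs)
    + split (fun P R =>
        ins s (comp (fun ys => g (f (map s (x :: P)) :: ys)) f) b R) xs.
  rewrite insF_cons; congr (_ + _); last first.
    apply: eq_split => P R e; rewrite (IH P R e) //; exact: madd_cons.
  under [RHS]eq_split => A R _ do rewrite split_split.
  rewrite split_split; apply: eq_split => P C _; rewrite uE.
  have hD : {morph (fun v => comp (fun ys => g (v :: ys)) f C) : v w / v + w}.
    by move=> v w; rewrite -compD; apply: eq_compl => ys; exact: (maddP gD [::]).
  rewrite (morph_split _ _ hD); apply: eq_split => A R _.
  exact: (morph_split _ _ hD).
rewrite ins_cons [in RHS]split_cons -addrA; congr (_ + _).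
  by apply: eq_split => B C _; rewrite /= comp_cons.
rewrite [X in _ = _ + X](split_split (fun P A R => split (fun B C =>
  comp (fun ys => g (f (map s (x :: P)) :: ys)) f (map s A ++ b B :: C)) R)).
rewrite -splitD; apply: eq_split => A R _.
rewrite -(split_swap (fun B C P A =>
  comp (fun ys => g (f (map s (x :: P)) :: ys)) f (map s A ++ b B :: C))).
rewrite -splitD; apply: eq_split => B C _.
by rewrite comp_cons split_cat split_map addrC.
Qed.
End Morphism.

Lemma insFB (V M W : zmodType) (s : V -> V) (f u u' : seq V -> M)
    (g : seq M -> W) xs : multiadditive g ->
  insF s f (fun B => u B - u' B) g xs = insF s f u g xs - insF s f u' g xs.
Proof.
move=> gD; apply/eqP; rewrite eq_sym subr_eq; apply/eqP.
rewrite /insF -splitD; apply: eq_split => A R _.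
rewrite -splitD; apply: eq_split => B C _.
rewrite -compD; apply: eq_compl => ys; rewrite -compD; apply: eq_compl => zs.
by rewrite -(maddP gD ys) subrK.
Qed.

(** Two insertions at disjoint places occur in both orders with opposite signs,
    since b anticommutes with s; the nested ones remain. *)
Lemma ins_square (V W : zmodType) (s : V -> V) (b : seq V -> V) (g : seq V -> W) xs :
  multiadditive g -> multiadditive b -> b [::] = 0 -> {morph s : x y / x + y} ->
  involutive s -> (forall B, b (map s B) = - s (b B)) ->
  ins s (ins s g b) b xs = ins id g (ins s b b) xs.
Proof.
move=> gD bD b0 sD ss bs; elim: xs g gD => [|x xs IH] g gD.
  rewrite !ins_nil //; apply: ins_placewise => // [|z u v ->].
    by split=> [|z u v z' u' v' -> ->]; rewrite ?addr0 // addrACA.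
  exact: sD.
rewrite !ins_cons -(IH (fun ys => g (x :: ys))); last exact: madd_cons.
rewrite [X in ins s X b xs](_ : _ = fun ys =>
  split (fun Q S => g (b Q :: S)) (s x :: ys) + ins s (fun zs => g (x :: zs)) b ys);
  last by apply/funext => ys; rewrite ins_cons ss.
have insD h h' ys : ins s (fun zs => h zs + h' zs) b ys = ins s h b ys + ins s h' b ys :> W.
  rewrite /ins -splitD; apply: eq_split => A R _; exact: splitD.
rewrite insD addrA; congr (_ + _).
have v0 r : g (b [::] :: r) = 0 by rewrite b0 (madd0 gD [::]).
pose K A B C1 C2 := g (b (map s A ++ b B :: C1) :: C2).
have -> : split (fun P C => g (ins s b b P :: C)) (x :: xs)
    = split (fun A R => split (fun B C => split (K A B) C) R) (x :: xs).
  under [RHS]eq_split => A R _ do rewrite split_split.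
  rewrite split_split; apply: eq_split => P C _.
  rewrite (morph_split _ _ (maddP gD [::] C)); apply: eq_split => A R _.
  exact: (morph_split _ _ (maddP gD [::] C)).
rewrite [RHS]split_cons.
(* the second insertion takes place inside of the first block, or after it *)
have -> : split (fun B C => ins s g b (b B :: C)) (x :: xs)
    = split (fun B C => split (K [::] B) C) (x :: xs)
      + split (fun Q R => ins s (fun ys => g (s (b (x :: Q)) :: ys)) b R) xs.
  rewrite [X in _ + X](_ : _ =
      split (fun Q R => ins s (fun ys => g (s (b Q) :: ys)) b R) (x :: xs)).
    rewrite -splitD; apply: eq_split => B C _; rewrite ins_cons; congr (_ + _).
    by rewrite split_cons v0 add0r.
  rewrite split_cons b0 [X in _ = X + _](_ : _ = 0) ?add0r //.
  apply: split0 => A R _; apply: split0 => B C _.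
  by rewrite (add_morph0 sD) (madd0 gD [::]).
rewrite -addrA; congr (_ + _).
rewrite [X in _ + X](_ : _ = split (fun A R => split (fun B C => split (K (x :: A) B) C) R) xs
   + split (fun Q R => ins s (fun ys => g (b (map s (x :: Q)) :: ys)) b R) xs).
  rewrite addrC -addrA -splitD [X in _ + X](_ : _ = 0) ?addr0 //.
  apply: split0 => Q R _; rewrite /ins -splitD; apply: split0 => A R' _.
  by rewrite -splitD; apply: split0 => B C _; rewrite bs (maddN gD [::]) addNr.
rewrite [X in _ = _ + X](split_split (fun Q A R => split (fun B C =>
  g (b (map s (x :: Q)) :: map s A ++ b B :: C)) R)).
rewrite -splitD; apply: eq_split => A R _.
rewrite -(split_swap (fun B C Q S => g (b (map s (x :: Q)) :: map s S ++ b B :: C))).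
rewrite -splitD; apply: eq_split => B C _.
rewrite split_cons v0 add0r split_cat split_map addrC; congr (_ + _).
Qed.

(** * Homotopy transfer *)

Lemma split_first (V : Type) (W : zmodType) (K : seq V -> seq V -> W) xs :
  (forall x P R, K (x :: P) R = 0) -> split K xs = K [::] xs.
Proof.
case: xs => [|x xs] K0; first by rewrite split_nil.
by rewrite split_cons split0 ?addr0.
Qed.

Lemma split_last (V : Type) (W : zmodType) (K : seq V -> seq V -> W) xs :
  (forall P x R, K P (x :: R) = 0) -> split K xs = K xs [::].
Proof.
elim: xs K => [|x xs IH] K K0; first by rewrite split_nil.
by rewrite split_cons K0 add0r IH.
Qed.

Section OnePlus.
Variables (V W : zmodType) (d : V -> W) (b : seq V -> W).
Definition single (xs : seq V) : W := if xs is [:: x] then d x else 0.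
Definition plural (xs : seq V) : W := if (1 < size xs)%N then b xs else 0.

Lemma single_plural xs : b [::] = 0 -> (forall x, b [:: x] = d x) ->
  b xs = single xs + plural xs.
Proof.
move=> b0 bd; case: xs => [|x [|y xs]]; rewrite /single /plural /=.
- by rewrite b0 addr0.
- by rewrite bd addr0.
- by rewrite add0r.
Qed.

Lemma single_placewise (S : V -> V -> V -> Prop) (T : W -> W -> W -> Prop) :
  T 0 0 0 -> (forall z x y, S z x y -> T (d z) (d x) (d y)) -> placewise S T single.
Proof. by move=> T0 dP [|v [|v' l]] [|w r] z x y zxy //=; apply: dP. Qed.

Lemma plural_placewise (S : V -> V -> V -> Prop) (T : W -> W -> W -> Prop) :
  T 0 0 0 -> placewise S T b -> placewise S T plural.
Proof.
move=> T0 bP l r z x y zxy; rewrite /plural !size_cat /=.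
by case: ifP => _ //; exact: bP.
Qed.
End OnePlus.

Lemma sumrel_add (W : zmodType) : sumrel (fun z x y : W => z = x + y).
Proof. by split=> [|z x y z' x' y' -> ->]; rewrite ?addr0 // addrACA. Qed.

Lemma comp_plural1 (V M W : zmodType) (b : seq M -> W) (f : seq V -> M) x :
  comp (plural b) f [:: x] = 0.
Proof. by rewrite comp_cons split_nil comp_nil. Qed.

Lemma eq_comp_plural (V M W : zmodType) (b : seq M -> W) (f f' : seq V -> M) xs :
  (forall B, (size B < size xs)%N -> f B = f' B) ->
  comp (plural b) f xs = comp (plural b) f' xs.
Proof.
case: xs => [|x xs] // e; rewrite !comp_cons; apply: eq_split => P [|y R] eR.
  by rewrite !comp_nil.
rewrite e; last by rewrite -eR /= size_cat /=; lia.
apply: eq_compr => B hB; apply: e; move: hB; rewrite -eR /= size_cat /=; lia.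
Qed.

Lemma comp_single (V M W : zmodType) (d : M -> W) (f : seq V -> M) xs :
  d 0 = 0 -> f [::] = 0 -> comp (single d) f xs = d (f xs).
Proof.
move=> d0 f0; case: xs => [|x xs]; first by rewrite comp_nil f0 d0.
rewrite comp_cons split_last // => P y R.
rewrite comp_cons; apply: split0 => Q S _; exact: comp0.
Qed.

Lemma insF_plural (V M W : zmodType) (s : V -> V) (b : seq M -> W)
    (f u : seq V -> M) xs : multiadditive b ->
  (forall B, (size B < size xs)%N -> u B = 0) -> insF s f u (plural b) xs = 0.
Proof.
move=> bD u0; apply: split0 => A R eA; apply: split0 => B C eB.
have [Bxs|] := ltnP (size B) (size xs).
  apply: comp0 => ys; apply: comp0 => zs; rewrite u0 //.
  by apply: madd0; apply: plural_placewise => //; rewrite addr0.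
rewrite -eA -eB !size_cat => h.
have -> : A = [::] by apply/nilP; rewrite /nilp; lia.
by have -> : C = [::] by apply/nilP; rewrite /nilp; lia.
Qed.

Lemma ins_plural (V W : zmodType) (s : V -> V) (f : seq V -> W)
    (u : seq V -> V) xs : multiadditive f ->
  (forall B, (size B < size xs)%N -> u B = 0) -> ins s (plural f) u xs = 0.
Proof.
move=> fD u0; apply: split0 => A R eA; apply: split0 => B C eB.
have [Bxs|] := ltnP (size B) (size xs).
  by rewrite u0 //; apply: madd0; apply: plural_placewise => //; rewrite addr0.
rewrite -eA -eB !size_cat => h.
have -> : A = [::] by apply/nilP; rewrite /nilp; lia.
by have -> : C = [::] by apply/nilP; rewrite /nilp; lia.
Qed.

Section Transfer.
Variables (N M : zmodType) (sN : N -> N) (sM : M -> M) (b : seq M -> M).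
Variables (i : N -> M) (dN : N -> N) (p : M -> N) (G : M -> M).

(** The fixed point equations f = i + G b_+ f and b' = dN + p b_+ f, where b_+ is
    b without its linear part and products with f are composites of coalgebra
    maps.  Expanding f gives the sums over trees of homotopy transfer.  The
    equation for f is recursive in the length of the list, of which n is a
    bound: only proper sublists matter to b_+ f. *)
Fixpoint transfer_morn (n : nat) (xs : seq N) : M :=
  if n is n'.+1 then single i xs + G (comp (plural b) (transfer_morn n') xs)
  else 0.
Definition transfer_mor xs := transfer_morn (size xs) xs.
Definition transfer_alg xs := single dN xs + p (comp (plural b) transfer_mor xs).

Local Notation f := transfer_mor.
Local Notation b' := transfer_alg.

Section Closure.
Variables (SN : N -> N -> N -> Prop) (SM : M -> M -> M -> Prop).
Hypotheses (SN0 : sumrel SN) (SM0 : sumrel SM).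
Hypothesis bP : placewise SM SM b.
Hypothesis iP : forall z x y, SN z x y -> SM (i z) (i x) (i y).
Hypothesis dP : forall z x y, SN z x y -> SN (dN z) (dN x) (dN y).
Hypothesis pP : forall z x y, SM z x y -> SN (p z) (p x) (p y).
Hypothesis GP : forall z x y, SM z x y -> SM (G z) (G x) (G y).

Lemma transfer_morn_placewise n : placewise SN SM (transfer_morn n).
Proof.
elim: n => [|n IH] l r z x y zxy /=; first exact: sumrel0.
apply: sumrelD => //.
  by apply: single_placewise zxy => //; exact: sumrel0.
apply: GP; apply: (comp_placewise (SM := SM)) zxy => //.
by apply: plural_placewise => //; exact: sumrel0.
Qed.

Lemma transfer_mor_placewise : placewise SN SM f.
Proof.
move=> l r z x y zxy; rewrite /f !size_cat /=.
exact: transfer_morn_placewise.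
Qed.

Lemma transfer_alg_placewise : placewise SN SN b'.
Proof.
move=> l r z x y zxy; apply: sumrelD => //.
  by apply: single_placewise zxy => //; exact: sumrel0.
apply: pP; apply: (comp_placewise (SM := SM)) zxy => //; first exact: transfer_mor_placewise.
by apply: plural_placewise => //; exact: sumrel0.
Qed.
End Closure.

Hypotheses (iD : {morph i : x y / x + y}) (dD : {morph dN : x y / x + y}).
Hypotheses (pD : {morph p : x y / x + y}) (GD : {morph G : x y / x + y}).
Hypotheses (sND : {morph sN : x y / x + y}) (sMD : {morph sM : x y / x + y}).
Hypotheses (bD : multiadditive b) (b0 : b [::] = 0).
Hypotheses (sNK : involutive sN) (sMK : involutive sM).
Hypothesis bs : forall ys, b (map sM ys) = - sM (b ys).
Hypothesis i_sign : forall x, i (sN x) = sM (i x).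
Hypothesis ps : forall x, p (sM x) = sN (p x).
Hypothesis Gs : forall x, G (sM x) = - sM (G x).
Hypothesis ds : forall x, dN (sN x) = - sN (dN x).

Lemma transfer_morn_stable n m xs : (size xs <= n)%N -> (size xs <= m)%N ->
  transfer_morn n xs = transfer_morn m xs.
Proof.
have nil0 j : transfer_morn j [::] = 0.
  by case: j => [|j] //=; rewrite comp_nil /plural /= (add_morph0 GD) addr0.
elim: n m xs => [|n IH] [|m] xs hn hm //.
- by have -> : xs = [::] by apply/nilP; rewrite /nilp -leqn0.
- by have -> : xs = [::] by apply/nilP; rewrite /nilp -leqn0.
- rewrite /=; congr (_ + G _); apply: eq_comp_plural => B hB.
  by apply: IH; lia.
Qed.

Lemma transfer_morE xs : f xs = single i xs + G (comp (plural b) f xs).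
Proof.
rewrite {1}/f (@transfer_morn_stable _ (size xs).+1) //=; congr (_ + G _).
apply: eq_comp_plural => B hB; apply: transfer_morn_stable => //; lia.
Qed.

Lemma transfer_mor0 : f [::] = 0. Proof. by []. Qed.
Lemma transfer_mor1 x : f [:: x] = i x.
Proof. by rewrite transfer_morE comp_plural1 (add_morph0 GD) addr0. Qed.
Lemma transfer_alg0 : b' [::] = 0.
Proof. by rewrite /b' comp_nil /plural /= (add_morph0 pD) addr0. Qed.
Lemma transfer_alg1 x : b' [:: x] = dN x.
Proof. by rewrite /b' comp_plural1 (add_morph0 pD) addr0. Qed.

Lemma transfer_mor_add : multiadditive f.
Proof.
have sM' := sumrel_add M.
apply: (transfer_mor_placewise (SN := fun z x y => z = x + y) sM') => // z x y -> //.
Qed.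
Lemma transfer_alg_add : multiadditive b'.
Proof.
have sN' := sumrel_add N; have sM' := sumrel_add M.
apply: (transfer_alg_placewise sN' sM') => // z x y -> //.
Qed.

Lemma comp_plural_sign (h : seq N -> M) xs :
  (forall B, h (map sN B) = sM (h B)) ->
  comp (plural b) h (map sN xs) = - sM (comp (plural b) h xs).
Proof.
move=> hs; rewrite comp_map (funext hs) comp_mapr.
have nD : {morph (fun x => - sM x) : x y / x + y} by move=> x y; rewrite sMD opprD.
rewrite (morph_comp _ _ _ nD); apply: eq_compl => ys.
by rewrite /plural size_map bs; case: ifP => // _; rewrite (add_morph0 sMD) oppr0.
Qed.

Lemma transfer_mor_sign xs : f (map sN xs) = sM (f xs).
Proof.
rewrite /f size_map; move: (size xs) => n; elim: n xs => [|n IH] ys /=.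
  by rewrite (add_morph0 sMD).
rewrite sMD comp_plural_sign // add_morphN // Gs opprK; congr (_ + _).
by case: ys => [|x [|y ys]] /=; rewrite ?(add_morph0 sMD) ?i_sign.
Qed.

Lemma transfer_alg_sign xs : b' (map sN xs) = - sN (b' xs).
Proof.
rewrite /b' sND opprD comp_plural_sign; last exact: transfer_mor_sign.
rewrite add_morphN // ps; congr (_ + _).
by case: xs => [|x [|y xs]] /=; rewrite ?(add_morph0 sND) ?oppr0 ?ds.
Qed.

Hypothesis bb : forall ys, ins sM b b ys = 0.
Hypothesis di : forall x, b [:: i x] = i (dN x).
Hypothesis hG : forall x, i (p x) - x = b [:: G x] + G (b [:: x]).

Let d x := b [:: x].
Let dDD : {morph d : x y / x + y}. Proof. exact: (maddP bD [::] [::]). Qed.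
Let d0 : d 0 = 0. Proof. exact: (add_morph0 dDD). Qed.
Let bplD : multiadditive (plural b).
Proof. by apply: plural_placewise => //; rewrite addr0. Qed.
Let bE ys : b ys = single d ys + plural b ys. Proof. exact: single_plural. Qed.

Let compE (h : seq N -> M) xs : h [::] = 0 ->
  comp b h xs = d (h xs) + comp (plural b) h xs.
Proof.
by move=> h0; rewrite -(comp_single xs d0 h0) -compD; apply: eq_compl => ys; exact: bE.
Qed.

Lemma ins_single (V W : zmodType) (s : V -> V) (h : V -> W) (c : seq V -> V) xs :
  ins s (single h) c xs = h (c xs).
Proof.
rewrite /ins split_first => [|x P R]; last first.
  by apply: split0 => B C _; case: P.
by rewrite split_last.
Qed.

Lemma insD (V W : zmodType) (s : V -> V) (h h' : seq V -> W) (c : seq V -> V) xs :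
  ins s (fun ys => h ys + h' ys) c xs = ins s h c xs + ins s h' c xs.
Proof. by rewrite /ins -splitD; apply: eq_split => A R _; exact: splitD. Qed.

Lemma morph_ins (V W W' : zmodType) (s : V -> V) (h : W -> W') (g : seq V -> W)
    (c : seq V -> V) xs : {morph h : x y / x + y} ->
  h (ins s g c xs) = ins s (fun ys => h (g ys)) c xs.
Proof.
by move=> hD; rewrite /ins morph_split //; apply: eq_split => A R _; exact: morph_split.
Qed.

Let dd x : d (d x) = 0.
Proof.
have := bb [:: x]; rewrite /ins split_cons !split_nil split_cons split_nil /=.
rewrite b0 (madd0 bD [::]) (madd0 bD [:: sM x]) add0r addr0 => <-.
by rewrite /d.
Qed.

(** The defect u of this identity satisfies u = G (b_+ with one entry from u and
    the others from f), by the equation of f, b b = 0 and the homotopy relation.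
    In this expression u is only applied to proper sublists, since b_+ takes at
    least two arguments, and u vanishes by induction on the length. *)
Lemma transfer_morP xs : comp b f xs = ins sN f b' xs.
Proof.
pose u ys := comp b f ys - ins sN f b' ys.
suff: u xs = 0 by move=> /eqP; rewrite subr_eq0 => /eqP.
have uE ys : u ys = G (insF sN f u (plural b) ys).
  pose h := comp (plural b) f.
  have E1 : d (h ys) + insF sN f (comp b f) (plural b) ys = 0.
    rewrite -(comp_ins (t := sM) (b := b)) //; last exact: transfer_mor_sign.
    transitivity (comp (ins sM b b) f ys); last by apply: comp0.
    rewrite (_ : h ys = comp b f ys - d (f ys)); last first.
      by rewrite compE ?transfer_mor0 // addrAC subrr add0r.
    rewrite dDD (add_morphN _ dDD) dd oppr0 addr0.
    rewrite (morph_comp _ _ _ dDD) -compD; apply: eq_compl => zs.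
    by rewrite -(ins_single sM d b) -insD; congr (ins _ _ _ _); apply/funext => ?;
       rewrite -bE.
  have E2 : ins sN f b' ys = i (b' ys) + G (ins sN h b' ys).
    rewrite (morph_ins _ _ _ _ GD) -(ins_single sN i) -insD.
    by congr (ins _ _ _ _); apply/funext => zs; exact: transfer_morE.
  have E3 : ins sN h b' ys = insF sN f (ins sN f b') (plural b) ys.
    by apply: ins_comp => //; [exact: transfer_mor_add|exact: transfer_alg0].
  have E4 : i (b' ys) = d (single i ys) + i (p (h ys)).
    rewrite /b' iD; congr (_ + _); case: ys {E1 E2 E3} => [|y [|z ys]] /=;
      by rewrite ?(add_morph0 iD) ?d0 // -di.
  rewrite insFB //.
  have -> : insF sN f (comp b f) (plural b) ys = - d (h ys).
    by apply/eqP; rewrite -subr_eq0 opprK addrC E1.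
  rewrite -E3 /u compE ?transfer_mor0 // E2 E4 -/(h ys) {1}transfer_morE -/(h ys) dDD.
  have -> : G (- d (h ys) - ins sN h b' ys) = - G (d (h ys)) - G (ins sN h b' ys).
    by rewrite GD !(add_morphN _ GD).
  have -> : G (d (h ys)) = i (p (h ys)) - h ys - d (G (h ys)).
    by rewrite hG -![b [:: _]]/(d _); zmodule.
  zmodule.
have [n] := ubnP (size xs); elim: n xs => // n IH xs hn.
rewrite uE insF_plural ?(add_morph0 GD) // => B hB; apply: IH.
exact: leq_trans hB hn.
Qed.

Hypothesis i_inj : injective i.

(** Since b f = f b', the square of b' is sent by f to the square of b, which is
    zero.  If it vanishes on shorter lists then only the linear part i of f
    contributes, and i is injective. *)
Lemma transfer_algP xs : ins sN b' b' xs = 0.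
Proof.
have [n] := ubnP (size xs); elim: n xs => // n IH xs hn; apply: i_inj.
rewrite (add_morph0 iD) -(transfer_mor1 (ins sN b' b' xs)).
have e0 : ins id f (ins sN b' b') xs = 0.
  rewrite -(ins_square _ transfer_mor_add transfer_alg_add) //; first last.
  - exact: transfer_alg_sign.
  - exact: transfer_alg0.
  rewrite (_ : ins sN f b' = comp b f); last by apply/funext => ys; rewrite transfer_morP.
  rewrite (ins_comp (u := ins sN f b')) //; first last.
  - exact: transfer_alg0.
  - exact: transfer_mor_add.
  rewrite -(comp_ins (t := sM) (b := b)) //; first exact: comp0.
  - exact: transfer_mor_sign.
  - by move=> ys; rewrite transfer_morP.
rewrite -[RHS]e0 transfer_mor1 (_ : f = fun ys => single i ys + plural f ys); last first.
  by apply/funext => ys; apply: single_plural => // x; exact: transfer_mor1.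
rewrite insD ins_single [X in _ = _ + X](_ : _ = 0) ?addr0 //.
apply: ins_plural; first exact: transfer_mor_add.
by move=> B hB; apply: IH; exact: leq_trans hB hn.
Qed.
End Transfer.

(** * Parity operators *)

Section KSign.
Variable k : fieldType.
Local Notation ksign := (ksign k).

Lemma ksign_nat n : ksign n%:Z = (-1) ^+ n. Proof. by []. Qed.
Lemma ksignE z : ksign z = (-1) ^ z.
Proof.
case: z => n; first by [].
by rewrite NegzE -exprz_inv invrN1 /ksign abszN absz_nat.
Qed.
Lemma ksignD a b : ksign (a + b) = ksign a * ksign b.
Proof. by rewrite !ksignE expfzDr // oppr_eq0 oner_eq0. Qed.
Lemma ksign_double c : ksign (c * 2) = 1.
Proof. by rewrite ksignE mulrC -exprz_exp -exprnP sqrrN expr1n exp1rz. Qed.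
Lemma ksign_eq a b c : a = b + c * 2 -> ksign a = ksign b.
Proof. by move=> ->; rewrite ksignD ksign_double mulr1. Qed.
Lemma ksign0 : ksign 0 = 1. Proof. by []. Qed.
Lemma ksign1 : ksign 1 = -1. Proof. by []. Qed.
Lemma ksign_scale_comp (V : lmodType k) a b (x : V) :
  ksign a *: (ksign b *: x) = ksign (a + b) *: x.
Proof. by rewrite scalerA ksignD. Qed.
Lemma ksign_scaleN (V : lmodType k) (x : V) : - x = ksign 1 *: x.
Proof. by rewrite ksign1 scaleN1r. Qed.
End KSign.

Section Weights.
Variables (k : fieldType) (I : zmodType) (V : gmod k I) (chi : I -> k).

(** The graph of the operator below, as elements have no canonical decomposition
    into homogeneous components. *)
Definition weight_rel (v w : V) : Prop := exists s (f : I -> V),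
  [/\ uniq s, forall i, f i \in gpart i, v = \sum_(i <- s) f i
    & w = \sum_(i <- s) chi i *: f i].

Lemma weight_widen (s t : seq I) (f : I -> V) (c : I -> k) :
  uniq s -> uniq t -> {subset s <= t} ->
  \sum_(i <- s) c i *: f i = \sum_(i <- t) c i *: (if i \in s then f i else 0).
Proof.
move=> us ut st; rewrite (sub_widen (@gpart _ _ V 0) _ us ut st).
by apply: eq_bigr => i _; case: ifP => _; rewrite ?scaler0.
Qed.

Lemma weight_functional : functional_rel weight_rel.
Proof.
split.
- move=> v; have [s [f [us fV e]]] := homsum_uniq (gmod_sum v).
  by exists (\sum_(i <- s) chi i *: f i), s, f.
- move=> w [s [f [us fV e ->]]]; rewrite big_seq big1 // => i iS.
  by rewrite (gmod_indep us fV (esym e) iS) scaler0.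
move=> a v v' w w' [s [f [us fV -> ->]]] [t [g [ut gV -> ->]]].
have uu : uniq (undup (s ++ t)) by exact: undup_uniq.
have ss : {subset s <= undup (s ++ t)} by move=> i; rewrite mem_undup mem_cat => ->.
have ts : {subset t <= undup (s ++ t)}.
  by move=> i; rewrite mem_undup mem_cat => ->; rewrite orbT.
exists (undup (s ++ t)), (fun i => a *: (if i \in s then f i else 0)
                            + (if i \in t then g i else 0)); split=> //.
- by move=> i; rewrite smD ?smZ //; case: ifP => _; rewrite ?sm0.
- rewrite (sub_widen (@gpart _ _ V 0) f us uu ss) (sub_widen (@gpart _ _ V 0) g ut uu ts).
  by rewrite scaler_sumr -big_split.
- rewrite (weight_widen f chi us uu ss) (weight_widen g chi ut uu ts).
  rewrite scaler_sumr -big_split; apply: eq_bigr => i _ /=.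
  by rewrite scalerDr !scalerA mulrC.
Qed.

Definition weight : {linear V -> V} := lrel weight_functional.

Lemma weightE i x : x \in gpart i -> weight x = chi i *: x.
Proof.
move=> xi; apply: lrelE.
exists [:: i], (fun j => if j == i then x else 0).
rewrite !big_seq1 eqxx; split=> // j.
by case: eqP => [->|_]; rewrite ?sm0.
Qed.
End Weights.

Lemma hom_ext (k : fieldType) (I : zmodType) (V : gmod k I) (W : zmodType)
    (f g : V -> W) : {morph f : x y / x + y} -> {morph g : x y / x + y} ->
  (forall i x, x \in @gpart _ _ V i -> f x = g x) -> f =1 g.
Proof.
move=> fD gD h x; have [s sV ->] := gmod_sum x.
rewrite (big_morph f fD (add_morph0 fD)) (big_morph g gD (add_morph0 gD)).
by rewrite big_seq [RHS]big_seq; apply: eq_bigr => p /(allP sV)/h.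
Qed.

Lemma lin_add (k : fieldType) (V W : lmodType k) (f : V -> W) :
  linear f -> {morph f : x y / x + y}.
Proof. by move=> fL x y; have := fL 1 x y; rewrite !scale1r. Qed.

Lemma lin_scale (k : fieldType) (V W : lmodType k) (f : V -> W) :
  linear f -> forall a, {morph f : x / a *: x}.
Proof.
by move=> fL a x; have := fL a x 0; rewrite addr0 (add_morph0 (lin_add fL)) addr0.
Qed.

Section Tau.
Variable k : fieldType.
Implicit Types V W : bgmod k.

Fact tau_key : unit. Proof. exact: tt. Qed.
(** Locked, to prevent its unfolding when powers of it are compared. *)
Definition tau V : {linear V -> V} :=
  locked_with tau_key (weight V (fun i => ksign k (tot i))).

Lemma tauE V i (x : V) : x \in gpart i -> tau V x = ksign k (tot i) *: x.
Proof. by rewrite /tau locked_withE; exact: weightE. Qed.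

Lemma tau_hom V i (x : V) : x \in gpart i -> tau V x \in gpart i.
Proof. by move=> xi; rewrite (tauE xi) smZ. Qed.

Lemma iter_tauE V n i (x : V) : x \in gpart i ->
  iter n (tau V) x = ksign k (n%:Z * tot i) *: x.
Proof.
move=> xi; elim: n => [|n IH]; first by rewrite mul0r scale1r.
by rewrite /= IH linearZ /= (tauE xi) ksign_scale_comp; congr (ksign _ _ *: _); lia.
Qed.

Lemma tauK V : involutive (tau V).
Proof.
apply: hom_ext => [x y|x y|i x xi]; rewrite ?linearD //.
by rewrite -[tau V (tau V x)]/(iter 2 (tau V) x) (iter_tauE _ xi) mulrC ksign_double scale1r.
Qed.

Lemma totD (i j : Z2) : tot (i + j) = tot i + tot j.
Proof. by rewrite /tot /=; lia. Qed.

Lemma tau_comm V W c (f : V -> W) x : linear f -> bihomog c f ->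
  f (tau V x) = ksign k (tot c) *: tau W (f x).
Proof.
move=> fL fh; have fD := lin_add fL.
move: x; apply: hom_ext => [x y|x y|i x xi].
- by rewrite linearD fD.
- by rewrite fD linearD scalerDr.
rewrite (tauE xi) (tauE (fh _ _ xi)) (lin_scale fL) ksign_scale_comp totD.
by congr (_ *: _); apply: (@ksign_eq _ _ _ (- tot c)); ring.
Qed.

Definition stau V (x : V) : V := - tau V x.
Lemma stauD V : {morph @stau V : x y / x + y}.
Proof. by move=> x y; rewrite /stau linearD opprD. Qed.
Lemma stauK V : involutive (@stau V).
Proof. by move=> x; rewrite /stau linearN opprK tauK. Qed.
End Tau.
Arguments tau {k V}.
Arguments stau {k V}.

(** * Removing the Koszul signs *)

Section Homog.
Variables (k : fieldType) (I : zmodType).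
Lemma homog_size (V : lmodType k) (V_ : I -> submodClosed V) ds xs :
  homog V_ ds xs -> size ds = size xs.
Proof. by rewrite /homog all2E => /andP[/eqP]. Qed.

Lemma homog_cat (V : lmodType k) (V_ : I -> submodClosed V) ds es xs ys :
  homog V_ ds xs -> homog V_ es ys -> homog V_ (ds ++ es) (xs ++ ys).
Proof.
by elim: ds xs => [|d ds IH] [|x xs] //= /andP[h1 h2] /(IH _ h2); rewrite /homog /= h1.
Qed.

Lemma homog_catP (V : lmodType k) (V_ : I -> submodClosed V) ds xs ys :
  homog V_ ds (xs ++ ys) ->
  homog V_ (take (size xs) ds) xs /\ homog V_ (drop (size xs) ds) ys.
Proof.
elim: xs ds => [|x xs IH] ds; first by rewrite take0 drop0.
case: ds => [|d ds] //; rewrite /homog /= => /andP[-> /IH[]].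
by split.
Qed.

Lemma homog_ext (V : gmod k I) (W : zmodType) (f : seq V -> W) :
  multiadditive f ->
  (forall ds xs, homog (@gpart _ _ V) ds xs -> f xs = 0) -> forall xs, f xs = 0.
Proof.
move=> fD f0 xs.
suff: forall ds l, homog (@gpart _ _ V) ds l -> f (l ++ xs) = 0.
  by move=> /(_ [::] [::]); apply.
elim: xs => [|x xs IH] ds l hl; first by rewrite cats0 (f0 ds).
move: x; apply: hom_ext => [x y|x y|i x xi]; rewrite ?addr0 //.
  exact: (maddP fD).
rewrite -cat_rcons; apply: (IH (rcons ds i)).
by rewrite -!cats1; apply: homog_cat; rewrite // /homog /= xi.
Qed.

Lemma multilinear_add (V W : lmodType k) (f : seq V -> W) :
  multilinear f -> multiadditive f.
Proof.
by move=> fL l r z x y ->; have := fL l r 1 x y; rewrite !scale1r.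
Qed.

Lemma multilinearZ (V W : lmodType k) (f : seq V -> W) l r a x :
  multilinear f -> f (l ++ a *: x :: r) = a *: f (l ++ x :: r).
Proof.
move=> fL; have := fL l r a x 0.
by rewrite addr0 (madd0 (multilinear_add fL)) addr0.
Qed.

Lemma multilinear_placewise (V W : lmodType k) (f : seq V -> W) :
  multilinear f <-> forall a,
    placewise (fun z x y => z = a *: x + y) (fun z x y => z = a *: x + y) f.
Proof.
split=> [fL a l r z x y ->|fL l r a x y]; [exact: fL|exact: fL].
Qed.

Lemma sumrel_lin (W : lmodType k) a : sumrel (fun z x y : W => z = a *: x + y).
Proof.
by split=> [|z x y z' x' y' -> ->]; rewrite ?scaler0 ?addr0 // scalerDr addrACA.
Qed.

Lemma comp_homog (N M W : lmodType k) (N_ : I -> submodClosed N)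
    (M_ : I -> submodClosed M) (W_ : I -> submodClosed W) (c e : I)
    (f : seq N -> M) (g : seq M -> W) ds xs :
  (forall ds xs, homog N_ ds xs -> f xs \in M_ (\sum_(d <- ds) d + c - c *+ size xs)) ->
  (forall ds xs, homog M_ ds xs -> g xs \in W_ (\sum_(d <- ds) d + e - c *+ size xs)) ->
  homog N_ ds xs -> comp g f xs \in W_ (\sum_(d <- ds) d + e - c *+ size xs).
Proof.
move=> fh; elim/suffix_ind: xs ds g e => [|x xs IH] ds g e gh hx.
  by case: ds hx => // _; exact: (gh [::] [::]).
rewrite comp_cons; apply: rpred_sum => i _; move: hx.
rewrite -{1}(cat_take_drop i xs) -cat_cons; set B := x :: _; set R := drop _ _.
move=> /homog_catP[]; set dB := take _ _; set dR := drop _ _ => hB hR.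
have -> : \sum_(d <- ds) d + e - c *+ size (x :: xs)
    = \sum_(d <- dR) d + (\sum_(d <- dB) d + e - c *+ size B) - c *+ size R.
  have -> : \sum_(d <- ds) d = \sum_(d <- dB) d + \sum_(d <- dR) d.
    by rewrite -big_cat cat_take_drop.
  rewrite (_ : size (x :: xs) = size B + size R)%N; last first.
    by rewrite -size_cat /B cat_cons cat_take_drop.
  have -> : c *+ (size B + size R) = c *+ size B + c *+ size R by exact: mulrnDr.
  zmodule.
apply: (IH (take i xs)) => //; first by rewrite cat_take_drop.
move=> es ys hy.
have h2 : homog M_ ((\sum_(d <- dB) d + c - c *+ size B) :: es) (f B :: ys).
  by rewrite /homog /= fh.
have := gh _ _ h2; congr (_ \in W_ _).
have -> : c *+ size (f B :: ys) = c + c *+ size ys by exact: mulrS.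
by rewrite big_cons /=; zmodule.
Qed.
End Homog.

Section Twist.
Variable k : fieldType.
Implicit Types V W : bgmod k.

(** The list [tau^(n-1) x_1; ..; tau^0 x_n] carries the Koszul signs
    (-1)^((n-i) deg x_i) of the n-th tensor power of a map of degree one, here
    the suspension, applied to the x_i.  Precomposition with tw turns the
    operations m_n into the components of a coderivation of the tensor
    coalgebra, and absorbs the signs of the Stasheff identities and of the
    equations of a morphism. *)
Fixpoint tw V (xs : seq V) : seq V :=
  if xs is x :: xs' then iter (size xs') tau x :: tw xs' else [::].

Lemma size_tw V (xs : seq V) : size (tw xs) = size xs.
Proof. by elim: xs => //= x xs ->. Qed.

Lemma tw_cat V (A L : seq V) :
  tw (A ++ L) = map (iter (size L) tau) (tw A) ++ tw L.
Proof.
elim: A => //= x A ->; congr (_ :: _).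
by rewrite size_cat addnC iterD.
Qed.

Lemma tw_map V W (h : V -> W) (A : seq V) : (forall x, h (tau x) = tau (h x)) ->
  tw (map h A) = map h (tw A).
Proof.
move=> hc; elim: A => //= x A ->; rewrite size_map; congr (_ :: _).
by elim: (size A) => //= n ->; rewrite hc.
Qed.

Lemma iter_tauK V n : involutive (iter n (@tau k V)).
Proof.
move=> x; elim: n x => // n IH x.
by rewrite [iter n.+1 tau x]iterS iterSr tauK IH.
Qed.

Lemma twK V : involutive (@tw V).
Proof.
elim=> //= x xs IH; rewrite size_tw IH; congr (_ :: _); exact: iter_tauK.
Qed.

Lemma iter_tau_hom V n i (x : V) : x \in gpart i -> iter n tau x \in gpart i.
Proof. by move=> xi; elim: n => //= n; exact: tau_hom. Qed.

Lemma tw_homog V ds (xs : seq V) : homog (@gpart _ _ V) ds xs ->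
  homog (@gpart _ _ V) ds (tw xs).
Proof.
elim: xs ds => [|x xs IH] [|d ds] //; rewrite /homog /= => /andP[h /IH].
by rewrite iter_tau_hom.
Qed.

Lemma map_homog V (h : V -> V) ds (xs : seq V) :
  (forall i x, x \in gpart i -> h x \in gpart i) ->
  homog (@gpart _ _ V) ds xs -> homog (@gpart _ _ V) ds (map h xs).
Proof.
move=> hh; elim: xs ds => [|x xs IH] [|d ds] //; rewrite /homog /= => /andP[hx /IH].
by move=> e; rewrite hh.
Qed.

Lemma tw_placewise V W (f : seq V -> W) (S : V -> V -> V -> Prop)
    (T : W -> W -> W -> Prop) :
  (forall z x y, S z x y -> S (tau z) (tau x) (tau y)) ->
  placewise S T f -> placewise S T (fun xs => f (tw xs)).
Proof.
move=> Sh fP l r z x y zxy; rewrite !tw_cat /=; apply: fP.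
by elim: (size r) => //= n; exact: Sh.
Qed.

Lemma tw_multilinear V W (f : seq V -> W) :
  multilinear f -> multilinear (fun xs => f (tw xs)).
Proof.
move=> /multilinear_placewise fP; apply/multilinear_placewise => a.
by apply: tw_placewise (fP a) => z x y ->; rewrite linearP.
Qed.

Lemma multilinear_signs V W (f : seq V -> W) (h : V -> V) (e : Z2 -> int)
    l r ds xs : multilinear f ->
  (forall i x, x \in gpart i -> h x = ksign k (e i) *: x) ->
  homog (@gpart _ _ V) ds xs ->
  f (l ++ map h xs ++ r) = ksign k (\sum_(d <- ds) e d) *: f (l ++ xs ++ r).
Proof.
move=> fL he; elim: xs ds l => [|x xs IH] [|d ds] l //.
  by move=> _; rewrite big_nil scale1r.
rewrite /homog /= => /andP[xd hx].
rewrite (he _ _ xd) multilinearZ // -cat_rcons (IH ds) // cat_rcons.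
by rewrite ksign_scale_comp big_cons.
Qed.

Lemma iter_tau_signs V W (f : seq V -> W) a l r ds xs : multilinear f ->
  homog (@gpart _ _ V) ds xs ->
  f (l ++ map (iter a tau) xs ++ r)
    = ksign k (a%:Z * \sum_(d <- ds) tot d) *: f (l ++ xs ++ r).
Proof.
move=> fL hx; rewrite (multilinear_signs (e := fun d => a%:Z * tot d) _ _ fL _ hx).
  by rewrite mulr_sumr.
by move=> i x; exact: iter_tauE.
Qed.

Lemma stau_signs V W (f : seq V -> W) l r ds xs : multilinear f ->
  homog (@gpart _ _ V) ds xs ->
  f (l ++ map stau xs ++ r)
    = ksign k ((size xs)%:Z + \sum_(d <- ds) tot d) *: f (l ++ xs ++ r).
Proof.
move=> fL hx; rewrite (multilinear_signs (e := fun d => 1 + tot d) _ _ fL _ hx).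
  rewrite big_split /= -(homog_size hx); congr (ksign _ (_ + _) *: _).
  by elim: (ds) => [|d ds' IH]; rewrite ?big_nil // big_cons IH /= -intS.
move=> i x xi; rewrite /stau (tauE xi) ksign_scaleN ksign_scale_comp.
by [].
Qed.

Lemma tot_sum (ds : seq Z2) : tot (\sum_(d <- ds) d) = \sum_(d <- ds) tot d.
Proof.
by elim: ds => [|d ds IH]; rewrite ?big_nil // !big_cons totD IH.
Qed.

(* the values of a multilinear family whose n-th map has total degree c - n *)
Definition total_deg V W (c : int) (f : seq V -> W) := exists2 dg : nat -> Z2,
  (forall n, tot (dg n) = c - n%:Z)
  & multihomog (@gpart _ _ V) (@gpart _ _ W) dg f.

Lemma total_degE V W c (f : seq V -> W) a ds xs : total_deg c f ->
  homog (@gpart _ _ V) ds xs ->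
  iter a tau (f xs)
   = ksign k (a%:Z * (\sum_(d <- ds) tot d + c - (size xs)%:Z)) *: f xs.
Proof.
move=> [dg dgE fh] hx; rewrite (iter_tauE _ (fh _ _ hx)) totD dgE tot_sum.
by rewrite addrA.
Qed.

Section Insertion.
Variables (V W : bgmod k) (f : seq V -> W) (m : seq V -> V).
Hypotheses (fL : multilinear f) (mL : multilinear m) (m0 : m [::] = 0).
Hypothesis md : total_deg 2 m.

(** Both sides evaluate f and m at the same elements, each multiplied by a power
    of -1.  Moving tau past m contributes the degree 2 - |B| of m, and the signs
    agree modulo 2. *)
Lemma insertion_term dA dB dC A B C :
  homog (@gpart _ _ V) dA A -> homog (@gpart _ _ V) dB B ->
  homog (@gpart _ _ V) dC C ->
  f (tw (map stau A ++ m (tw B) :: C)) =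
  ksign k ((size A)%:Z + (size B)%:Z * (size C)%:Z
            + (2 - (size B)%:Z) * \sum_(d <- dA) tot d)
  *: f (map (iter (size B + size C) tau) (tw A)
        ++ m (map (iter (size C) tau) (tw B)) :: tw C).
Proof.
move=> hA hB hC; rewrite tw_cat /= tw_map; last by move=> x; rewrite /stau linearN.
have hA' := tw_homog hA; have hB' := tw_homog hB.
have hsA : homog (@gpart _ _ V) dA (map stau (tw A)).
  by apply: map_homog hA' => i x xi; rewrite /stau smN // tau_hom.
have := iter_tau_signs (size C).+1 [::] (iter (size C) tau (m (tw B)) :: tw C) fL hsA.
rewrite !cat0s => ->.
have := stau_signs [::] (iter (size C) tau (m (tw B)) :: tw C) fL hA'.
rewrite !cat0s => ->.
have := iter_tau_signs (size B + size C) [::]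
  (m (map (iter (size C) tau) (tw B)) :: tw C) fL hA'.
rewrite !cat0s => ->.
have := iter_tau_signs (size C) [::] [::] mL hB'.
rewrite !cat0s !cats0 => ->.
rewrite (total_degE _ md hB') !multilinearZ // !ksign_scale_comp; congr (_ *: _).
rewrite !size_tw; set a := \sum_(d <- dA) _; set b := \sum_(d <- dB) _.
apply: (@ksign_eq _ _ _ ((size C)%:Z - (size B)%:Z * (size C)%:Z)).
by rewrite PoszD intS; ring.
Qed.

(** The factors (-1)^(r+st) and the Koszul sign of m passing the first r entries
    are what tw and stau produce on the right; the empty insertions there vanish
    because m [::] = 0. *)
Lemma insertion_ins ds xs : homog (@gpart _ _ V) ds xs ->
  insertion_sum tot f m ds (tw xs)
    = ins stau (fun ys => f (tw ys)) (fun ys => m (tw ys)) xs.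
Proof.
move=> hx; rewrite /insertion_sum size_tw /ins [RHS]/split big_ord_recr /=.
rewrite drop_size split_nil m0 (madd0 (multilinear_add (tw_multilinear fL))) addr0.
apply: eq_bigr => r _; have rn := ltn_ord r.
rewrite /split size_drop.
rewrite (big_ord_widen (size xs).+1 (fun s => f (tw (map stau (take r xs) ++
   m (tw (take s (drop r xs))) :: drop s (drop r xs))))); last lia.
rewrite big_mkcond [RHS]big_mkcond; apply: eq_bigr => s _.
have [->|s0] := posnP s.
  by rewrite !take0 /= m0 (madd0 (multilinear_add (tw_multilinear fL))).
rewrite (_ : (s < (size xs - r).+1)%N = (r + s <= size xs)%N); last lia.
rewrite /=; case: ifP => // rs.
rewrite drop_drop [(s + r)%N]addnC.
set A := take r xs; set B := take s (drop r xs); set C := drop (r + s) xs.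
have eA : size A = r by rewrite size_takel //; lia.
have eB : size B = s by rewrite size_takel // size_drop; lia.
have eC : size C = (size xs - r - s)%N by rewrite size_drop; lia.
have exs : xs = A ++ B ++ C.
  by rewrite /A /B /C addnC -drop_drop !cat_take_drop.
have [hA hBC] := homog_catP (etrans (congr1 (homog _ ds) (esym exs)) hx).
have [hB hC] := homog_catP hBC.
rewrite (insertion_term hA hB hC).
set A' := map _ (tw A); set B' := map _ (tw B).
have sA : size A' = r by rewrite size_map size_tw.
have sB : size B' = s by rewrite size_map size_tw.
have -> : tw xs = A' ++ B' ++ tw C by rewrite exs tw_cat size_cat tw_cat.
rewrite [(r + s)%N]addnC -drop_drop take_size_cat // drop_size_cat // take_size_cat //.
by rewrite (drop_size_cat _ sB) eA eB eC -ksign_nat -ksignD PoszD PoszM.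
Qed.
End Insertion.
End Twist.

(** ** Compositions of an integer *)

Fixpoint shapes_below (b n : nat) : seq (seq nat) :=
  match n, b with
  | 0, _ => [:: [::]]
  | _, 0 => [::]
  | n'.+1, b'.+1 =>
      flatten [seq [seq s.+1 :: sh | sh <- shapes_below b' (n' - s)] | s <- iota 0 n'.+1]
  end.

(** The bound b on the number of parts makes the recursion structural. *)
Definition shapes n := shapes_below n n.

Lemma shapes_below_stable b c n : (n <= b)%N -> (n <= c)%N ->
  shapes_below b n = shapes_below c n.
Proof.
elim: b c n => [|b IH] [|c] [|n] // hb hc.
rewrite -[LHS]/(flatten [seq [seq s.+1 :: sh | sh <- shapes_below b (n - s)]
  | s <- iota 0 n.+1]).
rewrite -[RHS]/(flatten [seq [seq s.+1 :: sh | sh <- shapes_below c (n - s)]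
  | s <- iota 0 n.+1]).
congr flatten; apply/eq_in_map => s _; rewrite (IH c) //; lia.
Qed.

Lemma shapesS n : shapes n.+1 =
  flatten [seq [seq s.+1 :: sh | sh <- shapes (n - s)] | s <- iota 0 n.+1].
Proof.
transitivity (flatten [seq [seq s.+1 :: sh | sh <- shapes_below n (n - s)]
   | s <- iota 0 n.+1]) => //; congr flatten; apply/eq_in_map => s _.
by rewrite /shapes (@shapes_below_stable n (n - s)) //; lia.
Qed.

Lemma mem_shapes n sh : (sh \in shapes n) = all (fun i => 0 < i)%N sh && (sumn sh == n).
Proof.
elim: sh n => [|i sh IH] [|n] //.
- by rewrite shapesS [RHS]/=; apply/negbTE/flatten_mapP => -[j _ /mapP[]].
- by case: i => //= i; rewrite andbF.
rewrite shapesS; apply/flatten_mapP/andP.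
  move=> [s]; rewrite mem_iota => hs /mapP[sh' hsh' [-> e]].
  move: hsh'; rewrite -e IH => /andP[h /eqP es].
  by split; rewrite //= es; apply/eqP; lia.
case: i => [|i] [h1 /eqP h2]; first by [].
rewrite /= in h1 h2; exists i; first by rewrite mem_iota; lia.
apply/mapP; exists sh => //; rewrite IH h1 /=; apply/eqP; lia.
Qed.

Lemma shapes_uniq n : uniq (shapes n).
Proof.
have [b] := ubnP n; elim: b n => // b IH [|n] // hn.
rewrite shapesS; apply: allpairs_uniq_dep; first exact: iota_uniq.
  by move=> s _; apply: IH; lia.
move=> [s sh] [t sh'] /= _ _ [e1 e2]; by rewrite e1 e2.
Qed.

Lemma comp_shapes (V M : Type) (W : zmodType) (g : seq M -> W) (f : seq V -> M) xs :
  comp g f xs = \sum_(sh <- shapes (size xs)) g (map f (reshape sh xs)).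
Proof.
elim/suffix_ind: xs g => [|x xs IH] g.
  by rewrite comp_nil /shapes /= big_seq1.
rewrite comp_cons [size _]/= shapesS big_flatten big_map /split.
rewrite (_ : iota 0 _ = index_iota 0 (size xs).+1) ?big_mkord; last first.
  by rewrite /index_iota subn0.
apply: eq_bigr => s _; rewrite big_map (IH (take s xs)) ?cat_take_drop //.
by rewrite size_drop.
Qed.

Lemma big_tuple_shapes (W : zmodType) (F : seq nat -> W) n :
  \sum_(q < n.+1) \sum_(c : q.-tuple 'I_n.+1
      | all (fun i : 'I_n.+1 => (0 < i)%N) c && (sumn [seq val i | i <- c] == n))
    F [seq val i | i <- c] = \sum_(sh <- shapes n) F sh.
Proof.
have sh_size sh : sh \in shapes n -> (size sh < n.+1)%N.
  rewrite mem_shapes => /andP[h /eqP <-]; rewrite ltnS.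
  elim: sh h => //= i sh IH /andP[i0 /IH]; lia.
transitivity (\sum_(q < n.+1) \sum_(sh <- shapes n | size sh == q) F sh); last first.
  rewrite (exchange_big_dep xpredT) //= [LHS]big_seq [RHS]big_seq.
  apply: eq_bigr => sh /sh_size h; by rewrite (big_pred1 (Ordinal h)).
apply: eq_bigr => q _; rewrite -[RHS]big_filter -[LHS]big_filter.
set L := [seq c <- _ | _].
transitivity (\sum_(sh <- [seq [seq val i | i <- tval c] | c <- L]) F sh).
  by rewrite big_map.
apply: perm_big; apply: uniq_perm.
- rewrite map_inj_uniq ?filter_uniq ?index_enum_uniq // => c c' e.
  by apply: val_inj; exact: (inj_map val_inj e).
- by rewrite filter_uniq // shapes_uniq.
move=> sh; rewrite mem_filter mem_shapes; apply/mapP/idP.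
  move=> [c]; rewrite mem_filter => /andP[/andP[h1 h2] _] ->.
  by rewrite size_map size_tuple eqxx all_map h1.
move=> /andP[/eqP hq /andP[h1 h2]].
have lt i : i \in sh -> (i < n.+1)%N.
  move=> ish; rewrite ltnS -(eqP h2).
  by elim: (sh) ish => //= j s IH; rewrite inE => /orP[/eqP ->|/IH]; lia.
have sz : size [seq inord i : 'I_n.+1 | i <- sh] == q by rewrite size_map hq.
have e : [seq val i | i <- [seq inord i : 'I_n.+1 | i <- sh]] = sh.
  rewrite -map_comp -[RHS]map_id; apply/eq_in_map => i /lt h.
  by rewrite /= inordK.
exists (Tuple sz) => //; rewrite mem_filter mem_index_enum andbT /= e h2 andbT.
by move: h1; rewrite -{1}e all_map.
Qed.

Section Blocks.
Variables (k : fieldType) (V W : bgmod k).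
Variables (f : seq V -> W) (m : seq W -> W).
Hypotheses (fL : multilinear f) (fd : total_deg 1 f).

Definition block_sign (sh : seq nat) (ds : seq Z2) : int :=
  ((\sum_(j < size sh) (size sh - j.+1) * (nth 0%N sh j).-1)%N)%:Z
  + \sum_(j < size sh) (1 - (nth 0%N sh j)%:Z)
                  * \sum_(d <- take (sumn (take j sh)) ds) tot d.

Lemma block_sign_cons i sh ds : block_sign (i :: sh) ds =
  (size sh * i.-1)%N%:Z
  + (\sum_(j <- sh) (1 - j%:Z)) * \sum_(d <- take i ds) tot d
  + block_sign sh (drop i ds).
Proof.
rewrite /block_sign /= !big_ord_recl /= subn1 /= take0 big_nil mulr0 add0r PoszD.
set X := (\sum_(j < _) ((size sh).+1 - _) * _)%N; set Y := \sum_(j < _) (1 - _) * _.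
rewrite (_ : X = \sum_(j < size sh) (size sh - j.+1) * (nth 0 sh j).-1)%N; last first.
  by apply: eq_bigr => j _; rewrite /bump leq0n add1n subSS add0n.
have -> : Y = (\sum_(j <- sh) (1 - j%:Z)) * \sum_(d <- take i ds) tot d
   + \sum_(j < size sh) (1 - (nth 0%N sh j)%:Z)
       * \sum_(d <- take (sumn (take j sh)) (drop i ds)) tot d.
  rewrite (big_nth 0%N) big_mkord mulr_suml -big_split; apply: eq_bigr => j _.
  by rewrite /= add0n takeD big_cat mulrDr.
ring.
Qed.

(** On the left the value of f on the j-th of q blocks carries tau^(q-j), on the
    right its entries carry a power of tau, with exponent the number of entries
    of the later blocks.  The difference is (-1)^((q-j)(i_j-1)) times the Koszul
    sign of f_{i_j} passing the entries before its block; only the product of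
    these signs over all j agrees, as seen by splitting off the first block. *)
Lemma block_term (g : seq W -> W) sh ds xs : multilinear g ->
  all (fun i => 0 < i)%N sh -> sumn sh = size xs -> homog (@gpart _ _ V) ds xs ->
  g (tw (map (fun B => f (tw B)) (reshape sh xs)))
    = ksign k (block_sign sh ds) *: g (map f (reshape sh (tw xs))).
Proof.
elim: sh ds xs g => [|i sh IH] ds xs g gL.
  by move=> _ _ _; rewrite /block_sign !big_ord0 scale1r.
move=> /= /andP[i0 sh0] si hx.
set B := take i xs; set R := drop i xs.
have eB : size B = i by rewrite size_takel // -si leq_addr.
have eR : size R = sumn sh by rewrite size_drop -si addKn.
have exs : xs = B ++ R by rewrite cat_take_drop.
have [hB hR] := homog_catP (etrans (congr1 (homog _ ds) (esym exs)) hx).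
rewrite eB in hB hR.
have gL' u : multilinear (fun ys => g (u :: ys)) by move=> l; exact: (gL (u :: l)).
have szR : size (reshape sh R) = size sh.
  by rewrite -(size_map size) -/(shape _) reshapeKl ?size_map // eR.
rewrite (IH (drop i ds) _ _ (gL' _)) // size_map szR.
set B' := map (iter (size R) tau) (tw B).
have sB' : size B' = i by rewrite size_map size_tw.
have -> : tw xs = B' ++ tw R by rewrite exs tw_cat.
rewrite take_size_cat // drop_size_cat //.
have := iter_tau_signs (size R) [::] [::] fL (tw_homog hB).
rewrite !cat0s !cats0 => ->.
rewrite (total_degE _ fd (tw_homog hB)) -[_ *: _ :: _]cat0s -[X in _ = _ *: g X]cat0s.
rewrite !multilinearZ // !ksign_scale_comp; congr (_ *: _).
rewrite block_sign_cons size_tw eB; set b := \sum_(d <- take i ds) _.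
have -> : \sum_(j <- sh) (1 - j%:Z) = (size sh)%:Z - (size R)%:Z.
  rewrite eR; elim: (sh) => [|j s IHs]; first by rewrite big_nil.
  rewrite big_cons IHs /= intS PoszD; ring.
rewrite PoszM (_ : i.-1%:Z = i%:Z - 1); last by case: (i) i0 => // j _; rewrite intS /=; ring.
set c := block_sign _ _; set q := (size sh)%:Z; set t := (size R)%:Z.
apply: (@ksign_eq _ _ _ (q * (1 - i%:Z) )); ring.
Qed.

Lemma block_comp ds xs : multilinear m -> homog (@gpart _ _ V) ds xs ->
  block_sum tot m f ds (tw xs)
    = comp (fun ys => m (tw ys)) (fun ys => f (tw ys)) xs.
Proof.
move=> mL hx; rewrite comp_shapes.
transitivity (\sum_(sh <- shapes (size xs))
    ksign k (block_sign sh ds) *: m (map f (reshape sh (tw xs)))); last first.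
  rewrite big_seq [RHS]big_seq; apply: eq_bigr => sh.
  by rewrite mem_shapes => /andP[h /eqP e]; rewrite (block_term (ds := ds)).
rewrite -big_tuple_shapes /block_sum size_tw; apply: eq_bigr => q _.
apply: eq_bigr => c _; rewrite /block_sign size_map size_tuple.
by rewrite ksignD.
Qed.
End Blocks.

(** * Transfer of A-infinity structures *)

Section Degrees.
Variable s : nat.

Let c : Z2 := (s%:Z, 1 - s%:Z).
Lemma mor_degE n : mor_deg s n = c - c *+ n.
Proof.
elim: n => [|n IH]; first by apply: Z2_eq; rewrite /= ?mulr0n; ring.
by rewrite mulrSr opprD addrA -IH; apply: Z2_eq; rewrite /= intS; ring.
Qed.
Lemma alg_degE n : alg_deg s n = c *+ 2 - c *+ n.
Proof.
rewrite mulr2n -addrA -mor_degE; apply: Z2_eq; rewrite /=; ring.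
Qed.
Lemma tot_alg_deg n : tot (alg_deg s n) = 2 - n%:Z.
Proof. rewrite /tot /=; ring. Qed.
Lemma tot_mor_deg n : tot (mor_deg s n) = 1 - n%:Z.
Proof. rewrite /tot /=; ring. Qed.
Lemma alg_deg1 : alg_deg s 1 = c.
Proof. by rewrite alg_degE mulr2n addrK. Qed.

End Degrees.

(** The Stasheff identities for all elements, without signs. *)
Lemma Ainf_ins (k : fieldType) (s : nat) (M : bgmod k) (m : gmulti M M (alg_deg s)) ys :
  is_bAinf M m -> ins stau (fun xs => m (tw xs)) (fun xs => m (tw xs)) ys = 0.
Proof.
move=> m_Ainf; have mL : multilinear m := gmultiL m.
have bD := multilinear_add (tw_multilinear mL).
apply: homog_ext ys => [|es xs hx].
  apply: ins_placewise; rewrite //; first exact: sumrel_add.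
  by move=> z x y ->; exact: stauD.
rewrite -(insertion_ins mL mL (gmulti0 m) _ hx); first exact: m_Ainf (tw_homog hx).
by exists (alg_deg s); [exact: tot_alg_deg|exact: gmultiP].
Qed.

Section TransferBigraded.
Variables (k : fieldType) (s : nat) (N M : bgmod k).
Variables (m : gmulti M M (alg_deg s)).
Variables (i : N -> M) (dN : N -> N) (p : M -> N) (G : M -> M).

Let c : Z2 := (s%:Z, 1 - s%:Z).
Hypotheses (iL : linear i) (dL : linear dN) (pL : linear p) (GL : linear G).
Hypotheses (iH : bihomog 0 i) (dH : bihomog (alg_deg s 1) dN).
Hypotheses (pH : bihomog 0 p) (GH : bihomog (- alg_deg s 1) G).
Hypothesis m_Ainf : is_bAinf M m.
Hypothesis di : forall x, m [:: i x] = i (dN x).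
Hypothesis hG : forall x, i (p x) - x = m [:: G x] + G (m [:: x]).
Hypothesis i_inj : injective i.

Let b xs := m (tw xs).
Let tf := transfer_mor b i G.
Let tb := transfer_alg b i dN p G.

Let mL : multilinear m. Proof. exact: gmultiL. Qed.
Let bL : multilinear b. Proof. exact: tw_multilinear. Qed.
Let bD : multiadditive b. Proof. exact: multilinear_add. Qed.
Let b0 : b [::] = 0. Proof. exact: gmulti0. Qed.
Let bH ds xs : homog (@gpart _ _ M) ds xs ->
  b xs \in gpart (\sum_(d <- ds) d + c *+ 2 - c *+ size xs).
Proof.
by move=> hx; have := gmultiP m (tw_homog hx); rewrite size_tw alg_degE addrA.
Qed.
Let md : total_deg 2 m.
Proof. by exists (alg_deg s); [exact: tot_alg_deg|exact: gmultiP]. Qed.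
Let iD := lin_add iL. Let dD := lin_add dL. Let pD := lin_add pL. Let GD := lin_add GL.

Let bs ys : b (map stau ys) = - stau (b ys).
Proof.
apply/eqP; rewrite -subr_eq0 opprK; apply/eqP; move: ys.
apply: homog_ext => [l r z x y ->|ds xs hx].
  rewrite !map_cat /= stauD !(maddP bD) stauD; zmodule.
have := stau_signs [::] [::] bL hx; rewrite !cat0s !cats0 => ->.
rewrite /stau (tauE (bH hx)); apply/eqP; rewrite subr_eq0; apply/eqP.
congr (_ *: _); rewrite -addrA -alg_degE totD tot_alg_deg tot_sum.
by apply: (@ksign_eq _ _ _ ((size xs)%:Z - 1)); ring.
Qed.

Let i_sign x : i (stau x) = stau (i x).
Proof.
by rewrite /stau (add_morphN _ iD) (tau_comm _ iL iH) scale1r.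
Qed.
Let ps x : p (stau x) = stau (p x).
Proof.
by rewrite /stau (add_morphN _ pD) (tau_comm _ pL pH) scale1r.
Qed.
Let Gs x : G (stau x) = - stau (G x).
Proof.
rewrite /stau (add_morphN _ GD) (tau_comm _ GL GH).
rewrite (_ : tot _ = 1 + (-1) * 2); last by rewrite /tot /=; ring.
by rewrite ksignD ksign_double mulr1 ksign1 scaleN1r.
Qed.
Let ds x : dN (stau x) = - stau (dN x).
Proof.
rewrite /stau (add_morphN _ dD) (tau_comm _ dL dH) tot_alg_deg.
by rewrite (_ : 2 - 1%:Z = 1) // ksign1 scaleN1r.
Qed.

Let bb ys : ins stau b b ys = 0. Proof. exact: Ainf_ins. Qed.

Let single_homog (U : bgmod k) e (h : N -> U) es xs : bihomog e h ->
  homog (@gpart _ _ N) es xs ->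
  single h xs \in gpart (\sum_(d <- es) d + (e + c) - c *+ size xs).
Proof.
move=> hh; case: xs es => [|y [|z ys]] es; try by move=> _; exact: sm0.
case: es => [|d [|d' es]]; rewrite /homog /= ?andbF //.
rewrite andbT => /hh.
by rewrite big_seq1 mulr1n addrA addrK.
Qed.

Lemma transfer_mor_homog es xs : homog (@gpart _ _ N) es xs ->
  tf xs \in gpart (\sum_(d <- es) d + c - c *+ size xs).
Proof.
move: es xs; suff h : forall n es ys, homog (@gpart _ _ N) es ys ->
    transfer_morn b i G n ys \in gpart (\sum_(d <- es) d + c - c *+ size ys).
  by move=> es xs; exact: h.
elim=> [|n IH] es ys hy /=; first exact: sm0.
apply: smD.
  by have := single_homog iH hy; rewrite add0r.
have hb fs zs : homog (@gpart _ _ M) fs zs ->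
    plural b zs \in gpart (\sum_(d <- fs) d + c *+ 2 - c *+ size zs).
  by rewrite /plural => /bH; case: ifP => // _ _; exact: sm0.
have := GH (comp_homog IH hb hy); rewrite alg_deg1 mulr2n.
by congr (_ \in gpart _); zmodule.
Qed.

Lemma transfer_alg_homog es xs : homog (@gpart _ _ N) es xs ->
  tb xs \in gpart (\sum_(d <- es) d + c *+ 2 - c *+ size xs).
Proof.
move=> hx; apply: smD.
  by have := single_homog dH hx; rewrite alg_deg1 mulr2n.
have hb fs zs : homog (@gpart _ _ M) fs zs ->
    plural b zs \in gpart (\sum_(d <- fs) d + c *+ 2 - c *+ size zs).
  by rewrite /plural => /bH; case: ifP => // _ _; exact: sm0.
by have := pH (comp_homog transfer_mor_homog hb hx); rewrite addr0.
Qed.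

Section Closed.
Variables (SN : N -> N -> N -> Prop) (SM : M -> M -> M -> Prop).
Hypotheses (SN0 : sumrel SN) (SM0 : sumrel SM).
Hypothesis tN : forall z x y, SN z x y -> SN (tau z) (tau x) (tau y).
Hypothesis tM : forall z x y, SM z x y -> SM (tau z) (tau x) (tau y).
Hypothesis mP : placewise SM SM m.
Hypothesis iP : forall z x y, SN z x y -> SM (i z) (i x) (i y).
Hypothesis dP : forall z x y, SN z x y -> SN (dN z) (dN x) (dN y).
Hypothesis pP : forall z x y, SM z x y -> SN (p z) (p x) (p y).
Hypothesis GP : forall z x y, SM z x y -> SM (G z) (G x) (G y).

(** Applied to linearity and to k[h]-linearity. *)
Lemma transfer_closed :
  placewise SN SN (fun xs => tb (tw xs)) /\ placewise SN SM (fun xs => tf (tw xs)).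
Proof.
have bP : placewise SM SM b by exact: tw_placewise.
by split; apply: tw_placewise => //;
  [exact: (transfer_alg_placewise SN0 SM0)|exact: transfer_mor_placewise].
Qed.
End Closed.

Lemma transfer_linear :
  multilinear (fun xs => tb (tw xs)) /\ multilinear (fun xs => tf (tw xs)).
Proof.
have h a : placewise (fun z x y => z = a *: x + y) (fun z x y => z = a *: x + y) m.
  by have /multilinear_placewise := mL; apply.
have H a := @transfer_closed (fun z x y => z = a *: x + y)
  (fun z x y => z = a *: x + y) (sumrel_lin N a) (sumrel_lin M a).
have {}H a : placewise (fun z x y => z = a *: x + y) (fun z x y => z = a *: x + y)
      (fun xs => tb (tw xs))
    /\ placewise (fun z x y => z = a *: x + y) (fun z x y => z = a *: x + y)
      (fun xs => tf (tw xs)).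
  apply: H => [z x y ->|z x y ->||z x y ->|z x y ->|z x y ->|z x y ->] //;
    by rewrite ?linearP ?iL ?dL ?pL ?GL.
by split; apply/multilinear_placewise => a; have [] := H a.
Qed.

Lemma transfer_alg_multihomog :
  multihomog (@gpart _ _ N) (@gpart _ _ N) (alg_deg s) (fun xs => tb (tw xs)).
Proof.
move=> es xs /tw_homog/transfer_alg_homog.
by rewrite size_tw alg_degE -addrA.
Qed.

Lemma transfer_mor_multihomog :
  multihomog (@gpart _ _ N) (@gpart _ _ M) (mor_deg s) (fun xs => tf (tw xs)).
Proof.
move=> es xs /tw_homog/transfer_mor_homog.
by rewrite size_tw mor_degE -addrA.
Qed.

Definition transferred_alg : gmulti N N (alg_deg s) :=
  @Gmulti _ _ N N _ (fun xs => tb (tw xs)) (transfer_alg0 b i dN G pD)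
    (proj1 transfer_linear) transfer_alg_multihomog.

Definition transferred_mor : gmulti N M (mor_deg s) :=
  @Gmulti _ _ N M _ (fun xs => tf (tw xs)) (transfer_mor0 b i G)
    (proj2 transfer_linear) transfer_mor_multihomog.

Let di' x : b [:: i x] = i (dN x). Proof. exact: di. Qed.
Let hG' x : i (p x) - x = b [:: G x] + G (b [:: x]). Proof. exact: hG. Qed.

Let tfE : (fun xs => transferred_mor (tw xs)) = tf.
Proof. by apply/funext => xs; rewrite /= twK. Qed.
Let tbE : (fun xs => transferred_alg (tw xs)) = tb.
Proof. by apply/funext => xs; rewrite /= twK. Qed.

Lemma transferred_Ainf : is_bAinf N transferred_alg.
Proof.
move=> es xs hx; rewrite -(twK xs) /stasheff.
rewrite (insertion_ins (V := N)) ?tw_homog //; first last.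
- exists (alg_deg s); [exact: tot_alg_deg|exact: gmultiP].
- exact: gmulti0.
- exact: gmultiL.
- exact: gmultiL.
rewrite tbE; apply: transfer_algP => //;
  first [exact: stauD|exact: stauK|exact: bs|exact: i_sign|exact: ps|exact: Gs|exact: ds].
Qed.

Lemma transferred_morphism :
  is_Ainf_morphism tot (@gpart _ _ N) transferred_alg m transferred_mor.
Proof.
move=> es xs hx; rewrite -(twK xs).
rewrite (insertion_ins (V := N)) ?tw_homog //; first last.
- exists (alg_deg s); [exact: tot_alg_deg|exact: gmultiP].
- exact: gmulti0.
- exact: gmultiL.
- exact: gmultiL.
rewrite (block_comp (V := N)) ?tw_homog //; first last.
- exists (mor_deg s); [exact: tot_mor_deg|exact: gmultiP].
- exact: gmultiL.
rewrite tbE tfE; apply/esym/(transfer_morP (sM := stau)) => //;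
  first [exact: stauD|exact: stauK|exact: bs|exact: i_sign|exact: ps|exact: Gs|exact: ds].
Qed.

Lemma transferred_alg1 x : transferred_alg [:: x] = dN x.
Proof. exact: (transfer_alg1 b i dN G pD). Qed.
Lemma transferred_mor1 x : transferred_mor [:: x] = i x.
Proof. exact: (transfer_mor1 b i GD). Qed.
Lemma transferred_alg2 x y : transferred_alg [:: x; y] = p (m [:: i x; i y]).
Proof.
rewrite /= /tb /transfer_alg /= add0r comp_cons split_cons split_nil comp_nil addr0.
rewrite comp_cons split_nil comp_nil !(transfer_mor1 b i GD) /plural /b /=.
by rewrite -(scale1r (tau _)) -ksign0 -(tau_comm _ iL iH) tauK.
Qed.
End TransferBigraded.

(** * Contractions *)

Section Perturbation.
Variables (M N : zmodType) (d0 dl s : M -> M) (i0 : N -> M) (p0 : M -> N) (L : M -> M).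
Hypotheses (d0D : {morph d0 : x y / x + y}) (dlD : {morph dl : x y / x + y}).
Hypotheses (sD : {morph s : x y / x + y}) (i0D : {morph i0 : x y / x + y}).
Hypotheses (p0D : {morph p0 : x y / x + y}) (LD : {morph L : x y / x + y}).
Hypothesis (pi0 : forall x, p0 (i0 x) = x).
Hypothesis (ss : forall x, s (s x) = 0).
Hypothesis (si0 : forall x, s (i0 x) = 0).
Hypothesis (p0s : forall x, p0 (s x) = 0).
Hypothesis (p0d0 : forall x, p0 (d0 x) = 0).
Hypothesis (htpy : forall x, i0 (p0 x) + s (d0 x) + d0 (s x) = x).
Hypothesis (dd0 : forall x, d0 (d0 x) = 0).
Hypothesis (dd : forall x, d0 (d0 x + dl x) + dl (d0 x + dl x) = 0).
Hypotheses (LK : forall x, L (x + s (dl x)) = x) (KL : forall x, L x + s (dl (L x)) = x).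

(** The contraction (i0, p0, s) of d0, carried over to the perturbed
    differential d0 + dl by means of the inverse L of 1 + s dl.  These are the
    formulas of the homological perturbation lemma. *)
Definition pert_i x := L (i0 x).
Definition pert_p x := p0 x - p0 (dl (L (s x))).
Definition pert_s x := L (s x).
Definition pert_d x := p0 (dl (pert_i x)).

Let s_i x : s (pert_i x) = 0.
Proof.
have := congr1 s (KL (i0 x)); rewrite sD ss si0 addr0; exact.
Qed.

Let p0_i x : p0 (pert_i x) = x.
Proof.
by have := congr1 p0 (KL (i0 x)); rewrite p0D p0s addr0 pi0.
Qed.

(** The difference y of both sides is killed by s and p0, so y = s (d0 y) by the
    homotopy relation.  As d0 + dl has square zero, (d0 + dl) y is in the image
    of (d0 + dl) \o pert_i, on which s vanishes.  So (1 + s dl) y = 0. *)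
Lemma pert_chain x : d0 (pert_i x) + dl (pert_i x) = pert_i (pert_d x).
Proof.
pose y := d0 (pert_i x) + dl (pert_i x) - pert_i (pert_d x).
suff y0 : y = 0 by apply/eqP; rewrite -subr_eq0; apply/eqP.
have iE : i0 x = pert_i x + s (dl (pert_i x)) by rewrite KL.
have sDi u : s (d0 (pert_i u)) + s (dl (pert_i u)) = 0.
  have := htpy (pert_i u); rewrite p0_i s_i (add_morph0 d0D) addr0.
  rewrite -[X in X + _ = _](KL (i0 u)) -/(pert_i u) => e.
  apply: (addrI (pert_i u)); rewrite addr0 -[RHS]e; zmodule.
have sy : s y = 0 by rewrite /y !sD (add_morphN _ sD) s_i oppr0 addr0 sDi.
have py : p0 y = 0.
  by rewrite /y !p0D (add_morphN _ p0D) p0_i p0d0 add0r subrr.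
have e1 : s (d0 y) = y.
  by have := htpy y; rewrite sy py (add_morph0 i0D) (add_morph0 d0D) add0r addr0.
have e2 : d0 y + dl y = - (d0 (pert_i (pert_d x)) + dl (pert_i (pert_d x))).
  have := dd (pert_i x).
  rewrite (_ : d0 (pert_i x) + dl (pert_i x) = y + pert_i (pert_d x)); last by rewrite /y subrK.
  by rewrite d0D dlD => e; rewrite -[RHS]add0r -[X in _ = X + _]e; zmodule.
have e3 : y + s (dl y) = 0.
  by rewrite -{1}e1 -sD e2 (add_morphN _ sD) sD sDi oppr0.
by rewrite -(LK y) e3 (add_morph0 LD).
Qed.

Lemma pert_pi x : pert_p (pert_i x) = x.
Proof.
by rewrite /pert_p p0_i s_i (add_morph0 LD) (add_morph0 dlD) (add_morph0 p0D) subr0.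
Qed.

(** After composition with 1 + s dl on the left, the equation is a sum of
    instances of the unperturbed homotopy relation. *)
Lemma pert_homotopy x :
  d0 (pert_s x) + dl (pert_s x) + pert_s (d0 x + dl x) = x - pert_i (pert_p x).
Proof.
pose z := pert_s x; rewrite -/z.
have zE : s x = z + s (dl z) by rewrite KL.
have sz : s z = 0.
  by have := congr1 s zE; rewrite ss sD ss addr0 => <-.
have pz : p0 z = 0.
  by have := congr1 p0 zE; rewrite p0s p0D p0s addr0 => <-.
pose w := d0 z + dl z + pert_s (d0 x + dl x) - x + pert_i (pert_p x).
suff w0 : w = 0.
  by apply/eqP; rewrite -subr_eq0 opprB; apply/eqP; rewrite -w0 /w; zmodule.
have e1 : L (d0 z + dl z + s (dl (d0 z + dl z)) + s (d0 x + dl x)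
      - (x + s (dl x)) + i0 (pert_p x)) = w.
  by rewrite 3!LD (add_morphN _ LD) !LK.
rewrite -e1 -[RHS](add_morph0 LD); congr (L _).
have hx := htpy x; have hz := htpy z; have hd := htpy (dl z).
rewrite pz sz (add_morph0 i0D) (add_morph0 d0D) add0r addr0 in hz.
rewrite /pert_p i0D (add_morphN _ i0D) -/(pert_s x) -/z.
have dsx : d0 (s x) = d0 z + d0 (s (dl z)) by rewrite zE d0D.
have ddz : s (d0 (dl z)) + s (dl (d0 z + dl z)) = 0.
  rewrite -sD; have := dd z; rewrite d0D dd0 add0r => ->.
  exact: add_morph0.
rewrite sD.
(* the sum of ddz with hd - hx - dsx, each with its terms on one side *)
transitivity (s (d0 (dl z)) + s (dl (d0 z + dl z))
  + (dl z - (i0 (p0 (dl z)) + s (d0 (dl z)) + d0 (s (dl z))))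
  - (x - (i0 (p0 x) + s (d0 x) + d0 (s x)))
  - (d0 (s x) - (d0 z + d0 (s (dl z))))); first by zmodule.
by rewrite ddz hd hx dsx !subrr add0r !subr0.
Qed.
End Perturbation.

Section Complements.
Variables (k : fieldType) (I : zmodType) (V : gmod k I) (Z K : gsub V).

(** The graded subspaces of Z that meet K trivially. *)
Definition partial_complement (A : set V) : Prop :=
  [/\ forall x, A x -> x \in Z,
      forall a x y, A x -> A y -> A (a *: x + y),
      forall x, A x -> exists2 t : seq (I * V),
        (forall u, u \in t -> u.2 \in @gpart _ _ V u.1 /\ A u.2) & x = \sum_(u <- t) u.2
    & forall x, A x -> x \in K -> x = 0].

Lemma partial_complement_chain (F : set (set V)) :
  (F `<=` partial_complement)%classic -> total_on F subset ->
  partial_complement (\bigcup_(X in F) X)%classic.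
Proof.
move=> FP Ftot; split.
- by move=> x [X /FP[h _ _ _]]; exact: h.
- move=> a x y [X FX Xx] [Y FY Yy].
  have [XY|YX] := Ftot _ _ FX FY.
    by exists Y => //; have [_ h _ _] := FP _ FY; apply: h => //; exact: XY.
  by exists X => //; have [_ h _ _] := FP _ FX; apply: h => //; exact: YX.
- move=> x [X FX Xx]; have [_ _ h _] := FP _ FX; have [t tP ->] := h _ Xx.
  by exists t => // u /tP[h1 h2]; split=> //; exists X.
- by move=> x [X /FP[_ _ _ h]]; exact: h.
Qed.

(** A maximal graded subspace A of Z that meets K trivially is a complement: a
    homogeneous element outside of A + K could be added to it. *)
Lemma complement_exists : exists C : gsub V,
  [/\ forall x, x \in C -> x \in Z, forall x, x \in C -> x \in K -> x = 0
    & forall z, z \in Z -> exists c u, [/\ c \in C, u \in K & z = c + u]].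
Proof.
have [A [[AZ AL Ag AK] Amax]] := Zorn_bigcup partial_complement_chain.
have A0 : A 0.
  have [[x Ax]|] := pselect (exists x, A x).
    by have := AL (-1) x x Ax Ax; rewrite scaleN1r addNr.
  move=> An; exfalso; apply: (Amax [set 0]%classic).
    by split=> [x Ax|/(_ 0 erefl) h]; exfalso; apply: An; [exists x|exists 0].
  split=> [x ->|a x y -> ->|x ->|x ->] //=.
  - exact: sm0.
  - by rewrite scaler0 addr0.
  - by exists [::]; rewrite ?big_nil.
pose Csub := submod_of A0 AL.
have inC x : reflect (A x) (x \in Csub) by exact: submod_ofP.
have Cg : is_graded_sub Csub.
  move=> x /inC/Ag[t tP ->]; exists t => //; apply/allP => u /tP[h1 h2].
  by rewrite h1; apply/inC.
pose C := Gsub Cg; exists C; split.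
- by move=> x /inC; exact: (AZ).
- by move=> x /inC; exact: (AK).
pose good z := exists c u, [/\ c \in C, u \in K & z = c + u].
have good0 : good 0 by exists 0, 0; rewrite ?sm0 ?addr0.
have goodD x y : good x -> good y -> good (x + y).
  move=> [c [u [cC uK ->]]] [c' [u' [cC' uK' ->]]].
  exists (c + c'), (u + u'); split; [exact: smD|exact: smD|exact: addrACA].
suff hom i z : z \in @gpart _ _ V i -> z \in Z -> good z.
  move=> z /(gsubP (g := Z))[t tP ->].
  elim: t tP => [|u t IH] /=; first by rewrite big_nil.
  move=> /andP[/andP[h1 h2] h3]; rewrite big_cons.
  by apply: goodD; [exact: hom h1 h2|exact: IH].
move=> zi zZ; apply: contrapT => zn.
pose B : set V := fun y => exists x a, A x /\ y = x + a *: z.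
apply: (Amax B).
  split; first by move=> x Ax; exists x, 0; rewrite scale0r addr0.
  move=> /(_ z) h; apply: zn; exists z, 0; split; rewrite ?sm0 ?addr0 //.
  by apply/inC/h; exists 0, 1; rewrite scale1r add0r.
split.
- by move=> y [x [a [Ax ->]]]; rewrite smD ?smZ //; exact: (AZ).
- move=> b y y' [x [a [Ax ->]]] [x' [a' [Ax' ->]]].
  exists (b *: x + x'), (b * a + a'); split; first exact: (AL).
  by rewrite scalerDr addrACA scalerA scalerDl.
- move=> y [x [a [Ax ->]]]; have [t tP ->] := Ag _ Ax.
  exists (rcons t (i, a *: z)); last by rewrite -cats1 big_cat big_seq1.
  move=> u; rewrite mem_rcons inE => /orP[/eqP -> /=|/tP[h1 h2]].
    by split; [exact: smZ|exists 0, a; rewrite add0r].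
  by split=> //; exists u.2, 0; rewrite scale0r addr0.
move=> y [x [a [Ax ->]]] yK.
have [a0|a0] := eqVneq a 0.
  by move: yK; rewrite a0 scale0r addr0; exact: (AK).
exfalso; apply: zn; exists (- (a^-1 *: x)), (a^-1 *: (x + a *: z)); split.
- by rewrite smN // smZ //; apply/inC.
- exact: smZ.
- by rewrite scalerDr scalerA mulVf // scale1r addrA addNr add0r.
Qed.

(** The components in degree n of a decomposition of an element of degree n. *)
Lemma hom_sum_split (C : gsub V) n z c u : z \in @gpart _ _ V n ->
  c \in C -> u \in K -> z = c + u -> exists c' u',
  [/\ c' \in C, c' \in @gpart _ _ V n, u' \in K, u' \in @gpart _ _ V n & z = c' + u'].
Proof.
move=> zn cC uK zE.
have [s [f [us fV cE]]] := homsum_uniq (gmod_sum c).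
have [t [g [ut gV uE]]] := homsum_uniq (gmod_sum u).
pose w := undup (s ++ t).
have uw : uniq w by exact: undup_uniq.
have sw : {subset s <= w} by move=> j js; rewrite mem_undup mem_cat js.
have tw' : {subset t <= w} by move=> j js; rewrite mem_undup mem_cat js orbT.
pose f' j := if j \in s then f j else 0; pose g' j := if j \in t then g j else 0.
have f'V j : f' j \in gpart j by rewrite /f'; case: ifP => _; rewrite ?sm0.
have g'V j : g' j \in gpart j by rewrite /g'; case: ifP => _; rewrite ?sm0.
have f'C j : f' j \in C.
  rewrite /f'; case: ifP => js; last exact: sm0.
  by apply: (gsub_comp us fV) js; rewrite -cE.
have g'K j : g' j \in K.
  rewrite /g'; case: ifP => js; last exact: sm0.
  by apply: (gsub_comp ut gV) js; rewrite -uE.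
have zE' : z = \sum_(j <- w) (f' j + g' j).
  rewrite big_split /= -(sub_widen (gpart 0) f us uw sw) -(sub_widen (gpart 0) g ut uw tw').
  by rewrite -cE -uE.
have fgV j : f' j + g' j \in gpart j by rewrite smD.
have := hom_comp uw fgV; rewrite -zE' => /(_ _ zn) ->.
case: ifP => _; first by exists (f' n), (g' n).
by exists 0, 0; rewrite !sm0 addr0.
Qed.
End Complements.

Section Contraction.
Variables (k : fieldType) (V : bgmod k) (d : hlin V V).
Hypothesis dd : forall x, d (d x) = 0.
Local Notation H := (coh d).
Local Notation cl := (cls (gker d) (gim d)).
Variables C1 C2 : gsub V.
Hypothesis C1Z : forall x, x \in C1 -> x \in gker d.
Hypothesis C1B : forall x, x \in C1 -> x \in gim d -> x = 0.
Hypothesis C1P : forall z, z \in gker d ->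
  exists c u, [/\ c \in C1, u \in gim d & z = c + u].
Hypothesis C2Z : forall x, x \in C2 -> x \in gker d -> x = 0.
Hypothesis C2P : forall z, z \in gfull V ->
  exists c u, [/\ c \in C2, u \in gker d & z = c + u].

Let C1d x : x \in C1 -> d x = 0. Proof. by move=> /C1Z/gkerP. Qed.
Let imd x : d x \in gim d. Proof. by apply/gimP; exists x. Qed.
Let imker x : x \in gim d -> x \in gker d.
Proof. by move=> /gimP[y ->]; apply/gkerP. Qed.

(** With C1 a complement of the boundaries in the cycles and C2 one of the cycles,
    each v is d y + x + z for unique x in C1 and y, z in C2, as in Hodge theory:
    x represents the cohomological part of v, and v |-> y is the homotopy. *)
Definition hodge (v y x z : V) : Prop :=
  [/\ y \in C2, x \in C1, z \in C2 & v = d y + x + z].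

Lemma hodge_exists n v : v \in @gpart _ _ V n -> exists y x z,
  [/\ hodge v y x z, y \in @gpart _ _ V (n - hdeg d), x \in @gpart _ _ V n
    & z \in @gpart _ _ V n].
Proof.
move=> vn; have vf : v \in gfull V by apply/submod_ofP.
have [z0 [u0 [z0C u0Z e0]]] := C2P vf.
have [z [u [zC zn uZ un e]]] := hom_sum_split vn z0C u0Z e0.
have [x0 [w0 [x0C w0B e1]]] := C1P uZ.
have [x [w [xC xn wB wn e2]]] := hom_sum_split un x0C w0B e1.
have [y0 y0n wE] := him wB wn.
have yf : y0 \in gfull V by apply/submod_ofP.
have [y1 [v1 [y1C v1Z e3]]] := C2P yf.
have [y [v' [yC yn v'Z _ e4]]] := hom_sum_split y0n y1C v1Z e3.
exists y, x, z; split=> //; split=> //.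
by rewrite e e2 wE e4 linearD (gkerP _ _ v'Z) addr0; zmodule.
Qed.

Lemma hodge_lin a v y x z v' y' x' z' : hodge v y x z -> hodge v' y' x' z' ->
  hodge (a *: v + v') (a *: y + y') (a *: x + x') (a *: z + z').
Proof.
move=> [h1 h2 h3 ->] [h1' h2' h3' ->]; split; rewrite ?smD ?smZ //.
by rewrite linearP !scalerDr; zmodule.
Qed.

Lemma hodge_total v : exists y x z, hodge v y x z.
Proof.
have [s sV ->] := gmod_sum v; elim: s sV => [|u s IH] /=.
  by move=> _; exists 0, 0, 0; rewrite big_nil; split; rewrite ?sm0 // linear0 !addr0.
move=> /andP[/hodge_exists[y [x [z [h _ _ _]]]] /IH[y' [x' [z' h']]]].
exists (1 *: y + y'), (1 *: x + x'), (1 *: z + z'); rewrite big_cons.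
by have := hodge_lin 1 h h'; rewrite scale1r.
Qed.

Lemma hodge0 y x z : hodge 0 y x z -> [/\ y = 0, x = 0 & z = 0].
Proof.
move=> [yC xC zC e].
have z0 : z = 0.
  apply: C2Z => //; rewrite (_ : z = - (d y + x)); last first.
    by apply/eqP; rewrite -subr_eq0 opprK addrC -e.
  by apply: smN; apply: smD; [exact: imker|exact: C1Z].
have x0 : x = 0.
  apply: C1B => //; rewrite (_ : x = - d y) ?smN //.
  by apply/eqP; rewrite -subr_eq0 opprK addrC e z0 addr0.
split=> //; apply: C2Z => //; apply/gkerP.
by rewrite e x0 z0 !addr0.
Qed.

Definition section_rel (c : H) (x : V) : Prop := x \in C1 /\ c = cl x.
Definition homotopy_rel (v y : V) : Prop := exists x z, hodge v y x z.
Definition projection_rel (v : V) (c : H) : Prop :=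
  exists y x z, hodge v y x z /\ c = cl x.

Lemma section_functional : functional_rel section_rel.
Proof.
split.
- elim/clsW=> z zZ; have [c [u [cC uB e]]] := C1P zZ; exists c; split=> //.
  by apply/clsP => //; [exact: C1Z|rewrite e addrAC subrr add0r].
- move=> x [xC e]; apply: C1B => //; apply/(@cls_eq0 _ _ (gker d)); first exact: C1Z.
  exact: esym e.
- move=> a c c' x x' [xC ->] [xC' ->]; split; first by rewrite smD ?smZ.
  by rewrite cls_lin ?C1Z.
Qed.

Lemma homotopy_functional : functional_rel homotopy_rel.
Proof.
split.
- by move=> v; have [y [x [z h]]] := hodge_total v; exists y, x, z.
- by move=> y [x [z /hodge0[]]].
- move=> a v v' y y' [x [z h]] [x' [z' h']].
  by exists (a *: x + x'), (a *: z + z'); exact: hodge_lin.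
Qed.

Lemma projection_functional : functional_rel projection_rel.
Proof.
split.
- by move=> v; have [y [x [z h]]] := hodge_total v; exists (cl x), y, x, z.
- by move=> c [y [x [z [/hodge0[_ -> _] ->]]]]; rewrite cls0.
- move=> a v v' c c' [y [x [z [h ->]]]] [y' [x' [z' [h' ->]]]].
  exists (a *: y + y'), (a *: x + x'), (a *: z + z'); split; first exact: hodge_lin.
  by rewrite cls_lin //; apply: C1Z; [case: h|case: h'].
Qed.

Definition hodge_i : {linear H -> V} := lrel section_functional.
Definition hodge_s : {linear V -> V} := lrel homotopy_functional.
Definition hodge_p : {linear V -> H} := lrel projection_functional.

Lemma hodge_sE v y x z : hodge v y x z -> hodge_s v = y.
Proof. by move=> h; apply: lrelE; exists x, z. Qed.
Lemma hodge_pE v y x z : hodge v y x z -> hodge_p v = cl x.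
Proof. by move=> h; apply: lrelE; exists y, x, z. Qed.
Lemma hodge_iE x : x \in C1 -> hodge_i (cl x) = x.
Proof. by move=> xC; apply: lrelE. Qed.
Lemma hodge_iC c : hodge_i c \in C1 /\ cl (hodge_i c) = c.
Proof. by have [h1 h2] := lrel_funP section_functional c. Qed.

Lemma contraction_exists0 : exists (i0 : {linear H -> V}) (s : {linear V -> V})
    (p0 : {linear V -> H}),
  [/\ bihomog 0 i0, bihomog (- hdeg d) s & bihomog 0 p0] /\
  [/\ (forall c, d (i0 c) = 0), (forall c, cl (i0 c) = c),
      (forall c, p0 (i0 c) = c) & forall x, p0 (d x) = 0] /\
  [/\ forall x, s (s x) = 0, forall c, s (i0 c) = 0, forall x, p0 (s x) = 0
    & forall x, i0 (p0 x) + s (d x) + d (s x) = x].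
Proof.
have hC1 x : x \in C1 -> hodge x 0 x 0.
  by move=> xC; split; rewrite ?sm0 // linear0 add0r addr0.
have hC2 x : x \in C2 -> hodge x 0 0 x.
  by move=> xC; split; rewrite ?sm0 // linear0 !add0r.
have sC v : hodge_s v \in C2.
  by have [y [x [z h]]] := hodge_total v; rewrite (hodge_sE h); case: h.
have hd v y x z : hodge v y x z -> hodge (d v) z 0 0.
  move=> [yC xC zC ->]; split; rewrite ?sm0 //.
  by rewrite !linearD dd (C1d xC) !add0r !addr0.
exists hodge_i, hodge_s, hodge_p; split; last split.
- split=> n.
  + move=> c cn; rewrite addr0; have /submod_ofP[z [zn zZ ->]] := cn.
    have [c0 [u0 [c0C u0B e0]]] := C1P zZ.
    have [x [u [xC xn uB un e]]] := hom_sum_split zn c0C u0B e0.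
    rewrite (_ : cl z = cl x) ?hodge_iE //; apply/clsP => //; first exact: C1Z.
    by rewrite e addrAC subrr add0r.
  + by move=> v /hodge_exists[y [x [z [h yn _ _]]]]; rewrite (hodge_sE h).
  + move=> v /hodge_exists[y [x [z [h _ xn _]]]]; rewrite (hodge_pE h) addr0.
    by apply/submod_ofP; exists x; split=> //; apply: C1Z; case: h.
- split=> x.
  + by apply: C1d; case: (hodge_iC x).
  + by case: (hodge_iC x).
  + by have [h1 h2] := hodge_iC x; rewrite (hodge_pE (hC1 _ h1)).
  + by have [y [w [z h]]] := hodge_total x; rewrite (hodge_pE (hd _ _ _ _ h)) cls0.
- split=> x.
  + by rewrite (hodge_sE (hC2 _ (sC x))).
  + by have [h1 h2] := hodge_iC x; rewrite (hodge_sE (hC1 _ h1)).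
  + by rewrite (hodge_pE (hC2 _ (sC x))) cls0.
  + have [y [w [z h]]] := hodge_total x.
    rewrite (hodge_pE h) (hodge_sE h) (hodge_sE (hd _ _ _ _ h)).
    have [_ wC _ ->] := h; rewrite hodge_iE //; zmodule.
Qed.
End Contraction.

Lemma contraction_exists (k : fieldType) (V : bgmod k) (d : hlin V V) (H := coh d) :
  (forall x, d (d x) = 0) ->
  exists (i0 : {linear H -> V}) (s : {linear V -> V}) (p0 : {linear V -> H}),
  [/\ bihomog 0 i0, bihomog (- hdeg d) s & bihomog 0 p0] /\
  [/\ (forall c, d (i0 c) = 0), (forall c, hcls d (i0 c) = c),
      (forall c, p0 (i0 c) = c) & forall x, p0 (d x) = 0] /\
  [/\ forall x, s (s x) = 0, forall c, s (i0 c) = 0, forall x, p0 (s x) = 0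
    & forall x, i0 (p0 x) + s (d x) + d (s x) = x].
Proof.
move=> dd; have [C1 [h1 h2 h3]] := complement_exists (gker d) (gim d).
have [C2 [_ h4 h5]] := complement_exists (gfull V) (gker d).
exact: (contraction_exists0 dd h1 h2 h3 h4 h5).
Qed.

(** The inverse of the restriction of q to a graded complement of its kernel. *)
Lemma section_exists (k : fieldType) (V W : bgmod k) (q : hlin V W) :
  hdeg q = 0 -> (forall w, exists v, w = q v) ->
  exists s : {linear W -> V}, bihomog 0 s /\ forall w, q (s w) = w.
Proof.
move=> q0 qs; have [C [_ CK CP]] := complement_exists (gfull V) (gker q).
have Cs v : exists c u, [/\ c \in C, u \in gker q & v = c + u].
  by apply: CP; apply/submod_ofP.
pose rel (w : W) (v : V) := v \in C /\ w = q v.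
have relF : functional_rel rel.
  split.
  - move=> w; have [v ->] := qs w; have [c [u [cC /gkerP qu ->]]] := Cs v.
    by exists c; split=> //; rewrite linearD qu addr0.
  - by move=> v [vC e]; apply: CK => //; apply/gkerP.
  - move=> a w w' v v' [vC ->] [vC' ->]; split; last by rewrite linearP.
    by rewrite smD ?smZ.
exists (lrel relF); split; last by move=> w; have [_ <-] := lrel_funP relF w.
move=> n w wn; have wi : w \in gim q by apply/gimP; exact: qs.
have [v vn ->] := him wi wn; rewrite q0 subr0 in vn.
have [c0 [u0 [c0C u0K e0]]] := Cs v.
have [c [u [cC cn uK un ->]]] := hom_sum_split vn c0C u0K e0.
by rewrite addr0 linearD (gkerP _ _ uK) addr0 (lrelE relF (w := c)).
Qed.

(** * Bigraded power series *)

Section HserTheory.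
Variable k : fieldType.
Implicit Types V W : bgmod k.

Lemma hser_ext V (f g : hser V) : (forall r, hcoef r f = hcoef r g) -> f = g.
Proof. by move=> h; apply: val_inj; apply/funext => r; exact: h. Qed.

Lemma hcoef0_hbar V (f : hser V) : hcoef 0 (hbar f) = 0. Proof. by []. Qed.
Lemma hcoefS_hbar V r (f : hser V) : hcoef r.+1 (hbar f) = hcoef r f.
Proof. by []. Qed.
Lemma hcoef_hbar_inv V r (f : hser V) : hcoef r (hbar_inv f) = hcoef r.+1 f.
Proof. by []. Qed.
Lemma hcoef0_const V (b : V) : hcoef 0 (hconst b) = b. Proof. by []. Qed.

Lemma hbar_inj V : injective (@hbar k V). Proof. exact: can_inj (@hbarK k V). Qed.

Lemma hbar_invK V (f : hser V) : hcoef 0 f = 0 -> hbar (hbar_inv f) = f.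
Proof. by move=> f0; apply: hser_ext => -[|r] //; rewrite f0. Qed.

Lemma hser_split V (f : hser V) : f = hconst (hcoef 0 f) + hbar (hbar_inv f).
Proof.
apply: hser_ext => r; rewrite linearD.
by case: r => [|r]; rewrite ?hcoef0_const ?hcoef0_hbar ?addr0 // hcoefS_hbar /= add0r.
Qed.

Lemma iter_hbar0 V n (f : hser V) r : (r < n)%N -> hcoef r (iter n hbar f) = 0.
Proof. by elim: n r => // n IH [|r] //= h; rewrite -(IH r). Qed.

Lemma hbarX_eq0 V (f : hser V) : (forall n, in_hbarX n.+1 f) -> f = 0.
Proof.
move=> h; apply: hser_ext => r; have [g ->] := h r.
by rewrite iter_hbar0 // linear0.
Qed.

Lemma hbarX0 V n : in_hbarX n (0 : hser V).
Proof. by exists 0; elim: n => //= n <-; rewrite linear0. Qed.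

(** Applied to defects of equations, which need only be shown to be h times a
    defect at another point. *)
Lemma hbar_divisible V W (f : hser V -> hser W) :
  (forall x, exists y, f x = hbar (f y)) -> forall x, f x = 0.
Proof.
move=> h x; apply: hser_ext => r; rewrite linear0.
by elim: r x => [|r IH] x; have [y ->] := h x; rewrite ?hcoefS_hbar ?IH.
Qed.

Lemma hbar_hom V : bihomog (-1, 1) (@hbar k V).
Proof. by move=> i x xi; exact: (hlinP hbar xi). Qed.

Lemma hbar_tau V (x : hser V) : hbar (tau x) = tau (hbar x).
Proof.
rewrite (tau_comm x (linearP hbar) (@hbar_hom V)).
by rewrite (_ : tot _ = 0) // scale1r.
Qed.

Lemma hcoef0_hom V : bihomog 0 (@hcoef k V 0).
Proof. by move=> i x /(@hcoef_hom _ _ 0%N); congr (_ \in gpart _); rewrite oppr0. Qed.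

Definition hcomm V W (f : hser V -> hser W) := forall x, f (hbar x) = hbar (f x).

(** An element is its constant term plus a multiple of h, so the difference of f
    and g is divisible by every power of h. *)
Lemma hcomm_eq V W (f g : hser V -> hser W) : linear f -> linear g ->
  hcomm f -> hcomm g -> (forall v, f (hconst v) = g (hconst v)) -> f =1 g.
Proof.
move=> fL gL fh gh e x; apply/eqP; rewrite -subr_eq0; apply/eqP.
apply: (hbar_divisible (f := fun x => f x - g x)) => {}x.
exists (hbar_inv x).
rewrite {1 2}(hser_split x) (lin_add fL) (lin_add gL) e fh gh linearB.
by zmodule.
Qed.

Section Extension.
Variables (V W : bgmod k) (phi : {linear V -> W}) (c : Z2).
Hypothesis phiH : bihomog c phi.

Definition hpost (f : nat -> V) : nat -> W := fun r => phi (f r).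
Lemma hpost_linear : linear hpost.
Proof. by move=> a f g; apply/funext => r; exact: linearP. Qed.
Lemma hpostP i f : f \in hser_part V i -> mklin hpost_linear f \in hser_part W (i + c).
Proof.
move=> /submod_ofP fP; apply/submod_ofP => r.
by have := phiH (fP r); congr (_ \in gpart _); apply: Z2_eq => /=; ring.
Qed.

(** The k[h]-linear extension of a map. *)
Definition hext : hlin (hser V) (hser W) := dmap (@hser_indep k V) (@hser_indep k W) hpostP.

Lemma hcoef_hext r f : hcoef r (hext f) = phi (hcoef r f). Proof. by []. Qed.
Lemma hext_comm : hcomm hext.
Proof.
move=> f; apply: hser_ext => -[|r]; rewrite hcoef_hext ?hcoefS_hbar //.
by rewrite !hcoef0_hbar linear0.
Qed.
Lemma hext_hom : bihomog c hext. Proof. by move=> i x xi; exact: (hlinP hext xi). Qed.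
End Extension.

Section AdicExpansion.
Variables (R V : bgmod k) (h : hlin R R) (q : {linear R -> V}) (sec : {linear V -> R}).
Hypotheses (hd : hdeg h = (-1, 1)) (h_inj : injective h).
Hypotheses (qH : bihomog 0 q) (secH : bihomog 0 sec) (secK : forall v, q (sec v) = v).
Hypothesis qh : forall x, q (h x) = 0.
Hypothesis hq : forall x, q x = 0 -> exists y, x = h y.

(** The graph of a |-> h^(-1) (a - sec (q a)). *)
Definition digit_rel (a b : R) : Prop := a = sec (q a) + h b.

Lemma digit_functional : functional_rel digit_rel.
Proof.
split.
- move=> a; have [b e] : exists b, a - sec (q a) = h b.
    by apply: hq; rewrite linearB secK subrr.
  by exists b; rewrite /digit_rel -e addrC subrK.
- move=> b; rewrite /digit_rel !linear0 add0r => e; apply: h_inj.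
  by rewrite linear0.
- move=> a v v' w w' e e'; rewrite /digit_rel {1}e {1}e' !linearP scalerDr.
  by zmodule.
Qed.

(** This removes the digit q a of the h-adic expansion of a and shifts the
    others, so that the digit of index r is q (digit^r a). *)
Definition digit : {linear R -> R} := lrel digit_functional.

Lemma digitP a : a = sec (q a) + h (digit a).
Proof. exact: (lrel_funP digit_functional a). Qed.

Lemma digit_hom : bihomog (1, -1) digit.
Proof.
move=> i a ai; have sa : sec (q a) \in gpart i.
  by have := secH (qH ai); rewrite !addr0.
have := smB ai sa; rewrite {1}(digitP a) addrAC subrr add0r => hi.
have /him /(_ hi)[x xi e] : h (digit a) \in gim h by apply/gimP; exists (digit a).
rewrite (h_inj e); move: xi; rewrite hd; congr (_ \in gpart _).
Qed.

Lemma digitE v b : digit (sec v + h b) = b.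
Proof. by apply: lrelE; rewrite /digit_rel linearD secK qh addr0. Qed.

Lemma digit_h a : digit (h a) = a.
Proof.
by apply: h_inj; have := digitP (h a); rewrite qh linear0 add0r => <-.
Qed.

Lemma digit_sec v : digit (sec v) = 0.
Proof.
apply: h_inj; rewrite linear0; have := digitP (sec v); rewrite secK => e.
by apply: (addrI (sec v)); rewrite -e addr0.
Qed.

Definition expansion_fun (a : R) : nat -> V := fun r => q (iter r digit a).

Lemma iter_digit_linear r : linear (iter r digit).
Proof. by move=> a x y; elim: r => //= r ->; rewrite linearP. Qed.

Lemma expansion_fun_linear : linear expansion_fun.
Proof.
move=> a x y; apply/funext => r; rewrite /expansion_fun iter_digit_linear.
exact: linearP.
Qed.

Lemma expansion_part i a : a \in gpart i -> expansion_fun a \in hser_part V i.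
Proof.
move=> ai; apply/submod_ofP => r.
have : iter r digit a \in gpart (i.1 + r%:Z, i.2 - r%:Z).
  elim: r => [|r IH]; first by rewrite addr0 subr0; case: (i) ai.
  have := digit_hom IH; congr (_ \in gpart _).
  by apply: Z2_eq; rewrite /= intS; ring.
by move=> /qH; rewrite addr0.
Qed.

Lemma expansion_span a : expansion_fun a \in dspan (hser_part V).
Proof.
have [s sV ->] := gmod_sum a.
rewrite [expansion_fun _](linear_sum (mklin expansion_fun_linear)) big_seq.
apply: rpred_sum => p /(allP sV)/expansion_part h'.
by apply/submod_ofP; exact: homsum_hom h'.
Qed.

Definition expansion_map (a : R) : hser V := Subm (expansion_span a).
Lemma expansion_linear : linear expansion_map.
Proof. by move=> a x y; apply: val_inj; exact: expansion_fun_linear. Qed.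
Lemma expansion_map_hom i a : a \in gpart i ->
  mklin expansion_linear a \in @gpart _ _ (hser V) (i + 0).
Proof. by move=> ai; rewrite addr0; apply/submod_ofP; exact: expansion_part. Qed.

(** R with its h-adic expansions: a k[h]-linear map which sends sec v to the
    constant series v. *)
Definition expansion : hlin R (hser V) := Hlin expansion_map_hom.

Lemma hcoef_expansion r a : hcoef r (expansion a) = q (iter r digit a).
Proof. by []. Qed.

Lemma expansion_h a : expansion (h a) = hbar (expansion a).
Proof.
apply: hser_ext => -[|r]; first by rewrite hcoef_expansion hcoef0_hbar /= qh.
by rewrite hcoefS_hbar !hcoef_expansion iterSr digit_h.
Qed.

Lemma expansion_sec v : expansion (sec v) = hconst v.
Proof.
apply: hser_ext => -[|r]; first by rewrite hcoef_expansion hcoef0_const /= secK.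
rewrite hcoef_expansion iterSr digit_sec (_ : iter r digit 0 = 0) ?linear0 //.
by elim: r => //= r ->; rewrite linear0.
Qed.

(** An element whose digits are zero is divisible by every power of h. *)
Lemma expansion_remainder a n : expansion a = 0 -> a = iter n h (iter n digit a).
Proof.
move=> e; elim: n => //= n IH; rewrite -iterS iterSr {1}IH; congr (iter n h _).
rewrite {1}(digitP (iter n digit a)) -hcoef_expansion e [hcoef _ _]linear0.
by rewrite linear0 add0r.
Qed.
End AdicExpansion.

Section Geometric.
Variables (V : bgmod k) (X : {linear hser V -> hser V}).
Hypotheses (XH : bihomog 0 X) (Xh : hcomm X) (X0 : forall f, hcoef 0 (X f) = 0).

(** The elements (1 + X) v, for v constant, reduce to v modulo h, so every series
    has an h-adic expansion with digits of this form.  Replacing its digits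
    (1 + X) v by v is the inverse of 1 + X.  It is also the geometric series
    sum_n (-X)^n. *)
Lemma one_plus_inverse : exists L : {linear hser V -> hser V},
  [/\ bihomog 0 L, hcomm L, forall f, L (f + X f) = f & forall f, L f + X (L f) = f].
Proof.
pose T f := f + X f.
have TL : linear T by move=> a f g; rewrite /T linearP scalerDr; zmodule.
have Th : hcomm T by move=> f; rewrite /T Xh linearD.
have secL : linear (fun v => T (hconst v)) by move=> a v w; rewrite linearP TL.
pose sec := mklin secL.
have secH : bihomog 0 sec.
  move=> i v vi; have ci := hconst_hom vi; rewrite addr0.
  by apply: smD => //; have := XH ci; rewrite addr0.
have secK v : hcoef 0 (sec v) = v.
  by rewrite [LHS]linearD X0 addr0 hcoef0_const.
have hq (f : hser V) : hcoef 0 f = 0 -> exists g, f = hbar g.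
  by move=> f0; exists (hbar_inv f); rewrite hbar_invK.
pose L := expansion (h := hbar) erefl (@hbar_inj V) (@hcoef0_hom V) secH secK hq.
have Lh : hcomm L by move=> f; exact: expansion_h.
exists L; split=> //.
- by move=> i f fi; exact: (hlinP L fi).
- apply: (hcomm_eq (f := fun f => L (T f)) (g := id)) => //.
  + by move=> a f g; rewrite TL linearP.
  + by move=> f; rewrite Th Lh.
  + by move=> v; exact: expansion_sec.
move=> f; apply/eqP; rewrite -subr_eq0; apply/eqP.
apply: (hbar_divisible (f := fun f => L f + X (L f) - f)) => {}f.
exists (digit (h := hbar) (@hbar_inj V) secK hq f).
set g := digit _ _ _ f.
have fE : f = T (hconst (hcoef 0 f)) + hbar g.
  exact: (digitP (h := hbar) (@hbar_inj V) secK hq f).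
have Lf : L f = hconst (hcoef 0 f) + hbar (L g).
  by rewrite {1}fE linearD -Lh; congr (_ + _); exact: expansion_sec.
rewrite Lf linearD Xh [X in _ - X]fE /T linearB [hbar (L g + _)]linearD.
by zmodule.
Qed.
End Geometric.
End HserTheory.

(** * Change of modules, and reduction modulo h *)

Section Functoriality.
Variables (k : fieldType) (I : zmodType) (tdeg : I -> int).
Variables (V V' W W' : lmodType k).
Variables (phi : {linear W -> W'}) (psi : V -> V').

Lemma insertion_sum_map (f : seq V -> W) (f' : seq V' -> W')
    (m : seq V -> V) (m' : seq V' -> V') ds xs :
  (forall ys, phi (f ys) = f' (map psi ys)) ->
  (forall ys, psi (m ys) = m' (map psi ys)) ->
  phi (insertion_sum tdeg f m ds xs) = insertion_sum tdeg f' m' ds (map psi xs).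
Proof.
move=> fE mE; rewrite /insertion_sum size_map linear_sum; apply: eq_bigr => r _.
rewrite linear_sum; apply: eq_bigr => s _; rewrite linearZ /= fE.
by rewrite map_cat /= mE !map_take !map_drop.
Qed.

Lemma block_sum_map (f : seq V -> W) (f' : seq V' -> W')
    (m : seq W -> W) (m' : seq W' -> W') ds xs :
  (forall ys, phi (f ys) = f' (map psi ys)) ->
  (forall ys, phi (m ys) = m' (map phi ys)) ->
  phi (block_sum tdeg m f ds xs) = block_sum tdeg m' f' ds (map psi xs).
Proof.
move=> fE mE; rewrite /block_sum size_map linear_sum; apply: eq_bigr => q _.
rewrite linear_sum; apply: eq_bigr => c _; rewrite linearZ /= mE -map_comp.
rewrite -map_reshape -map_comp; congr (_ *: m' _); apply: eq_map => ys /=.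
exact: fE.
Qed.
End Functoriality.

Section Reduction.
Variable k : fieldType.
Implicit Types V W : bgmod k.

Lemma hconst_homog V ds (xs : seq V) :
  homog (@gpart _ _ V) ds xs -> homog (@gpart _ _ (hser V)) ds (map hconst xs).
Proof.
elim: xs ds => [|x xs IH] [|d ds] //; rewrite /homog /= => /andP[xd /IH hx].
by apply/andP; split=> //; exact: hconst_hom.
Qed.

(** Replacing an argument by its constant term changes the value by a multiple
    of h. *)
Lemma reduce_const V W (f : seq (hser V) -> hser W) xs :
  multilinear f -> hbar_linear f ->
  hcoef 0 (f xs) = hcoef 0 (f (map hconst (map (hcoef 0) xs))).
Proof.
move=> fL fh.
suff: forall l, hcoef 0 (f (l ++ xs))
    = hcoef 0 (f (l ++ map hconst (map (hcoef 0) xs))).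
  by move=> /(_ [::]).
elim: xs => [|x xs IH] l //=.
rewrite {1}(hser_split x) (maddP (multilinear_add fL)) linearD fh hcoef0_hbar addr0.
by rewrite -cat_rcons IH cat_rcons.
Qed.

Section Reduce.
Variables (V W : bgmod k) (dg : nat -> Z2) (f : gmulti (hser V) (hser W) dg).

Definition reduce_fun (xs : seq V) : W := hcoef 0 (f (map hconst xs)).
Lemma reduce_fun0 : reduce_fun [::] = 0.
Proof. by rewrite /reduce_fun gmulti0 linear0. Qed.
Lemma reduce_linear : multilinear reduce_fun.
Proof.
by move=> l r a x y; rewrite /reduce_fun !map_cat /= linearP (gmultiL f) linearP.
Qed.
Lemma reduce_homog : multihomog (@gpart _ _ V) (@gpart _ _ W) dg reduce_fun.
Proof.
move=> ds xs /hconst_homog/(gmultiP f)/hcoef0_hom.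
by rewrite addr0 size_map.
Qed.

Definition reduce : gmulti V W dg := Gmulti reduce_fun0 reduce_linear reduce_homog.

Lemma reduceE xs : reduce xs = hcoef 0 (f (map hconst xs)). Proof. by []. Qed.

Lemma reduceP : hbar_linear f -> reduces_to f reduce.
Proof. by move=> fh xs; rewrite reduce_const //; exact: gmultiL. Qed.
End Reduce.

Lemma map_hconstK V (xs : seq V) : map (hcoef 0) (map hconst xs) = xs.
Proof. by rewrite -map_comp map_id_in. Qed.

Lemma reduced_Ainf V (m : seq V -> V) (tm : seq (hser V) -> hser V) :
  reduces_to tm m ->
  (forall ds xs, homog (@gpart _ _ (hser V)) ds xs -> stasheff tot tm ds xs = 0) ->
  is_bAinf V m.
Proof.
move=> red tmA ds xs hx; rewrite -(map_hconstK xs) /stasheff.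
rewrite -(insertion_sum_map tot ds _ red red).
by rewrite [insertion_sum _ _ _ _ _](tmA _ _ (hconst_homog hx)) linear0.
Qed.

Lemma reduced_morphism V W (mV : seq V -> V) (tmV : seq (hser V) -> hser V)
    (mW : seq W -> W) (tmW : seq (hser W) -> hser W)
    (f : seq V -> W) (tf : seq (hser V) -> hser W) :
  reduces_to tmV mV -> reduces_to tmW mW -> reduces_to tf f ->
  is_Ainf_morphism tot (@gpart _ _ (hser V)) tmV tmW tf ->
  is_Ainf_morphism tot (@gpart _ _ V) mV mW f.
Proof.
move=> redV redW redf tfA ds xs hx; rewrite -(map_hconstK xs).
rewrite -(insertion_sum_map tot ds _ redf redV) -(block_sum_map tot ds _ redf redW).
by rewrite (tfA _ _ (hconst_homog hx)).
Qed.

(** The identities modulo all powers of h are identities, as no nonzero series is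
    divisible by every power of h. *)
Lemma deformation_Ainf V (m : seq V -> V) (tm : seq (hser V) -> hser V) :
  is_deformation m tm -> is_bAinf (hser V) tm.
Proof. by case=> _ tmA _ ds xs hx; apply: hbarX_eq0 => n; exact: tmA. Qed.

Lemma Ainf_deformation V (m : seq V -> V) (tm : seq (hser V) -> hser V) :
  hbar_linear tm -> is_bAinf (hser V) tm -> reduces_to tm m -> is_deformation m tm.
Proof. by move=> h tmA red; split=> // n ds xs /tmA ->; exact: hbarX0. Qed.
End Reduction.

(** * Leibniz rule and associativity *)

Section LowIdentities.
Variables (k : fieldType) (s : nat) (V : bgmod k) (m : gmulti V V (alg_deg s)).
Hypothesis mA : is_bAinf V m.
Local Notation d x := (m [:: x]).

Let mL : multilinear m := gmultiL m.
Let mD := multilinear_add mL.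
Let m0 := gmulti0 m.
Let dH : bihomog (alg_deg s 1) (fun x => m [:: x]).
Proof. by move=> i x; exact: (hlinP (arity1 m)). Qed.

Lemma m1_linear : linear (fun x => m [:: x]). Proof. exact: arity1_linear. Qed.

Lemma m1_tau x : d (tau x) = - tau (d x).
Proof.
rewrite (tau_comm x m1_linear dH) tot_alg_deg.
by rewrite (_ : 2 - 1%:Z = 1) // ksign1 scaleN1r.
Qed.

Let tauN x : tau (- x) = - tau x :> V. Proof. exact: linearN. Qed.
Let dN x : d (- x) = - d x. Proof. exact: (maddN mD [::] [::]). Qed.

Lemma m1_square x : d (d x) = 0.
Proof.
have := Ainf_ins [:: x] mA; rewrite /ins split_cons !split_nil split_cons split_nil /=.
by rewrite m0 linear0 (madd0 mD [::]) (madd0 mD [:: _]) add0r addr0.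
Qed.

Lemma m2_leibniz x y : d (m [:: x; y]) = m [:: d x; y] + m [:: tau x; d y].
Proof.
have := Ainf_ins [:: tau x; y] mA.
rewrite /ins !(split_cons, split_nil) /= m0 !linear0 /= tauK.
rewrite !(madd0 mD [::]) !(madd0 mD [:: _]) !(madd0 mD [:: _; _]) !addr0 !add0r.
rewrite m1_tau /stau tauK !tauN tauK !(maddN mD [::]) => e.
apply/eqP; rewrite -subr_eq0 -[X in _ == X]e; apply/eqP.
zmodule.
Qed.

Hypothesis m3 : forall x y z, m [:: x; y; z] = 0.

Lemma m2_tau x y : m [:: tau x; tau y] = tau (m [:: x; y]).
Proof.
apply/eqP; rewrite -subr_eq0; apply/eqP.
pose F (xs : seq V) := if xs is [:: x; y] then m [:: tau x; tau y] - tau (m [:: x; y]) else 0.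
rewrite -[LHS]/(F [:: x; y]); apply: homog_ext [:: x; y] => [l r a u v ->|ds xs].
  case: l r => [|w [|w' l]] [|w1 [|w2 r]] /=; rewrite ?addr0 //.
  - rewrite linearD !(maddP mD [::]) linearD; zmodule.
  - rewrite linearD !(maddP mD [:: _]) linearD; zmodule.
  - by case: l => *; rewrite /= addr0.
  - by case: l => *; rewrite /= addr0.
  - by case: l => *; rewrite /= addr0.
case: xs ds => [|u [|v [|w xs]]] [|i [|j [|l ds]]] //; rewrite /homog /= ?andbF //.
move=> /and3P[ui vj _].
have := @gmultiP _ _ _ _ _ m [:: i; j] [:: u; v]; rewrite /homog /= ui vj => /(_ isT) h.
rewrite (tauE h) (tauE ui) (tauE vj) (multilinearZ [::] [:: _]) //.
rewrite (multilinearZ [:: u] [::]) // ksign_scale_comp -scalerBl.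
by rewrite totD tot_alg_deg subrr addr0 big_cons big_seq1 totD subrr scale0r.
Qed.

Lemma m2_assoc x y z : m [:: m [:: x; y]; z] = m [:: x; m [:: y; z]].
Proof.
have := Ainf_ins [:: x; tau y; z] mA.
rewrite /ins !(split_cons, split_nil) /= m0 !m3 !linear0 /=.
rewrite !(madd0 mD [::]) !(madd0 mD [:: _]) (madd0 mD [:: _; _]) (madd0 mD [:: _; _; _]).
rewrite !addr0 !add0r.
rewrite -m2_tau !tauK /stau !tauN tauK (maddN mD [::] [:: _]) /=.
by move=> /eqP; rewrite subr_eq0 => /eqP.
Qed.
End LowIdentities.

(** * Passage to the next page *)

Section Step.
Variables (k : fieldType) (s : nat) (V : bgmod k).
Variables (m : gmulti V V (alg_deg s)) (tm : gmulti (hser V) (hser V) (alg_deg s)).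
Hypothesis def : is_deformation m tm.
Hypothesis m1 : forall x, m [:: x] = 0.

Let tmA := deformation_Ainf def.
Let tmh : hbar_linear tm. Proof. by case: def. Qed.
Let red : reduces_to tm m. Proof. by case: def. Qed.

Let tm1 x : hcoef 0 (tm [:: x]) = 0. Proof. by rewrite red m1. Qed.

Let iterh_comm n (x : hser V) : iter n hbar (hbar x) = hbar (iter n hbar x).
Proof. by rewrite -iterSr. Qed.

(* Multiplied by h^2, the operation h^(n-2) tm_n becomes h^n tm_n, also for n = 1.
   As h is injective, identities may be checked after multiplication by h. *)
Let T_hh xs : iter 2 hbar (T_alg tm xs) = iter (size xs) hbar (tm xs).
Proof.
rewrite /= /T_fun; case: xs => [|x [|y xs]] /=.
- by rewrite gmulti0 !linear0.
- by rewrite hbar_invK.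
- by rewrite !subSS subn0.
Qed.

Let tm_iter l r n x : tm (l ++ iter n hbar x :: r) = iter n hbar (tm (l ++ x :: r)).
Proof. by elim: n => //= n IH; rewrite tmh IH. Qed.

Lemma T_hbar : hbar_linear (T_alg tm).
Proof.
move=> l r x; apply: hbar_inj; apply: hbar_inj.
rewrite -[LHS]/(iter 2 hbar _) T_hh tmh.
rewrite -[RHS]/(hbar (iter 2 hbar _)) T_hh -iterh_comm !size_cat /=.
by [].
Qed.

(** Each term of the n-th Stasheff identity contains operations with s and
    n + 1 - s arguments, so h^4 times the identity of the rescaled operations is
    h^(n+1) times that of tm. *)
Lemma T_Ainf : is_bAinf (hser V) (T_alg tm).
Proof.
move=> ds xs hx; do 4 apply: hbar_inj; rewrite !linear0.
rewrite -[LHS]/(iter 4 hbar _).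
rewrite (_ : iter 4 hbar _ = iter (size xs).+1 hbar (stasheff tot tm ds xs)); last first.
  have iter_sum (n : nat) (J : finType) (P : pred J) (F : J -> hser V) :
     iter n hbar (\sum_(j | P j) F j) = \sum_(j | P j) iter n hbar (F j).
    by elim: n => //= n ->; rewrite linear_sum.
  have iterZ' n a (x : hser V) : iter n hbar (a *: x) = a *: iter n hbar x.
    by elim: n => //= n ->; rewrite linearZ.
  rewrite /stasheff /insertion_sum !iter_sum; apply: eq_bigr => r _.
  rewrite !iter_sum; apply: eq_bigr => t /andP[t0 rt]; rewrite !iterZ'; congr (_ *: _).
  set A := take r xs; set B := take t (drop r xs); set C := drop (r + t) xs.
  have sB : size B = t by rewrite size_takel // size_drop; lia.
  have sA : size A = r by rewrite size_takel //; have := ltn_ord r; lia.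
  have sC : size C = (size xs - (r + t))%N by rewrite size_drop.
  rewrite -[LHS]/(iter 2 hbar (iter 2 hbar (T_alg tm _))) T_hh -iterD addnC iterD.
  rewrite -tm_iter T_hh sB tm_iter -iterD; congr (iter _ hbar _).
  rewrite size_cat /= sA sC addnS addSn; congr _.+1.
  by rewrite -addnA addnC -addnA [(t + r)%N]addnC subnK.
by rewrite (tmA hx); elim: (size xs).+1 => //= n ->; rewrite linear0.
Qed.

(** As tm_1 vanishes modulo h on constants, h^(-1) tm_1 reduces to its coefficient
    of h.  For n > 2 the operation h^(n-2) tm_n is a multiple of h. *)
Lemma T_reduces : reduces_to (T_alg tm) (P_alg m tm).
Proof.
move=> xs; rewrite /= /T_fun /P_fun; case: xs => [|x [|y [|z xs]]] /=.
- by rewrite gmulti0.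
- rewrite hcoef_hbar_inv {1}(hser_split x) (maddP (multilinear_add (gmultiL tm)) [::] [::]).
  by rewrite linearD (tmh [::] [::]) hcoefS_hbar tm1 addr0.
- exact: red.
- by [].
Qed.

Lemma PT_is_deform : is_deform (PT m tm).
Proof.
split; first exact: reduced_Ainf T_reduces T_Ainf.
by apply: Ainf_deformation; [exact: T_hbar|exact: T_Ainf|exact: T_reduces].
Qed.
End Step.

(** * Existence of deformed minimal models *)

Lemma bihomog_comp (k : fieldType) (U V W : bgmod k) (f : U -> V) (g : V -> W) c e c' :
  bihomog c f -> bihomog e g -> c' = c + e -> bihomog c' (fun x => g (f x)).
Proof. by move=> fH gH -> i x /fH/gH; rewrite addrA. Qed.

Lemma bihomogB (k : fieldType) (V W : bgmod k) (f g : V -> W) c :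
  bihomog c f -> bihomog c g -> bihomog c (fun x => f x - g x).
Proof. by move=> fH gH i x xi; rewrite smB ?fH ?gH. Qed.

Lemma linear_sub (k : fieldType) (V W : lmodType k) (f g : V -> W) :
  linear f -> linear g -> linear (fun x => f x - g x).
Proof. by move=> fL gL a x y; rewrite fL gL scalerBr; zmodule. Qed.

(** A deformed contraction (i, p, S) of the deformed differential onto the
    cohomology, with the operations mtm and the morphism mtf transferred along
    it, reduces to a model.  Modulo h the transferred differential is zero and
    mtf_1 is a section of the classes.  The product of two classes is that of
    the representatives chosen by i0; other representatives give the same class
    by the Leibniz rule.  That mtf_1 is a quasi-isomorphism, also before
    reduction, is what the homotopies say. *)
Section ModelOfTransfer.
Variables (k : fieldType) (s : nat) (X : deform_data k s).
Hypothesis Xdef : is_deform X.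

Local Notation B := (dB X).
Local Notation m := (dm X).
Local Notation tm := (dtm X).
Let d : hlin B B := arity1 m.
Local Notation H := (coh (arity1 (dm X))).
Let mA : is_bAinf B m := proj1 Xdef.
Let tmA : is_bAinf (hser B) tm := deformation_Ainf (proj2 Xdef).
Let tmh : hbar_linear tm. Proof. by case: Xdef => _ []. Qed.
Let red : reduces_to tm m. Proof. by case: Xdef => _ []. Qed.

Let dd x : d (d x) = 0. Proof. exact: (m1_square mA). Qed.

Variables (i0 : {linear H -> B}) (s0 : {linear B -> B}) (p0 : {linear B -> H}).
Hypothesis di0 : forall c, d (i0 c) = 0.
Hypothesis cli0 : forall c, hcls d (i0 c) = c.
Hypothesis htpy0 : forall x, i0 (p0 x) + s0 (d x) + d (s0 x) = x.

Let D x := tm [:: x].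
Let DL : linear D. Proof. exact: m1_linear. Qed.
Let DD x : D (D x) = 0. Proof. exact: (m1_square tmA). Qed.

Variables (i : hser H -> hser B) (p : hser B -> hser H) (S : hser B -> hser B).
Variable dN : hser H -> hser H.
Hypotheses (iL : linear i) (pL : linear p) (SL : linear S).
Hypothesis Di : forall x, tm [:: i x] = i (dN x).
Hypothesis pi : forall x, p (i x) = x.
Hypothesis homotopy : forall x, tm [:: S x] + S (tm [:: x]) = x - i (p x).
Hypothesis dN0 : forall x, hcoef 0 (dN x) = 0.
Hypothesis iE : forall x, hcoef 0 (i x) = i0 (hcoef 0 x).
Hypothesis pE : forall x, hcoef 0 (p x) = p0 (hcoef 0 x).

Variables (mtm : gmulti (hser H) (hser H) (alg_deg s)).
Variables (mtf : gmulti (hser H) (hser B) (mor_deg s)).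
Hypotheses (mtm1 : forall c, mtm [:: c] = dN c) (mtf1 : forall c, mtf [:: c] = i c).
Hypothesis mtm2 : forall c e, mtm [:: c; e] = p (tm [:: i c; i e]).
Hypotheses (mtmh : hbar_linear mtm) (mtfh : hbar_linear mtf).
Hypothesis mtmA : is_bAinf (hser H) mtm.
Hypothesis mtfA : is_Ainf_morphism tot (@gpart _ _ (hser H)) mtm tm mtf.

Let i_inj : injective i. Proof. exact: can_inj pi. Qed.
Let iD := lin_add iL. Let pD := lin_add pL. Let SD := lin_add SL. Let DD' := lin_add DL.
Let Di' x : D (i x) = i (dN x). Proof. exact: Di. Qed.
Let homotopy' x : D (S x) + S (D x) = x - i (p x). Proof. exact: homotopy. Qed.

(* Both sides have the same image under the injective map i: apply D to the
   homotopy relation at y, and compare with the relation at D y. *)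
Let p_chain y : p (D y) = dN (p y).
Proof.
have h1 := homotopy' (D y); rewrite DD (add_morph0 SD) addr0 in h1.
have h2 := congr1 D (homotopy' y).
rewrite DD' DD add0r DD' (add_morphN _ DD') Di' h1 in h2.
by apply: i_inj; have /oppr_inj := addrI _ h2.
Qed.

Let M : model_data X := Model (reduce mtm) (reduce mtf) mtm mtf.

Let redm : reduces_to mtm (reduce mtm). Proof. exact: reduceP. Qed.
Let redf : reduces_to mtf (reduce mtf). Proof. exact: reduceP. Qed.

Let rm1 c : reduce mtm [:: c] = 0.
Proof. by rewrite reduceE mtm1 dN0. Qed.
Let rf1 c : reduce mtf [:: c] = i0 c.
Proof. by rewrite reduceE mtf1 iE. Qed.

Let p0_cls z : d z = 0 -> p0 z = hcls d z.
Proof.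
move=> dz; rewrite -[LHS]cli0; apply/clsP.
- by apply/gkerP; exact: di0.
- exact/gkerP.
- have := htpy0 z; rewrite dz linear0 addr0 => e.
  rewrite -[X in _ - X]e opprD addrA subrr add0r smN //.
  by apply/gimP; exists (s0 z).
Qed.

Let leib u v : d (m [:: u; v]) = m [:: d u; v] + m [:: tau u; d v].
Proof. exact: (m2_leibniz mA). Qed.

Let d_tau u : d (tau u) = - tau (d u). Proof. exact: (m1_tau m). Qed.

Let m2_bound u v : d v = 0 -> m [:: d u; v] \in gim d.
Proof.
move=> dv; apply/gimP; exists (m [:: u; v]).
rewrite leib dv.
by rewrite (madd0 (multilinear_add (gmultiL m)) [:: _]) addr0.
Qed.
Let m2_boundr u v : d u = 0 -> m [:: u; d v] \in gim d.
Proof.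
move=> du; apply/gimP; exists (m [:: tau u; v]).
rewrite leib d_tau du linear0 oppr0.
by rewrite (madd0 (multilinear_add (gmultiL m)) [::]) add0r tauK.
Qed.

Let rm2c c e : reduce mtm [:: c; e] = p0 (m [:: i0 c; i0 e]).
Proof.
have h1 : hcoef 0 (tm [:: i (hconst c); i (hconst e)]) = m [:: i0 c; i0 e].
  by apply: etrans (red _) _; congr (m [:: _; _]); exact: iE.
have h2 := congr1 (hcoef 0) (mtm2 (hconst c) (hconst e)).
exact: etrans h2 (etrans (pE _) (congr1 p0 h1)).
Qed.

Let rm2 x y : d x = 0 -> d y = 0 ->
  reduce mtm [:: hcls d x; hcls d y] = hcls d (m [:: x; y]).
Proof.
move=> dx dy; rewrite rm2c.
have mD := multilinear_add (gmultiL m).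
have repr z : d z = 0 -> exists u, i0 (hcls d z) = z + d u.
  move=> dz; have /gimP[u e] : i0 (hcls d z) - z \in gim d.
    apply/(clsP (gim d) _ _); [by apply/gkerP; exact: di0|exact/gkerP|].
    by rewrite [LHS]cli0.
  by exists u; rewrite -e addrC subrK.
have [u ->] := repr _ dx; have [v ->] := repr _ dy.
rewrite p0_cls; last first.
  rewrite leib !linearD dx dy !dd addr0.
  by rewrite (madd0 mD [::]) (madd0 mD [:: _]) addr0.
have dxy z w : d z = 0 -> d w = 0 -> m [:: z; w] \in gker d.
  move=> dz dw; apply/gkerP; rewrite leib dz dw.
  by rewrite (madd0 mD [::]) (madd0 mD [:: _]) addr0.
apply/clsP; [apply: dxy|exact: dxy|]; rewrite ?linearD ?dx ?dy ?dd ?addr0 //.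
rewrite (maddP mD [::]) (maddP mD [:: x]) addrAC [_ + m [:: x; d v]]addrC addrK.
by rewrite smD ?m2_boundr ?m2_bound // linearD dy dd addr0.
Qed.

Lemma model_of_transfer : exists M : model_data X, is_model M /\ is_model_deformation M.
Proof.
exists M; split; split.
- exact: reduced_Ainf redm mtmA.
- exact: rm1.
- exact: rm2.
- split; first exact: reduced_morphism redm red redf mtfA.
  split=> [x _|x _ [y e]|y dy].
  + by rewrite [mo_f M _]rf1; exact: di0.
  + exists 0; rewrite [RHS]rm1 -(cli0 x); apply/cls_eq0; first by apply/gkerP; exact: di0.
    by apply/gimP; exists y; rewrite -rf1.
  + exists (p0 y), (s0 y); split; first exact: rm1.
    rewrite [mo_f M _]rf1 -[m [:: s0 y]]/(d (s0 y)).
    by have := htpy0 y; rewrite -[d y]/(m [:: y]) dy linear0 addr0.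
- by move=> c; rewrite [mo_f M _]rf1; split; [exact: di0|exact: cli0].
- by apply: Ainf_deformation.
- split=> // n ds xs hx; rewrite mtfA // subrr; exact: hbarX0.
- exact: redf.
- split=> [x|x dx [y e]|y dy].
  + rewrite [mo_tm M _]mtm1 [mo_tf M _]mtf1 => dx.
    by rewrite -[LHS]/(D (i x)) Di' dx (add_morph0 iD).
  + have e' : i x = D y := etrans (esym (mtf1 x)) e.
    by exists (p y); rewrite [mo_tm M _]mtm1 -p_chain -e' pi.
  + exists (p y), (S y); rewrite [mo_tm M _]mtm1 [mo_tf M _]mtf1 -p_chain.
    have dy' : D y = 0 := dy; rewrite dy' (add_morph0 pD); split=> //.
    have := homotopy' y; rewrite dy' (add_morph0 SD) addr0 => e.
    by rewrite -[tm _]/(D (S y)) e addrC subrK.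
Qed.
End ModelOfTransfer.

(** The contraction is extended k[h]-linearly, perturbed by the terms of positive
    order of tm_1, and used for the transfer of tm. *)
Section ModelExists.
Variables (k : fieldType) (s : nat) (X : deform_data k s).
Hypothesis Xdef : is_deform X.

Local Notation B := (dB X).
Local Notation m := (dm X).
Local Notation tm := (dtm X).
Let d : hlin B B := arity1 m.
Local Notation H := (coh (arity1 (dm X))).
Let mA : is_bAinf B m := proj1 Xdef.
Let tmA : is_bAinf (hser B) tm := deformation_Ainf (proj2 Xdef).
Let tmh : hbar_linear tm. Proof. by case: Xdef => _ []. Qed.
Let red : reduces_to tm m. Proof. by case: Xdef => _ []. Qed.

Let dd x : d (d x) = 0. Proof. exact: (m1_square mA). Qed.
Let dH : bihomog (alg_deg s 1) d. Proof. by move=> i x; exact: (hlinP d). Qed.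

Variables (i0 : {linear H -> B}) (s0 : {linear B -> B}) (p0 : {linear B -> H}).
Hypotheses (i0H : bihomog 0 i0) (s0H : bihomog (- alg_deg s 1) s0) (p0H : bihomog 0 p0).
Hypothesis di0 : forall c, d (i0 c) = 0.
Hypothesis cli0 : forall c, hcls d (i0 c) = c.
Hypothesis p0i0 : forall c, p0 (i0 c) = c.
Hypothesis p0d : forall x, p0 (d x) = 0.
Hypothesis ss0 : forall x, s0 (s0 x) = 0.
Hypothesis si0 : forall c, s0 (i0 c) = 0.
Hypothesis ps0 : forall x, p0 (s0 x) = 0.
Hypothesis htpy0 : forall x, i0 (p0 x) + s0 (d x) + d (s0 x) = x.

Let D x := tm [:: x].
Let DL : linear D. Proof. exact: m1_linear. Qed.
Let DH : bihomog (alg_deg s 1) D. Proof. by move=> i x; exact: (hlinP (arity1 tm)). Qed.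
Let Dh : hcomm D. Proof. by move=> x; exact: (tmh [::] [::]). Qed.
Let DD x : D (D x) = 0. Proof. exact: (m1_square tmA). Qed.

Let hd : hlin (hser B) (hser B) := hext dH.
Let hi0 : hlin (hser H) (hser B) := hext i0H.
Let hs0 : hlin (hser B) (hser B) := hext s0H.
Let hp0 : hlin (hser B) (hser H) := hext p0H.

Let hdh : hcomm hd. Proof. exact: hext_comm. Qed.
Let hi0h : hcomm hi0. Proof. exact: hext_comm. Qed.
Let hs0h : hcomm hs0. Proof. exact: hext_comm. Qed.
Let hp0h : hcomm hp0. Proof. exact: hext_comm. Qed.
Let hdE r x : hcoef r (hd x) = d (hcoef r x). Proof. by []. Qed.
Let hi0E r x : hcoef r (hi0 x) = i0 (hcoef r x). Proof. by []. Qed.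
Let hs0E r x : hcoef r (hs0 x) = s0 (hcoef r x). Proof. by []. Qed.
Let hp0E r x : hcoef r (hp0 x) = p0 (hcoef r x). Proof. by []. Qed.
Let hE := (hdE, hi0E, hs0E, hp0E).

Let dl_fun x := D x - hd x.
Let dl_linear : linear dl_fun.
Proof. by move=> a x y; rewrite /dl_fun DL linearP scalerBr; zmodule. Qed.
Let dl : {linear hser B -> hser B} := mklin dl_linear.
Let dlE x : dl x = D x - hd x. Proof. by []. Qed.
Let dlH : bihomog (alg_deg s 1) dl.
Proof. by apply: bihomogB => //; exact: hext_hom. Qed.
Let dlh : hcomm dl.
Proof. by move=> x; rewrite !dlE Dh hdh [hbar (_ - _)]linearB. Qed.
Let dl0 x : hcoef 0 (dl x) = 0.
Proof. by rewrite dlE linearB hE red subrr. Qed.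
Let hdl x : hd x + dl x = D x. Proof. by rewrite dlE addrC subrK. Qed.

Let sdl_linear : linear (fun x => hs0 (dl x)). Proof. by move=> a x y; rewrite !linearP. Qed.
Let sdl : {linear hser B -> hser B} := mklin sdl_linear.
Let sdlE x : sdl x = hs0 (dl x). Proof. by []. Qed.
Let sdlH : bihomog 0 sdl.
Proof. by apply: (bihomog_comp dlH (hext_hom s0H)); rewrite subrr. Qed.
Let sdlh : hcomm sdl. Proof. by move=> x; rewrite !sdlE dlh hs0h. Qed.
Let sdl0 x : hcoef 0 (sdl x) = 0. Proof. by rewrite sdlE hE dl0 linear0. Qed.

Lemma perturbation_inverse : exists L : {linear hser B -> hser B},
  [/\ bihomog 0 L, hcomm L, forall f, L (f + hs0 (dl f)) = f
    & forall f, L f + hs0 (dl (L f)) = f].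
Proof. exact: (one_plus_inverse sdlH sdlh sdl0). Qed.

Variable L : {linear hser B -> hser B}.
Hypotheses (LH : bihomog 0 L) (Lh : hcomm L).
Hypotheses (LK : forall f, L (f + hs0 (dl f)) = f) (KL : forall f, L f + hs0 (dl (L f)) = f).

Let i := pert_i hi0 L.
Let p := pert_p dl hs0 hp0 L.
Let S := pert_s hs0 L.
Let G x := - S x.
Let dN := pert_d dl hi0 hp0 L.

Let iL : linear i. Proof. by move=> a x y; rewrite /i /pert_i !linearP. Qed.
Let SL : linear S. Proof. by move=> a x y; rewrite /S /pert_s !linearP. Qed.
Let GL : linear G. Proof. by move=> a x y; rewrite /G SL opprD scalerN. Qed.
Let pL : linear p.
Proof. by apply: linear_sub => a x y; rewrite !linearP. Qed.
Let dNL : linear dN. Proof. by move=> a x y; rewrite /dN /pert_d -/i iL !linearP. Qed.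
Let iH : bihomog 0 i.
Proof. by apply: (bihomog_comp (hext_hom i0H) LH); rewrite addr0. Qed.
Let SH : bihomog (- alg_deg s 1) S.
Proof. by apply: (bihomog_comp (hext_hom s0H) LH); rewrite addr0. Qed.
Let GH : bihomog (- alg_deg s 1) G.
Proof. by move=> j x /SH h; rewrite smN. Qed.
Let dNH : bihomog (alg_deg s 1) dN.
Proof.
have dpH : bihomog (alg_deg s 1) (fun y => hp0 (dl y)).
  by apply: (bihomog_comp dlH (hext_hom p0H)); rewrite addr0.
by apply: (bihomog_comp iH dpH); rewrite add0r.
Qed.
Let pH : bihomog 0 p.
Proof.
apply: bihomogB; first exact: hext_hom.
have dpH : bihomog (alg_deg s 1) (fun y => hp0 (dl y)).
  by apply: (bihomog_comp dlH (hext_hom p0H)); rewrite addr0.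
by apply: (bihomog_comp SH dpH); rewrite addNr.
Qed.
Let ih : hcomm i. Proof. by move=> x; rewrite /i /pert_i hi0h Lh. Qed.
Let Sh : hcomm S. Proof. by move=> x; rewrite /S /pert_s hs0h Lh. Qed.
Let Gh : hcomm G. Proof. by move=> x; rewrite /G Sh linearN. Qed.
Let dNh : hcomm dN. Proof. by move=> x; rewrite /dN /pert_d -/i ih dlh hp0h. Qed.
Let ph : hcomm p.
Proof. by move=> x; rewrite /p /pert_p hs0h Lh dlh !hp0h [hbar (_ - _)]linearB. Qed.

Let hddd x : hd (hd x) = 0.
Proof. by apply: hser_ext => r; rewrite !hE dd linear0. Qed.

Let hD x : hd (hd x + dl x) + dl (hd x + dl x) = 0. Proof. by rewrite !hdl DD. Qed.

Let Di x : D (i x) = i (dN x).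
Proof.
rewrite -hdl; apply: (@pert_chain _ _ hd dl hs0 hi0 hp0) => //; try exact: linearD.
- by move=> y; apply: hser_ext => r; rewrite !hE p0i0.
- by move=> y; apply: hser_ext => r; rewrite !hE ss0 linear0.
- by move=> y; apply: hser_ext => r; rewrite !hE si0 linear0.
- by move=> y; apply: hser_ext => r; rewrite !hE ps0 linear0.
- by move=> y; apply: hser_ext => r; rewrite !hE p0d linear0.
- by move=> y; apply: hser_ext => r; rewrite !linearD !hE htpy0.
Qed.

Let pi x : p (i x) = x.
Proof.
apply: (@pert_pi _ _ dl hs0 hi0 hp0) => //; try exact: linearD.
- by move=> y; apply: hser_ext => r; rewrite !hE p0i0.
- by move=> y; apply: hser_ext => r; rewrite !hE ss0 linear0.
- by move=> y; apply: hser_ext => r; rewrite !hE si0 linear0.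
- by move=> y; apply: hser_ext => r; rewrite !hE ps0 linear0.
Qed.

Let homotopy x : D (S x) + S (D x) = x - i (p x).
Proof.
rewrite -[D (S x)]hdl -[D x]hdl.
apply: (@pert_homotopy _ _ hd dl hs0 hi0 hp0) => //; try exact: linearD.
- by move=> y; apply: hser_ext => r; rewrite !hE ss0 linear0.
- by move=> y; apply: hser_ext => r; rewrite !hE ps0 linear0.
- by move=> y; apply: hser_ext => r; rewrite !linearD !hE htpy0.
Qed.

Let i_inj : injective i. Proof. exact: can_inj pi. Qed.
Let hG x : i (p x) - x = tm [:: G x] + G (tm [:: x]).
Proof.
rewrite -[tm [:: x]]/(D x) -[tm [:: G x]]/(D (G x)) /G (add_morphN _ (lin_add DL)).
by rewrite -opprD homotopy opprB.
Qed.

Let mtm := transferred_alg tm iL dNL pL GL iH dNH pH GH.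
Let mtf := transferred_mor tm iL dNL pL GL iH GH.

Let mtm1 c : mtm [:: c] = dN c. Proof. exact: transferred_alg1. Qed.
Let mtf1 c : mtf [:: c] = i c. Proof. exact: transferred_mor1. Qed.

Let closed : placewise (fun z x y => z = hbar x) (fun z x y => z = hbar x) mtm
  /\ placewise (fun z x y => z = hbar x) (fun z x y => z = hbar x) mtf.
Proof.
have sr (U : bgmod k) : sumrel (fun z x y : hser U => z = hbar x).
  by split=> [|z x y z' x' y' -> ->]; rewrite ?linear0 ?linearD.
apply: transfer_closed => //
  [z x y ->|z x y ->|l r z x y ->|z x y ->|z x y ->|z x y ->|z x y ->].
- by rewrite hbar_tau.
- by rewrite hbar_tau.
- exact: tmh.
- exact: ih.
- exact: dNh.
- exact: ph.
- exact: Gh.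
Qed.

Let mtmh : hbar_linear mtm. Proof. by move=> l r x; exact: (proj1 closed l r _ x x). Qed.
Let mtfh : hbar_linear mtf. Proof. by move=> l r x; exact: (proj2 closed l r _ x x). Qed.

Let mtmA : is_bAinf (hser H) mtm. Proof. exact: transferred_Ainf. Qed.
Let mtfA : is_Ainf_morphism tot (@gpart _ _ (hser H)) mtm tm mtf.
Proof. exact: transferred_morphism. Qed.

Let dN0 x : hcoef 0 (dN x) = 0.
Proof. by rewrite /dN /pert_d hE dl0 linear0. Qed.
Let iE x : hcoef 0 (i x) = i0 (hcoef 0 x).
Proof.
have := congr1 (hcoef 0) (KL (hi0 x)); rewrite linearD hs0E dl0 linear0 addr0 => ->.
exact: hi0E.
Qed.
Let pE x : hcoef 0 (p x) = p0 (hcoef 0 x).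
Proof. by rewrite /p /pert_p linearB !hE dl0 linear0 subr0. Qed.

Let mtm2 c e : mtm [:: c; e] = p (tm [:: i c; i e]).
Proof. exact: transferred_alg2. Qed.

Lemma model_of_contraction : exists M : model_data X, is_model M /\ is_model_deformation M.
Proof.
exact: (model_of_transfer Xdef di0 cli0 htpy0 iL pL SL Di pi homotopy dN0 iE pE
  mtm1 mtf1 mtm2 mtmh mtfh mtmA mtfA).
Qed.
End ModelExists.

Lemma model_exists (k : fieldType) (s : nat) (X : deform_data k s) : is_deform X ->
  exists M : model_data X, is_model M /\ is_model_deformation M.
Proof.
move=> Xdef; have dd x := m1_square (proj1 Xdef) x.
have [i0 [s0 [p0 [[h1 h2 h3] [[h4 h5 h6 h7] [h8 h9 h10 h11]]]]]] :=
  contraction_exists (d := arity1 (dm X)) dd.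
have [L [L1 L2 L3 L4]] := perturbation_inverse Xdef h2.
exact: (model_of_contraction Xdef h1 h3 h4 h5 h6 h7 h8 h9 h10 h11 L1 L2 L3 L4).
Qed.

(** * The Rees algebra as a formal deformation *)

Lemma homog_span (k : fieldType) (I : zmodType) (V : gmod k I) (W : lmodType k)
    (f : seq V -> W) (S : submodClosed W) : multiadditive f ->
  (forall ds xs, homog (@gpart _ _ V) ds xs -> f xs \in S) -> forall xs, f xs \in S.
Proof.
move=> fD fS xs.
suff: forall ds l, homog (@gpart _ _ V) ds l -> f (l ++ xs) \in S.
  by move=> /(_ [::] [::]); apply.
elim: xs => [|x xs IH] ds l hl; first by rewrite cats0 (fS ds).
have [s sV ->] := gmod_sum x.
rewrite (big_morph (fun y => f (l ++ y :: xs)) (maddP fD l xs) (madd0 fD l xs)).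
rewrite big_seq; apply: rpred_sum => u /(allP sV) ui.
rewrite -cat_rcons; apply: (IH (rcons ds u.1)).
by rewrite -!cats1; apply: homog_cat; rewrite // /homog /= ui.
Qed.

Section FiniteSums.
Variable W : zmodType.

Lemma fsum_seq (s : seq int) (F : int -> W) : uniq s ->
  (forall a, a \notin s -> F a = 0) ->
  \sum_(a \in [set: int]) F a = \sum_(a <- s) F a.
Proof.
move=> us F0; rewrite (fsbigE s) //.
  by apply: eq_bigl => a; rewrite in_setT.
by move=> a _ /F0 ->.
Qed.
End FiniteSums.

Section Convolution.
Variables (k : fieldType) (A : filtered_Ainf k).
Implicit Types (g : seq A -> A) (fs : seq (int -> A)).

(** The k[h]-linear extension of g to the Rees module, whose elements are encoded
    by families f with f p the coefficient of h^(-p): the sum over all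
    p_1 + .. + p_n = p of the g [f_1 p_1; ..; f_n p_n].  The last argument is
    treated apart, as its index is determined by the others. *)
Fixpoint nconv g fs (p : int) : A :=
  match fs with
  | [::] => 0
  | f :: fs' =>
      match fs' with
      | [::] => g [:: f p]
      | _ :: _ => \sum_(a \in [set: int]) nconv (fun ys => g (f a :: ys)) fs' (p - a)
      end
  end.

Fixpoint fsupps fs : Prop := if fs is f :: fs' then fsupp f /\ fsupps fs' else True.

Lemma nconv0 fs p : nconv (fun _ => 0) fs p = 0.
Proof.
elim: fs p => [|f [|f' fs] IH] p //=.
by rewrite (@fsum_seq _ [::]) ?big_nil // => a _; exact: IH.
Qed.

Lemma nconv_cons g f fs p s : fs != [::] -> uniq s -> multiadditive g ->
  (forall a, a \notin s -> f a = 0) ->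
  nconv g (f :: fs) p = \sum_(a <- s) nconv (fun ys => g (f a :: ys)) fs (p - a).
Proof.
case: fs => // f' fs _ us gD f0.
rewrite -[LHS]/(\sum_(a \in [set: int]) nconv (fun ys => g (f a :: ys)) (f' :: fs) (p - a)).
rewrite (fsum_seq us) // => a /f0 ->.
rewrite -[RHS](nconv0 (f' :: fs) (p - a)).
by congr (nconv _ _ _); apply/funext => ys; rewrite (madd0 gD [::]).
Qed.

Lemma nconv_lin a g g' fs p : multiadditive g -> multiadditive g' ->
  fsupps fs -> nconv (fun ys => a *: g ys + g' ys) fs p
    = a *: nconv g fs p + nconv g' fs p.
Proof.
move=> gD gD'; elim: fs p g g' gD gD' => [|f fs IH] p g g' gD gD'.
  by rewrite /= scaler0 addr0.
move=> [[s us f0] ffs]; have [->|fs0] := eqVneq fs [::]; first by [].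
have ggD : multiadditive (fun ys => a *: g ys + g' ys).
  move=> l r z x y ->; rewrite (maddP gD) (maddP gD') scalerDr; zmodule.
rewrite !(nconv_cons _ fs0 us) // scaler_sumr -big_split; apply: eq_bigr => b _.
by rewrite IH //; exact: madd_cons.
Qed.

Lemma nconv_multilinear g p l r a (x y : int -> A) : multilinear g ->
  fsupps l -> fsupps r -> fsupp x -> fsupp y ->
  nconv g (l ++ (a *: x + y) :: r) p
    = a *: nconv g (l ++ x :: r) p + nconv g (l ++ y :: r) p.
Proof.
move=> gL fl fr [s us x0] [t ut y0].
have gD := multilinear_add gL.
elim: l fl p g gL gD => [|f l IH] fl p g gL gD; rewrite ?cat0s ?cat_cons.
  have [->|r0] := eqVneq r [::]; first exact: (gL [::] [::]).
  pose w := undup (s ++ t); have uw : uniq w by exact: undup_uniq.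
  have xw b : b \notin w -> x b = 0.
    by rewrite mem_undup mem_cat negb_or => /andP[/x0].
  have yw b : b \notin w -> y b = 0.
    by rewrite mem_undup mem_cat negb_or => /andP[_ /y0].
  rewrite (nconv_cons _ r0 uw gD xw) (nconv_cons _ r0 uw gD yw).
  rewrite (@nconv_cons g _ r p w) // => [|b bw]; last first.
    by rewrite [LHS](_ : _ = a *: x b + y b) // xw // yw // scaler0 addr0.
  rewrite scaler_sumr -big_split; apply: eq_bigr => b _ /=.
  rewrite -nconv_lin //; try exact: madd_cons.
  by congr (nconv _ _ _); apply/funext => ys; exact: (gL [::]).
have [[s' us' f0] fl'] := fl.
have l0 z : l ++ z :: r != [::] by case: (l).
rewrite !(nconv_cons _ (l0 _) us') // scaler_sumr -big_split; apply: eq_bigr => b _ /=.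
apply: IH => //; first by move=> l'; exact: (gL (f b :: l')).
exact: madd_cons.
Qed.

(** Multiplying one argument by h shifts its index, hence that of the value. *)
Lemma nconv_shift g p l r (z : int -> A) : multiadditive g ->
  fsupps l -> fsupps r -> fsupp z ->
  nconv g (l ++ rees_shift z :: r) p = nconv g (l ++ z :: r) (p + 1).
Proof.
move=> gD fl fr [s us z0]; elim: l fl p g gD => [|f l IH] fl p g gD; rewrite ?cat0s ?cat_cons.
  have [->|r0] := eqVneq r [::]; first by [].
  rewrite (@nconv_cons g z r (p + 1) s) //.
  rewrite (@nconv_cons g (rees_shift z) r p [seq b - 1 | b <- s]) //.
  - rewrite big_map; apply: eq_bigr => b _.
    rewrite /rees_shift subrK; congr (nconv _ _ _); ring.
  - by rewrite map_inj_uniq //; exact: addIr.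
  - move=> b bs; apply: z0; apply: contra bs => h.
    by apply/mapP; exists (b + 1); rewrite // addrK.
have [[s' us' f0] fl'] := fl.
have l0 y : l ++ y :: r != [::] by case: (l).
rewrite !(nconv_cons _ (l0 _) us') //; apply: eq_bigr => b _.
rewrite IH //; first by rewrite addrAC.
exact: madd_cons.
Qed.

(** The elements of A that underlie a list of homogeneous elements x h^(-p). *)
Definition evals (ds : seq Z2) (fs : seq (rees A)) : seq A :=
  [seq subm_val u.2 u.1.1 | u <- zip ds fs].

Lemma rees_homP i (f : rees A) : f \in gpart i ->
  [/\ subm_val f i.1 \in gpart (i.1 + i.2), subm_val f i.1 \in fil A i.1
    & forall p, p != i.1 -> subm_val f p = 0].
Proof. by move=> /submod_ofP/rees_partP. Qed.

Lemma nconv_hom g ds (fs : seq (rees A)) p : multiadditive g ->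
  homog (@gpart _ _ (rees A)) ds fs -> fs != [::] ->
  nconv g (map (@subm_val _ _ _) fs) p
    = if p == (\sum_(d <- ds) d).1 then g (evals ds fs) else 0.
Proof.
elim: fs ds p g => [|f fs IH] [|d ds] p g gD //; rewrite /homog /=.
move=> /andP[/rees_homP[_ _ f0] hfs] _.
have [fsE|fs0] := eqVneq fs [::].
  rewrite {}fsE in hfs *.
  case: ds hfs => [|? ?] // _; rewrite big_seq1 /evals /=.
  have [->//|pd] := eqVneq p d.1.
  by rewrite f0 // (madd0 gD [::]).
have ms0 : map (@subm_val _ _ (dspan (@rees_part k A))) fs != [::] by case: (fs) fs0.
have fd a : a \notin [:: d.1] -> subm_val f a = 0.
  by rewrite inE => /f0.
have := nconv_cons p ms0 _ gD fd; rewrite [nconv g (_ :: _) p]/= => -> //.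
rewrite big_seq1 (IH ds) //; last exact: madd_cons.
rewrite big_cons /= subr_eq addrC.
by case: ifP.
Qed.
End Convolution.

Lemma zip_take (S T : Type) n (s : seq S) (t : seq T) :
  zip (take n s) (take n t) = take n (zip s t).
Proof. by elim: n s t => [|n IH] [|x s] [|y t] //=; rewrite IH. Qed.

Lemma zip_drop (S T : Type) n (s : seq S) (t : seq T) :
  zip (drop n s) (drop n t) = drop n (zip s t).
Proof.
elim: n s t => [|n IH] [|x s] [|y t] //=; rewrite ?IH //.
  by case: (drop n t).
by case: (drop n s).
Qed.

Section ReesAlgebra.
Variables (k : fieldType) (A : filtered_Ainf k).
Local Notation m := (fm A).
Local Notation R := (rees A).
Local Notation val_ := (@subm_val _ _ (dspan (@rees_part k A))).

Lemma rees_fsupp (f : R) : fsupp (val_ f).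
Proof. by have /submod_ofP[s sV ->] := subm_valP f; exact: fsupp_sum. Qed.

Lemma rees_fsupps (fs : seq R) : fsupps (map val_ fs).
Proof. by elim: fs => //= f fs IH; split=> //; exact: rees_fsupp. Qed.

Let mL : multilinear m := gmultiL m.
Let mD := multilinear_add mL.

Definition rees_mul_fun (fs : seq R) : int -> A := nconv m (map val_ fs).

Lemma rees_mul_fun_linear : multilinear rees_mul_fun.
Proof.
move=> l r a x y; apply/funext => p; rewrite /rees_mul_fun !map_cat /=.
by rewrite [LHS]nconv_multilinear //; exact: rees_fsupps || exact: rees_fsupp.
Qed.

Lemma evals_homog ds (fs : seq R) : homog (@gpart _ _ R) ds fs ->
  homog (@gpart _ _ A) (map tot ds) (evals ds fs).
Proof.
elim: fs ds => [|f fs IH] [|d ds] //; rewrite /homog /= => /andP[/rees_homP[h _ _] /IH].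
by rewrite h.
Qed.

Lemma size_evals ds (fs : seq R) : homog (@gpart _ _ R) ds fs ->
  size (evals ds fs) = size fs.
Proof. by move=> /homog_size e; rewrite size_map size_zip e minnn. Qed.

Lemma fst_sum (ds : seq Z2) : (\sum_(d <- ds) d).1 = \sum_(d <- ds) d.1.
Proof. by elim: ds => [|d ds IH]; rewrite ?big_nil // !big_cons -IH. Qed.

Lemma rees_mul_fun_hom ds (fs : seq R) : homog (@gpart _ _ R) ds fs ->
  rees_mul_fun fs \in rees_part A (\sum_(d <- ds) d + alg_deg 0 (size fs)).
Proof.
have [->|fs0] := eqVneq fs [::] => hf; first exact: sm0.
have vE p : rees_mul_fun fs p = if p == (\sum_(d <- ds) d).1 then m (evals ds fs) else 0.
  exact: nconv_hom.
have deg1 : (\sum_(d <- ds) d + alg_deg 0 (size fs)).1 = (\sum_(d <- ds) d).1.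
  by rewrite /= mulr0 addr0.
apply/rees_partP; rewrite deg1 !vE eqxx; split.
- have := gmultiP m (evals_homog hf); rewrite big_map -tot_sum size_evals //.
  by congr (_ \in gpart _); rewrite /tot /=; ring.
- rewrite fst_sum; have := @fil_mul _ A (map fst ds) (evals ds fs); rewrite big_map; apply.
  elim: fs ds hf {fs0 vE deg1} => [|f fs IH] [|d ds] //; rewrite /homog /=.
  by move=> /andP[/rees_homP[_ h _] /IH]; rewrite h.
- by move=> p /negbTE pd; rewrite vE pd.
Qed.

Lemma rees_mul_fun_span fs : rees_mul_fun fs \in dspan (@rees_part k A).
Proof.
apply: homog_span fs => [|ds fs hf]; first exact: multilinear_add rees_mul_fun_linear.
by apply/submod_ofP; exact: homsum_hom (rees_mul_fun_hom hf).
Qed.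

Definition rees_m_fun (fs : seq R) : R := Subm (rees_mul_fun_span fs).
Lemma rees_m0 : rees_m_fun [::] = 0. Proof. exact: val_inj. Qed.
Lemma rees_m_linear : multilinear rees_m_fun.
Proof. by move=> l r a x y; apply: val_inj; exact: rees_mul_fun_linear. Qed.
Lemma rees_m_homog : multihomog (@gpart _ _ R) (@gpart _ _ R) (alg_deg 0) rees_m_fun.
Proof. by move=> ds fs hf; apply/submod_ofP; exact: rees_mul_fun_hom. Qed.

Definition rees_m : gmulti R R (alg_deg 0) := Gmulti rees_m0 rees_m_linear rees_m_homog.

Lemma rees_m1 f : rees_m [:: f] = rees_d A f. Proof. exact: val_inj. Qed.
Lemma rees_m2 f g : rees_m [:: f; g] = rees_mul f g. Proof. exact: val_inj. Qed.

Lemma rees_m_h l r x : rees_m (l ++ rees_h A x :: r) = rees_h A (rees_m (l ++ x :: r)).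
Proof.
apply: val_inj; apply/funext => p; rewrite /= /rees_mul_fun !map_cat /=.
by rewrite [LHS](nconv_shift _ mD) //; exact: rees_fsupps || exact: rees_fsupp.
Qed.

(** On homogeneous elements x_i h^(-p_i), both sides are concentrated in the index
    P = p_1 + .. + p_n, where the identity is that of A for the x_i; their
    degrees are the total degrees of the x_i h^(-p_i), as h has total degree
    zero, so that the signs agree. *)
Lemma rees_Ainf : is_bAinf R rees_m.
Proof.
move=> ds fs hf; apply: val_inj; apply/funext => p.
suff: val_ (stasheff tot rees_m ds fs) p = 0 by [].
pose E := evals ds fs; pose P := (\sum_(d <- ds) d).1.
have sE : size E = size fs by exact: size_evals.
have E0 := @fm_Ainf _ A _ _ (evals_homog hf).
transitivity (if p == P then stasheff id m (map tot ds) E else 0); last first.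
  by rewrite E0; case: ifP.
rewrite /stasheff /insertion_sum sE.
have sum_val (J : finType) (Q : pred J) (F : J -> R) :
   val_ (\sum_(j | Q j) F j) p = \sum_(j | Q j) val_ (F j) p.
  elim: (index_enum J) => [|j s IH]; first by rewrite !big_nil.
  by rewrite !big_cons; case: ifP => // _; rewrite -IH.
have if_sum (J : finType) (Q : pred J) (F : J -> A) :
   (if p == P then \sum_(j | Q j) F j else 0) = \sum_(j | Q j) if p == P then F j else 0.
  by case: ifP => // _; rewrite big1.
rewrite sum_val if_sum; apply: eq_bigr => r _.
rewrite sum_val if_sum; apply: eq_bigr => t /andP[t0 rt].
rewrite -map_take big_map.
set sg := _ * _; set A1 := take r fs; set B := take t (drop r fs); set C := drop (r + t) fs.
transitivity (sg *: val_ (rees_m (A1 ++ rees_m B :: C)) p); first by [].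
have exs : fs = A1 ++ B ++ C by rewrite /C addnC -drop_drop !cat_take_drop.
have [hA hBC] := homog_catP (etrans (congr1 (homog _ ds) (esym exs)) hf).
have [hB hC] := homog_catP hBC.
have sA : size A1 = r by rewrite size_takel // ltnW.
have sB : size B = t by rewrite size_takel // size_drop leq_subRL // ltnW.
rewrite sA in hA hB hC; rewrite sB in hB hC; rewrite drop_drop addnC in hC.
set dA := take r ds in hA; set dB := take t (drop r ds) in hB; set dC := drop (r + t) ds in hC.
have hI : homog (@gpart _ _ R) [:: \sum_(d <- dB) d + alg_deg 0 (size B)] [:: rees_m B].
  by rewrite /homog /= andbT; exact: rees_m_homog.
have := nconv_hom p mD (homog_cat hA (homog_cat hI hC)) _.
rewrite -[nconv _ _ _]/(val_ (rees_m (A1 ++ rees_m B :: C)) p) => ->; last by case: (A1).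
have -> : (\sum_(d <- dA ++ [:: \sum_(d <- dB) d + alg_deg 0 (size B)] ++ dC) d).1 = P.
  rewrite /P -[in RHS](cat_take_drop r ds) -[drop r ds in RHS](cat_take_drop t).
  rewrite drop_drop [(t + r)%N]addnC -/dA -/dB -/dC !big_cat big_seq1 /=.
  by rewrite mulr0 addr0.
rewrite (fun_if (fun x => sg *: x)) scaler0; case: ifP => // _.
congr (_ *: m _).
have evals_cat d1 d2 (f1 f2 : seq R) : size d1 = size f1 ->
    evals (d1 ++ d2) (f1 ++ f2) = evals d1 f1 ++ evals d2 f2.
  by move=> e; rewrite /evals zip_cat // map_cat.
rewrite !evals_cat ?(homog_size hA) //.
have -> : evals dA A1 = take r E by rewrite /E /evals -map_take -zip_take.
have -> : evals dC C = drop (r + t) E by rewrite /E /evals -map_drop -zip_drop.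
congr (_ ++ _ :: _); rewrite /evals /=.
have B0 : B != [::] by rewrite -size_eq0 sB -lt0n.
rewrite /rees_mul_fun (nconv_hom _ mD hB B0).
rewrite mulr0 addr0 eqxx; congr (m _).
by rewrite /E /evals -map_drop -map_take -zip_drop -zip_take.
Qed.
End ReesAlgebra.

Lemma hlin_injective (k : fieldType) (I : zmodType) (V W : gmod k I) (q : hlin V W) :
  (forall i x, x \in @gpart _ _ V i -> q x = 0 -> x = 0) -> injective q.
Proof.
move=> q0 x y e; apply/eqP; rewrite -subr_eq0; apply/eqP.
have : x - y \in gker q by apply/gkerP; rewrite linearB e subrr.
move=> /(gsubP (g := gker q))[s sP ->].
rewrite big_seq big1 // => u /(allP sP)/andP[h1 /gkerP h2].
exact: q0 h1 h2.
Qed.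

Lemma hlin_surjective (k : fieldType) (I : zmodType) (V W : gmod k I) (q : hlin V W) :
  (forall i y, y \in @gpart _ _ W i -> exists x, y = q x) -> forall y, exists x, y = q x.
Proof.
move=> qs y; have [s sV ->] := gmod_sum y.
elim: s sV => [|u s IH] /=; first by exists 0; rewrite big_nil linear0.
move=> /andP[/qs[x xE] /IH[x' x'E]]; exists (x + x').
by rewrite big_cons x'E linearD xE.
Qed.

Section ReesSeries.
Variables (k : fieldType) (A : filtered_Ainf k).
Local Notation R := (rees A).
Local Notation val_ := (@subm_val _ _ (dspan (@rees_part k A))).

Lemma rees_fil (f : R) p : val_ f p \in fil A p.
Proof.
have /submod_ofP[s sV ->] := subm_valP f; rewrite fct_sumE big_seq.
apply: rpred_sum => u /(allP sV)/rees_partP[_ h h0].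
by have [->//|/h0 ->] := eqVneq p u.1.1; exact: sm0.
Qed.

Lemma fil_mono p q x : p <= q -> x \in fil A q -> x \in fil A p.
Proof.
move=> pq; rewrite -(subrK p q) addrC; have : 0 <= q - p by rewrite subr_ge0.
case: (q - p) => // n _; elim: n => [|n IH]; first by rewrite addr0.
move=> h; apply: IH; apply: fil_dec.
by move: h; rewrite intS addrA [p + 1 + _]addrAC.
Qed.

Lemma rees_delta_subproof i x : x \in @gpart _ _ A (i.1 + i.2) -> x \in fil A i.1 ->
  (fun p => if p == i.1 then x else 0) \in rees_part A i.
Proof.
move=> x1 x2; apply/rees_partP; rewrite eqxx; split=> //.
by move=> p /negbTE ->.
Qed.

Lemma rees_delta i x : x \in @gpart _ _ A (i.1 + i.2) -> x \in fil A i.1 ->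
  exists f : R, f \in gpart i /\ forall p, val_ f p = if p == i.1 then x else 0.
Proof.
move=> x1 x2; have h := rees_delta_subproof x1 x2.
have hs : (fun p => if p == i.1 then x else 0) \in dspan (@rees_part k A).
  by apply/submod_ofP; exact: homsum_hom h.
by exists (Subm hs); split=> //; exact/submod_ofP.
Qed.

Lemma rees_ext (f g : R) : (forall p, val_ f p = val_ g p) -> f = g.
Proof. by move=> h; apply: val_inj; apply/funext => p; exact: h. Qed.

Lemma rees_hE (f : R) p : val_ (rees_h A f) p = val_ f (p + 1). Proof. by []. Qed.

Lemma iter_rees_hE n (f : R) p : val_ (iter n (rees_h A) f) p = val_ f (p + n%:Z).
Proof.
elim: n p => [|n IH] p; first by rewrite addr0.
by rewrite iterS rees_hE IH intS addrA.
Qed.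

Variable sec : {linear gr A -> R}.
Hypotheses (secH : bihomog 0 sec) (secK : forall c, gr_proj A (sec c) = c).

Let projH : bihomog 0 (gr_proj A).
Proof. by move=> i x xi; exact: (hlinP (gr_proj A) xi). Qed.
Let projh x : gr_proj A (rees_h A x) = 0.
Proof. by apply/gr_exact; exists x. Qed.
Let hproj x : gr_proj A x = 0 -> exists y, x = rees_h A y.
Proof. by move/gr_exact. Qed.

Definition rees_series : hlin R (hser (gr A)) :=
  expansion (h := rees_h A) erefl (@rees_h_inj _ A) projH secH secK hproj.
Local Notation dig := (digit (h := rees_h A) (@rees_h_inj _ A) secK hproj).

(** An element x h^(-p) with vanishing digits is divisible by all powers of h, so
    x lies in all the F^q A, and vanishes because A is separated. *)
Lemma rees_series_inj : injective rees_series.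
Proof.
apply: hlin_injective => i f fi f0; have [f1 f2 f3] := rees_homP fi.
apply: rees_ext => p; have [->|/f3 //] := eqVneq p i.1.
apply: (fil_separated f1) => q.
have [qp|pq] := lerP q i.1; first exact: fil_mono qp f2.
have [n nE] : exists n : nat, q = i.1 + n%:Z.
  by exists `|q - i.1|%N; rewrite gez0_abs; [ring|rewrite subr_ge0 ltW].
rewrite (expansion_remainder (h := rees_h A) n f0) iter_rees_hE -nE.
exact: rees_fil.
Qed.

(** If F has degree (p, n - p), its digits lift to elements a_r h^(-p-r) with
    a_r in F^(p+r) A, and by completeness the sum x of the a_r exists in A.  The
    digits of x h^(-p) are those of F, because after removing r of them there
    remains (x - a_0 - .. - a_(r-1)) h^(-p-r), denoted e r below. *)
Lemma rees_series_surj F : exists f, F = rees_series f.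
Proof.
move: F; apply: hlin_surjective => i F Fi; pose n := i.1 + i.2.
pose a (r : nat) : A := val_ (sec (hcoef r F)) (i.1 + r%:Z).
have secP r : sec (hcoef r F) \in gpart (i.1 + r%:Z, i.2 - r%:Z).
  by have := secH (hcoef_hom r Fi); rewrite addr0.
have an r : a r \in gpart n.
  have [h _ _] := rees_homP (secP r); move: h.
  by congr (_ \in gpart _); rewrite /n /=; ring.
have af r : a r \in fil A (i.1 + r%:Z) by exact: rees_fil.
(* the partial sum that determines x modulo F^q A *)
pose N q : nat := if q <= i.1 then 0%N else `|q - i.1|%N.
have NE q : i.1 < q -> (N q)%:Z = q - i.1.
  by move=> h; rewrite /N leNgt h /= gez0_abs // subr_ge0 ltW.
have [x xn xu] : exists2 x, x \in @gpart _ _ A n &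
    forall q, x - \sum_(r < N q) a r \in fil A q.
  apply: fil_complete => [q|q q' qq']; first by apply: rpred_sum => r _.
  have le : (N q <= N q')%N.
    rewrite /N; case: (lerP q i.1) => // h1; rewrite leNgt (lt_le_trans h1 qq') /=.
    have h2 := lt_le_trans h1 qq'.
    by rewrite -lez_nat !gez0_abs ?subr_ge0 ?(ltW h1) ?(ltW h2) ?lerD2r.
  rewrite -(big_mkord xpredT a) -(big_mkord xpredT a) (big_cat_nat _ le) //=.
  rewrite addrAC subrr add0r.
  rewrite big_seq_cond; apply: rpred_sum => r; rewrite mem_index_iota andbT => /andP[h _].
  apply: fil_mono (af r); have [h1|h1] := lerP q i.1.
    by rewrite (le_trans h1) // lerDl.
  by rewrite -lerBlDl -NE // lez_nat.
have xN r : x - \sum_(j < r) a j \in fil A (i.1 + r%:Z).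
  have e : N (i.1 + r%:Z) = r.
    rewrite /N; case: r => [|r]; first by rewrite addr0 lexx.
    by rewrite gerDl [X in `|X|%N]addrAC subrr add0r.
  by have := xu (i.1 + r%:Z); rewrite e.
have /choice[e eP] : forall r : nat, exists f : R, f \in gpart (i.1 + r%:Z, i.2 - r%:Z) /\
    forall p, val_ f p = if p == i.1 + r%:Z then x - \sum_(j < r) a j else 0.
  move=> r; apply: rees_delta; last exact: xN.
  have -> : (i.1 + r%:Z, i.2 - r%:Z).1 + (i.1 + r%:Z, i.2 - r%:Z).2 = n by rewrite /n /=; ring.
  by rewrite smB // rpred_sum.
have eS r : e r = sec (hcoef r F) + rees_h A (e r.+1).
  apply: rees_ext => p.
  rewrite [RHS](_ : _ = val_ (sec (hcoef r F)) p + val_ (e r.+1) (p + 1)) //.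
  have [_ ->] := eP r; have [_ ->] := eP r.+1.
  rewrite intS addrCA [p + 1]addrC (inj_eq (addrI _)).
  have [->|pr] := eqVneq p; last by have [_ _ ->] := rees_homP (secP r); rewrite ?addr0.
  by rewrite big_ord_recr -/(a r) /=; zmodule.
have dS r : dig (e r) = e r.+1.
  by rewrite [X in dig X]eS; exact: (digitE (h := rees_h A) _ secK projh).
have dE r : iter r dig (e 0%N) = e r by elim: r => // r IH; rewrite iterS IH; exact: dS.
exists (e 0%N); apply: hser_ext => r; rewrite hcoef_expansion dE eS linearD secK.
by rewrite projh addr0.
Qed.
End ReesSeries.

Section Transport.
Variables (k : fieldType) (s : nat) (R V : bgmod k) (h : R -> R).
Variables (mR : gmulti R R (alg_deg s)) (La : hlin R (hser V)) (T : {linear hser V -> R}).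
Hypotheses (Lad : hdeg La = 0) (TH : bihomog 0 T).
Hypotheses (TK : forall x, La (T x) = x) (KT : forall x, T (La x) = x).
Hypothesis Lah : forall x, La (h x) = hbar (La x).
Hypothesis mRh : forall l r x, mR (l ++ h x :: r) = h (mR (l ++ x :: r)).
Hypothesis mRA : is_bAinf R mR.

Definition transport_fun xs := La (mR (map T xs)).
Lemma transport0 : transport_fun [::] = 0.
Proof. by rewrite /transport_fun gmulti0 linear0. Qed.
Lemma transport_linear : multilinear transport_fun.
Proof.
by move=> l r a x y; rewrite /transport_fun !map_cat /= linearP (gmultiL mR) linearP.
Qed.
Lemma transport_args ds xs : homog (@gpart _ _ (hser V)) ds xs ->
  homog (@gpart _ _ R) ds (map T xs).
Proof.
elim: xs ds => [|x xs IH] [|d ds] //; rewrite /homog /= => /andP[/TH xd /IH].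
by move: xd; rewrite addr0 => ->.
Qed.
Lemma transport_homog :
  multihomog (@gpart _ _ (hser V)) (@gpart _ _ (hser V)) (alg_deg s) transport_fun.
Proof.
move=> ds xs /transport_args/(gmultiP mR)/(hlinP La).
by rewrite Lad addr0 size_map.
Qed.
Definition transport := Gmulti transport0 transport_linear transport_homog.

Lemma transportE xs : T (transport xs) = mR (map T xs).
Proof. exact: KT. Qed.

Lemma transport_h : forall x, T (hbar x) = h (T x).
Proof. by move=> x; rewrite -{1}(TK x) -Lah KT. Qed.

Lemma transport_hbar : hbar_linear transport.
Proof.
by move=> l r x; rewrite /= /transport_fun !map_cat /= transport_h mRh Lah.
Qed.

Lemma transport_Ainf : is_bAinf (hser V) transport.
Proof.
move=> ds xs hx; rewrite -[LHS]TK /stasheff.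
rewrite (insertion_sum_map tot ds xs transportE transportE).
by rewrite [insertion_sum _ _ _ _ _](mRA (transport_args hx)) linear0.
Qed.

Lemma transport_is_deform : is_deform (Deform (reduce transport) transport).
Proof.
have Xr := reduceP transport_hbar.
split; first exact: reduced_Ainf Xr transport_Ainf.
exact: Ainf_deformation transport_hbar transport_Ainf Xr.
Qed.
End Transport.

(** X is the structure of the Rees algebra, transported along the isomorphism T
    with power series.  The comparison of spectral sequences uses no more of T
    than the compatibilities listed here. *)
Lemma rees_deformation (k : fieldType) (A : filtered_Ainf k) :
  exists (X : gmulti (hser (gr A)) (hser (gr A)) (alg_deg 0))
      (T : {linear hser (gr A) -> rees A}),
  [/\ is_deform (Deform (reduce X) X),
      (forall x, gr_proj A (T x) = hcoef 0 x) /\ (forall x, T (hbar x) = rees_h A (T x)),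
      forall x, T (X [:: x]) = rees_d A (T x)
    & forall x y, T (X [:: x; y]) = rees_mul (T x) (T y)].
Proof.
have [sec [secH secK]] := section_exists (q := gr_proj A) erefl (@gr_proj_surj _ A).
pose La := rees_series secH secK.
have [T [TH TK]] := section_exists (q := La) erefl (rees_series_surj secH secK).
have KT x : T (La x) = x.
  by apply: (rees_series_inj (secH := secH) (secK := secK)); exact: TK.
have Lah x : La (rees_h A x) = hbar (La x).
  by apply: expansion_h => y; apply/gr_exact; exists y.
have Lad : hdeg La = 0 by [].
pose X := transport (rees_m A) Lad TH.
exists X, T; split.
- exact: (transport_is_deform Lad TH TK KT Lah (@rees_m_h _ A) (@rees_Ainf _ A)).
- split; last exact: (transport_h TK KT Lah).
  by move=> x; rewrite -{2}(TK x).
- by move=> x; rewrite -rees_m1; exact: (transportE (rees_m A) Lad TH KT [:: x]).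
- move=> x y; rewrite -rees_m2; exact: (transportE (rees_m A) Lad TH KT [:: x; y]).
Qed.

(** * Iterated classes in an exact couple *)

Section IteratedClasses.
Variables (k : fieldType) (C : ecouple k Z2).
Local Notation pg := (couple_page C).

(** The class on page r of an element of page 0, all of whose differentials up
    to page r vanish. *)
Fixpoint clE (r : nat) : cE C -> cE (pg r) :=
  match r with
  | 0 => fun e => e
  | r'.+1 => fun e => cls (gker (cd (pg r'))) (gim (cd (pg r'))) (clE r' e)
  end.

(** The r-th power of i, as a map onto its image, which is the term D of the r-th
    derived couple. *)
Fixpoint clD (r : nat) : cD C -> cD (pg r) :=
  match r with
  | 0 => fun z => z
  | r'.+1 => fun z => cls (gim (ci (pg r'))) (gzero (cD (pg r'))) (ci (pg r') (clD r' z))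
  end.

Lemma clD_i r z : ci (pg r) (clD r z) = clD r (ci C z).
Proof.
elim: r z => // r IH z.
have e := sqmapE (@ci'Z _ _ (pg r)) (@ci'B _ _ (pg r)) (imi (clD r z)).
by apply: etrans e _; rewrite /= -IH.
Qed.

Lemma clE_j r z : cj (pg r) (clD r z) = clE r (cj C z).
Proof.
elim: r z => // r IH z; apply: etrans (cj'E _) _.
by rewrite IH.
Qed.

Lemma clE_k r e z : ck C e = iter r (ci C) z -> ck (pg r) (clE r e) = clD r z.
Proof.
elim: r e z => // r IH e z; rewrite iterSr => /IH h.
have ez : clE r e \in gker (cd (pg r)).
  by apply/gkerP; rewrite cdE h -clD_i cj_ci.
have e1 := sqmapE (@ck'Z _ _ (pg r)) (@ck'B _ _ (pg r)) ez.
by apply: etrans e1 _; rewrite h -clD_i.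
Qed.

(** The usual description of the differentials: if k e = i^r z then the r-th
    differential sends the class of e to that of j z. *)
Lemma clE_d r e z : ck C e = iter r (ci C) z ->
  cd (pg r) (clE r e) = clE r (cj C z).
Proof. by move=> /clE_k h; rewrite cdE h clE_j. Qed.
End IteratedClasses.

(** * Maps induced in cohomology *)

Section CohMap.
Variables (k : fieldType) (V W : bgmod k) (dV : hlin V V) (dW : hlin W W) (f : V -> W).
Variables (mulV : V -> V -> V) (mulW : W -> W -> W).
Hypothesis fI : algebra_iso mulV mulW f.
Hypothesis fd : forall x, f (dV x) = dW (f x).

Let fL : linear f. Proof. by case: fI. Qed.
Let fD := lin_add fL.
Let f_inj : injective f. Proof. by case: fI => _ /bij_inj. Qed.

Lemma iso_reflects_degree i x : f x \in @gpart _ _ W i -> x \in @gpart _ _ V i.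
Proof.
have [s [g [us gV ->]]] := homsum_uniq (gmod_sum x).
have fH : bihomog 0 f by case: fI.
rewrite (big_morph f fD (add_morph0 fD)) => fxi.
have fgV j : f (g j) \in @gpart _ _ W j by have := fH _ _ (gV j); rewrite addr0.
have := hom_comp us fgV fxi.
rewrite -(big_morph f fD (add_morph0 fD)).
case: ifP => _; first by move/f_inj => ->.
by rewrite -(add_morph0 fD) => /f_inj ->; exact: sm0.
Qed.

(** Through the chosen representatives of classes. *)
Definition coh_map (c : coh dV) : coh dW := hcls dW (f (sqval c)).

Let fker x : x \in gker dV -> f x \in gker dW.
Proof. by move=> /gkerP dx; apply/gkerP; rewrite -fd dx (add_morph0 fD). Qed.

Lemma coh_mapE x : dV x = 0 -> coh_map (hcls dV x) = hcls dW (f x).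
Proof.
move=> dx; have xZ : x \in gker dV by apply/gkerP.
apply/clsP; [exact: fker (sqvalZ _)|exact: fker|].
have /gimP[u e] := sqval_cls (gim dV) xZ.
apply/gimP; exists (f u); rewrite -fd -e.
by rewrite fD (add_morphN _ fD).
Qed.

Lemma coh_mapP c : exists2 x, dV x = 0 & c = hcls dV x.
Proof. by exists (sqval c); [apply/gkerP; exact: sqvalZ|rewrite [RHS]sqvalK]. Qed.

Variable mulH : coh dW -> coh dW -> coh dW.
Hypothesis mulHE : forall x y, dW x = 0 -> dW y = 0 ->
  mulH (hcls dW x) (hcls dW y) = hcls dW (mulW x y).
Hypothesis mulZ : forall x y, dW x = 0 -> dW y = 0 -> dW (mulW x y) = 0.

(** A bijective chain map has a chain map as inverse, so it induces a bijection in
    cohomology. *)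
Lemma coh_map_iso : algebra_iso (coh_mul (d := dV) mulV) mulH coh_map.
Proof.
split.
- move=> a c c'; have [x dx ->] := coh_mapP c; have [y dy ->] := coh_mapP c'.
  have xZ : x \in gker dV by apply/gkerP.
  have yZ : y \in gker dV by apply/gkerP.
  rewrite /hcls -(cls_lin _ a xZ yZ) -!/(hcls _ _) !coh_mapE //; last first.
    by rewrite linearP dx dy scaler0 addr0.
  by rewrite fL /hcls cls_lin // fker.
- have [g fg gf] : bijective f by case: fI.
  have gd y : dW y = 0 -> dV (g y) = 0.
    by move=> dy; apply: f_inj; rewrite fd gf (add_morph0 fD).
  have inj : injective coh_map.
    move=> c c'; have [x dx ->] := coh_mapP c; have [y dy ->] := coh_mapP c'.
    rewrite !coh_mapE // => e.
    have h : f x - f y \in gim dW.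
      by apply/(clsP (gim dW) _ _ ).1; [apply: fker; apply/gkerP|apply: fker; apply/gkerP|].
    apply/clsP; [exact/gkerP|exact/gkerP|].
    have /gimP[u uE] := h; apply/gimP; exists (g u); apply: f_inj.
    by rewrite fd gf -uE fD (add_morphN _ fD).
  have surj c' : exists c, coh_map c = c'.
    have [y dy ->] : exists2 y, dW y = 0 & c' = hcls dW y.
      by exists (sqval c'); [apply/gkerP; exact: sqvalZ|rewrite [RHS]sqvalK].
    by exists (hcls dV (g y)); rewrite coh_mapE ?gd // gf.
  have /choice[h hP] := surj.
  by exists h => c; [apply: inj; rewrite hP|].
- move=> i c /submod_ofP[x [xi xZ ->]]; rewrite -/(hcls dV x) coh_mapE; last exact/gkerP.
  rewrite addr0; apply/submod_ofP; exists (f x); split=> //; last exact: fker.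
  by have fH : bihomog 0 f by [case: fI]; have := fH _ _ xi; rewrite addr0.
- move=> c c'; rewrite /coh_mul.
  have sZ (u : coh dV) : dV (sqval u) = 0 by apply/gkerP; exact: sqvalZ.
  have dfs (u : coh dV) : dW (f (sqval u)) = 0 by rewrite -fd sZ (add_morph0 fD).
  have fM x y : f (mulV x y) = mulW (f x) (f y) by case: fI.
  rewrite coh_mapE; first by rewrite fM -mulHE.
  by apply: f_inj; rewrite fd fM mulZ ?dfs // (add_morph0 fD).
Qed.
End CohMap.

Lemma morphism1 (k : fieldType) (s : nat) (V W : bgmod k) (mV : gmulti V V (alg_deg s))
    (mW : gmulti W W (alg_deg s)) (f : gmulti V W (mor_deg s)) x :
  is_Ainf_morphism tot (@gpart _ _ V) mV mW f -> mW [:: f [:: x]] = f [:: mV [:: x]].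
Proof.
move=> fA; have mVD := multilinear_add (gmultiL mV).
have mWD := multilinear_add (gmultiL mW); have fD := multilinear_add (gmultiL f).
move: x; apply: hom_ext => [x y|x y|i x xi].
- by rewrite (maddP fD [::] [::]) (maddP mWD [::] [::]).
- by rewrite (maddP mVD [::] [::]) (maddP fD [::] [::]).
have hx : homog (@gpart _ _ V) [:: i] [:: x] by rewrite /homog /= xi.
have := fA _ _ hx.
rewrite (insertion_ins (xs := [:: x]) (gmultiL f) (gmultiL mV) (gmulti0 mV) _ hx); last first.
  by exists (alg_deg s); [exact: tot_alg_deg|exact: gmultiP].
rewrite (block_comp (xs := [:: x]) (gmultiL f) _ (gmultiL mW) hx); last first.
  by exists (mor_deg s); [exact: tot_mor_deg|exact: gmultiP].
rewrite comp_cons split_nil comp_nil /ins split_cons !split_nil split_cons split_nil /=.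
by rewrite gmulti0 linear0 (madd0 fD [::]) (madd0 fD [:: _]) add0r addr0.
Qed.

(** * Comparison of the two spectral sequences *)

Section Compare.
Variables (k : fieldType) (X0 : deform_data k 0).
Variable ch : forall s (X : deform_data k s), model_data X.
Hypothesis valid : valid_procedure X0 ch.
Local Notation st := (stage X0 ch).

Let D r (x : hser (dB (st r))) : hser (dB (st r)) := dtm (st r) [:: x].
Let tf r (x : hser (dB (st r.+1))) : hser (dB (st r)) := mo_tf (ch (st r)) [:: x].
Let d r : hlin (dB (st r)) (dB (st r)) := arity1 (dm (st r)).

Let st_deform r : is_deform (st r). Proof. by case: (valid r). Qed.
Let st_model r : is_model (ch (st r)). Proof. by case: (valid r). Qed.
Let st_mdef r : is_model_deformation (ch (st r)). Proof. by case: (valid r). Qed.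
Let st_Ainf r : is_bAinf (dB (st r)) (dm (st r)) := proj1 (st_deform r).

Let dd r x : d r (d r x) = 0. Proof. exact: (m1_square (@st_Ainf r)). Qed.
Let leib r x y : d r (dm (st r) [:: x; y])
   = dm (st r) [:: d r x; y] + dm (st r) [:: tau x; d r y].
Proof. exact: (m2_leibniz (@st_Ainf r)). Qed.

Let D0 r (x : hser (dB (st r))) : hcoef 0 (D x) = d r (hcoef 0 x).
Proof. by have [_ [_ _ red]] := st_deform r; exact: red. Qed.

Let tf0 r (x : hser (dB (st r.+1))) : hcoef 0 (tf x) = mo_f (ch (st r)) [:: hcoef 0 x].
Proof. by have [_ _ red _] := st_mdef r; exact: red. Qed.

Let tfh r (x : hser (dB (st r.+1))) : tf (hbar x) = hbar (tf x).
Proof. by have [_ [h _] _ _] := st_mdef r; exact: (h [::] [::]). Qed.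

(* The differential of the next stage is h^(-1) times that of the model. *)
Let Dtf r (x : hser (dB (st r.+1))) : D (tf x) = hbar (tf (D x)).
Proof.
have [[_ _ red] [_ h] _ _] := st_mdef r; have [_ m0 _ _ _] := st_model r.
have mor : is_Ainf_morphism tot (@gpart _ _ (hser _)) (mo_tm (ch (st r)))
    (dtm (st r)) (mo_tf (ch (st r))).
  move=> ds xs hx; apply/eqP; rewrite -subr_eq0; apply/eqP.
  by apply: hbarX_eq0 => n; exact: h.
rewrite -tfh; apply: etrans (morphism1 x mor) _; congr (mo_tf _ [:: _]).
apply/esym; apply: hbar_invK; apply: etrans (red _) _; exact: m0.
Qed.

Let mof_cycle r c : d r (mo_f (ch (st r)) [:: c]) = 0.
Proof. by have [_ _ _ _ /(_ c)[]] := st_model r. Qed.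
Let mof_cls r c : hcls (d r) (mo_f (ch (st r)) [:: c]) = c.
Proof. by have [_ _ _ _ /(_ c)[]] := st_model r. Qed.
Let mo_mul r x y : d r x = 0 -> d r y = 0 ->
  dm (st r.+1) [:: hcls (d r) x; hcls (d r) y] = hcls (d r) (dm (st r) [:: x; y]).
Proof. by have [_ _ h _ _] := st_model r; exact: h. Qed.
Let mul_cycle r x y : d r x = 0 -> d r y = 0 -> d r (dm (st r) [:: x; y]) = 0.
Proof.
move=> dx dy; rewrite leib dx dy; have mD := multilinear_add (gmultiL (dm (st r))).
by rewrite (madd0 mD [::]) (madd0 mD [:: _]) addr0.
Qed.

Variables (C : ecouple k Z2) (mulC : cE C -> cE C -> cE C).
Local Notation pg := (couple_page C).
Variables (R : Type) (dR hR : R -> R) (cl0 : R -> cE C) (T : hser (dB X0) -> R).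
Hypothesis Th : forall x, T (hbar x) = hR (T x).
Hypothesis Td : forall x, dR (T x) = T (dtm X0 [:: x]).
Hypothesis cl_d : forall r x y, dR x = iter r.+1 hR y ->
  cd (pg r) (clE r (cl0 x)) = clE r (cl0 y).
Variable phi0 : cE C -> dB (st 1).
Hypothesis phi0I : algebra_iso mulC (fun x y => dm (st 1) [:: x; y]) phi0.
Hypothesis phi0E : forall x, phi0 (cl0 (T (mo_tf (ch X0) [:: x]))) = hcoef 0 x.

(** The composite of the quasi-isomorphisms of the first r steps of the procedure. *)
Fixpoint descend (r : nat) : hser (dB (st r)) -> R :=
  match r with
  | 0 => T
  | r'.+1 => fun x => descend (tf x)
  end.

Let descend_h r x : descend (r := r) (hbar x) = hR (descend x).
Proof.
elim: r x => [|r IH] x; first exact: Th.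
exact: etrans (congr1 _ (tfh x)) (IH _).
Qed.

Let descend_d r x : dR (descend (r := r) x) = iter r hR (descend (D x)).
Proof.
elim: r x => [|r IH] x; first exact: Td.
apply: etrans (IH (tf x)) _; rewrite Dtf descend_h -iterSr.
by [].
Qed.

Fixpoint page_map (r : nat) : cE (pg r) -> dB (st r.+1) :=
  match r with
  | 0 => phi0
  | r'.+1 => coh_map (dV := cd (pg r')) (d r'.+1) (@page_map r')
  end.

(* By induction on r.  Every class of page r comes from some descend x, where x
   may be chosen constant, and by cl_d and descend_d its differential comes from
   descend (D x).  Under the page map these become the constant term of x and
   its differential, which is the third property.  It makes the next map well
   defined on cohomology.  The second property for r + 1 follows because f_1 of
   the model sends an element of the cohomology to a representative of it. *)
Let page_map_spec r :
  [/\ algebra_iso (couple_mul mulC (r := r)) (fun x y => dm (st r.+1) [:: x; y])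
        (@page_map r),
      forall x, page_map (clE r (cl0 (descend (r := r.+1) x))) = hcoef 0 x
    & forall c, page_map (cd (pg r) c) = d r.+1 (page_map c)].
Proof.
have comm s : algebra_iso (couple_mul mulC (r := s)) (fun x y => dm (st s.+1) [:: x; y])
        (@page_map s) ->
   (forall x, page_map (clE s (cl0 (descend (r := s.+1) x))) = hcoef 0 x) ->
   forall c, page_map (cd (pg s) c) = d s.+1 (page_map c).
  move=> [_ /bij_inj inj _ _] E c.
  pose x : hser (dB (st s.+1)) := hconst (page_map c).
  have -> : c = clE s (cl0 (descend (r := s.+1) x)).
    by apply: inj; rewrite E hcoef0_const.
  by rewrite (cl_d (descend_d x)) !E D0.
elim: r => [|r [iso E fd]].
  by split; [exact: phi0I|exact: phi0E|exact: comm].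
have iso' : algebra_iso (couple_mul mulC (r := r.+1)) (fun x y => dm (st r.+2) [:: x; y])
        (@page_map r.+1).
  apply: (coh_map_iso iso fd (mulH := fun x y => dm (st r.+2) [:: x; y])).
  - exact: mo_mul.
  - exact: mul_cycle.
have E' x : page_map (clE r.+1 (cl0 (descend (r := r.+2) x))) = hcoef 0 x.
  have [_ /bij_inj inj _ _] := iso.
  have e1 : page_map (clE r (cl0 (descend (r := r.+2) x))) = hcoef 0 (tf x).
    exact: E.
  have ez : cd (pg r) (clE r (cl0 (descend (r := r.+2) x))) = 0.
    apply: inj; rewrite fd e1 tf0 mof_cycle.
    by apply/esym/add_morph0/lin_add; case: iso.
  apply: etrans (coh_mapE iso fd ez) _.
  by rewrite e1 tf0 mof_cls.
by split=> //; exact: comm.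
Qed.

Let iso r := let: And3 h _ _ := page_map_spec r in h.
Let fd r := let: And3 _ _ h := page_map_spec r in h.

(* The axioms hold for the dg algebra of stage r + 1. *)
Let page_dg r : dg_algebra_page r.+1 (cd (pg r)) (couple_mul mulC (r := r)).
Proof.
have [fL fB fH fM] := iso r; have inj := bij_inj fB; have fD := lin_add fL.
have mL := gmultiL (dm (st r.+1)).
have m3 x y z : dm (st r.+1) [:: x; y; z] = 0 by [].
split.
- move=> i x xi; apply: (iso_reflects_degree (iso r)); rewrite fd.
  have := hlinP (d r.+1) (fH _ _ xi); rewrite addr0; congr (_ \in gpart (_ + _)).
  by apply: Z2_eq; rewrite /=; ring.
- by move=> x; apply: inj; rewrite !fd dd (add_morph0 fD).
- by move=> y a x x'; apply: inj; rewrite fM fL (mL [::] [:: _]) fL !fM.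
- by move=> x a y y'; apply: inj; rewrite fM fL (mL [:: _] [::]) fL !fM.
- move=> i j x y xi yj; apply: (iso_reflects_degree (iso r)); rewrite fM.
  have hxy : homog (@gpart _ _ (dB (st r.+1))) [:: i; j] [:: page_map x; page_map y].
    by rewrite /homog /=; have := fH _ _ xi; have := fH _ _ yj; rewrite !addr0 => -> ->.
  have := gmultiP (dm (st r.+1)) hxy; rewrite big_cons big_seq1.
  by congr (_ \in gpart _); apply: Z2_eq; rewrite /=; ring.
- by move=> x y z; apply: inj; rewrite !fM (m2_assoc (@st_Ainf r.+1) m3).
- move=> i x y xi; apply: inj; rewrite fd fM leib fD (lin_scale fL) !fM !fd; congr (_ + _).
  have := fH _ _ xi; rewrite addr0 => fxi.
  by rewrite (tauE fxi) (multilinearZ [::] [:: _]).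
Qed.

(** The pages of the two spectral sequences are identified by the page_map r; the
    identification of the cohomology of a page with the next page is the
    identity on both sides. *)
Lemma couple_ss_enhanced : has_Ainf_enhancement (couple_ss mulC).
Proof.
split.
  move=> r; split; first exact: page_dg.
  split=> //; first by exists id.
  by move=> i x xi; rewrite addr0.
exists X0, ch; split=> //.
exists page_map; split=> [r|r x|r x dx].
- exact: iso.
- exact: fd.
- exact: (coh_mapE (iso r) (@fd r) dx).
Qed.
End Compare.

(** * The spectral sequence of a filtered A-infinity algebra *)

Section Filtration.
Variables (k : fieldType) (A : filtered_Ainf k).
Local Notation C := (filtration_couple A).
Local Notation h := (rees_h A).
Local Notation dR := (rees_d A).

Definition gr_class (x : rees A) : cE C := hcls (gr_d A) (gr_proj A x).

(** The connecting map sends the class of x, with d x = h^(r+1) y, to the class of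
    h^r y, which is i^r of the class of y. *)
Lemma gr_class_d r x y : dR x = iter r.+1 h y ->
  cd (couple_page C r) (clE r (gr_class x)) = clE r (gr_class y).
Proof.
move=> e.
have dy : dR y = 0.
  have hd n z : dR (iter n h z) = iter n h (dR z).
    by elim: n => // n IH; rewrite !iterS -rees_hd IH.
  have := congr1 dR e; rewrite rees_d2 hd => /esym.
  elim: (r.+1) => // n IH eh; apply: IH; apply: rees_h_inj.
  by rewrite -iterS eh linear0.
have yZ : y \in gker dR by apply/gkerP.
have hZ n : iter n h y \in gker dR.
  by elim: n => // n /gkerP IH; apply/gkerP; rewrite iterS -rees_hd IH linear0.
pose cy : cD C := hcls dR y.
have ciE n : iter n (ci C) cy = hcls dR (iter n h y).
  elim: n => // n IH; apply: etrans (congr1 (ci C) IH) _.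
  exact: (sqmapE _ _ (hZ n)).
have xh : gr_proj A x \in gker (gr_d A).
  apply/gkerP; rewrite -gr_projd e; apply/gr_exact; by exists (iter r h y).
have ckE : ck C (gr_class x) = iter r (ci C) cy.
  by rewrite ciE; apply: les_kE xh _.
rewrite (clE_d ckE); congr (clE r _); exact: (sqmapE _ _ yZ).
Qed.
End Filtration.

Section Procedure.
Variable k : fieldType.

Lemma zero_multihomog (V W : bgmod k) dg :
  multihomog (@gpart _ _ V) (@gpart _ _ W) dg (fun _ : seq V => 0 : W).
Proof. by move=> ds xs _; exact: sm0. Qed.
Lemma zero_multilinear (V W : bgmod k) : multilinear (fun _ : seq V => 0 : W).
Proof. by move=> l r a x y; rewrite scaler0 addr0. Qed.
Definition zero_gmulti (V W : bgmod k) dg : gmulti V W dg :=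
  Gmulti (erefl 0) (@zero_multilinear V W) (@zero_multihomog V W dg).

(** By choice of a model for each deformation; the value on structure maps that are
    not deformations is arbitrary.  As the models are minimal, each stage is a
    deformation again. *)
Lemma procedure_exists (X0 : deform_data k 0) : is_deform X0 ->
  exists ch, valid_procedure X0 ch.
Proof.
move=> X0def.
have h s (X : deform_data k s) : exists M : model_data X,
    is_deform X -> is_model M /\ is_model_deformation M.
  have [/model_exists[M MP]|n] := pselect (is_deform X); first by exists M.
  by exists (Model (zero_gmulti _ _ _) (zero_gmulti _ _ _) (zero_gmulti _ _ _)
    (zero_gmulti _ _ _)).
pose ch s (X : deform_data k s) : model_data X := sval (cid (h s X)).
have chP s (X : deform_data k s) : is_deform X ->
    is_model (ch s X) /\ is_model_deformation (ch s X) := svalP (cid (h s X)).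
exists ch; suff st r : is_deform (stage X0 ch r).
  by move=> r; have [h1 h2] := chP _ _ (st r).
elim: r => // r IH; have [[_ m0 _ _ _] [def _ _ _]] := chP _ _ IH.
exact: PT_is_deform.
Qed.
End Procedure.

Theorem proposition5p6 (k : fieldType) (A : filtered_Ainf k)
    (bg : Z2 -> submodClosed A)
    (hbg : compatible_bigrading 0 (fm A) bg) :
  has_Ainf_enhancement (filtration_ss A).
Proof.
have [X [T [Xdef [projT Th] Td Tmul]]] := rees_deformation A.
pose X0 : deform_data k 0 := Deform (reduce X) X.
have [ch valid] := procedure_exists Xdef.
have [_ [_ _ red]] := Xdef.
(* the differential and product of gr A are the reductions of those of X, since
   T (hconst z) is an element of the Rees module that represents z *)
have dE x : gr_d A x = reduce X [:: x].
  apply/esym; apply: etrans (esym (projT (X [:: hconst x]))) _.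
  by rewrite Td gr_projd projT hcoef0_const.
have mulE x y : gr_mul x y = reduce X [:: x; y].
  apply/esym; apply: etrans (esym (projT (X [:: hconst x; hconst y]))) _.
  rewrite Tmul /gr_mul -!rees_m2.
  have repr z : exists u, T (hconst z) = sqval z + rees_h A u.
    have /gr_exact[u e] : gr_proj A (T (hconst z) - sqval z) = 0.
      by rewrite linearB projT hcoef0_const [X in _ - X](sqvalK z) subrr.
    by exists u; rewrite -e addrC subrK.
  have [u ->] := repr x; have [v ->] := repr y.
  have mD := multilinear_add (gmultiL (rees_m A)).
  have projh w : gr_proj A (rees_h A w) = 0 by apply/gr_exact; exists w.
  rewrite (maddP mD [::]) linearD (rees_m_h [::]) projh addr0.
  by rewrite (maddP mD [:: _]) linearD (rees_m_h [:: _]) projh addr0.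
have idI : algebra_iso (@gr_mul _ A) (fun x y => reduce X [:: x; y]) id.
  by split=> //; [exists id|move=> i x xi; rewrite addr0].
have [_ [_ _ mo_mul _ mo_sec] [_ _ tf_red _]] := valid 0%N.
have mA : is_bAinf _ _ := proj1 Xdef.
have mD := multilinear_add (gmultiL (reduce X)).
(* the first pages are the cohomology of gr A, represented in two ways *)
apply: (couple_ss_enhanced (C := filtration_couple A)
  (mulC := coh_mul (d := gr_d A) (@gr_mul _ A)) valid Th
  (fun x => esym (Td x)) (@gr_class_d _ A)
  (phi0 := coh_map (dV := gr_d A) (arity1 (dm X0)) id)).
- apply: (coh_map_iso (dW := arity1 (dm X0)) idI dE
    (mulH := fun x y => dm (stage X0 ch 1) [:: x; y])); first exact: mo_mul.
  move=> x y dx dy; apply: etrans (m2_leibniz mA x y) _.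
  have dx' : reduce X [:: x] = 0 := dx; have dy' : reduce X [:: y] = 0 := dy.
  by rewrite dx' dy' (madd0 mD [::]) (madd0 mD [:: _]) addr0.
- move=> x; have [z_cycle z_cls] := mo_sec (hcoef 0 x).
  pose z : gr A := mo_f (ch 0%N X0) [:: hcoef 0 x].
  have zE : gr_proj A (T (mo_tf (ch 0%N X0) [:: x])) = z.
    exact: etrans (projT _) (tf_red [:: x]).
  have dz : gr_d A z = 0 := etrans (dE z) z_cycle.
  rewrite /gr_class zE.
  exact: etrans (coh_mapE (dW := arity1 (dm X0)) idI dE dz) z_cls.
Qed.
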